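(* Assume $p>n$, $n\ge 2$, and $u\in\mathcal{D}^{1,p}(\mathbb{R}^n)$ is the Morrey extremal which satisfies $$\sup_{x\neq y}\left\{\frac{|u(x)-u(y)|}{|x-y|^{1-n/p}}\right\}=\frac{|u(e_n)-u(-e_n)|}{|e_n-(-e_n)|^{1-n/p}},\qquad u(e_n)=1,\qquad u(-e_n)=-1.$$ If $x^1,x^2\in\mathbb{R}^n$ with $$x^1_n=x^2_n\ge 0\quad\text{and}\quad |x^2|\le|x^1|,$$ or if $$x^1_n=x^2_n\le 0\quad\text{and}\quad |x^1|\le|x^2|,$$ then $$u(x^1)\le u(x^2).$$
   Context: $\mathcal{D}^{1,p}(\mathbb{R}^n)$ is the space of weakly differentiable functions $u:\mathbb{R}^n\to\mathbb{R}$ whose first-order weak partial derivatives $u_{x_1},\dots,u_{x_n}$ belong to $L^p(\mathbb{R}^n)$; $Du$ is the weak gradient. Since $p>n$, each such $u$ agrees a.e. with a Hölder continuous function of exponent $1-n/p$, and $u$ is always identified with this continuous representative. $e_n\in\mathbb{R}^n$ is the point with $1$ in its $n$th coordinate and $0$ otherwise; $x^i_n$ denotes the $n$th coordinate of $x^i$. Morrey's inequality states that there is a constant $C$ with $$\sup_{x\neq y}\left\{\frac{|v(x)-v(y)|}{|x-y|^{1-n/p}}\right\}\le C\left(\int_{\mathbb{R}^n}|Dv|^p\,dx\right)^{1/p}\quad\text{for all } v\in\mathcal{D}^{1,p}(\mathbb{R}^n).$$ There is a smallest such constant $C_*>0$. A Morrey extremal is a nonconstant $u\in\mathcal{D}^{1,p}(\mathbb{R}^n)$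 for which equality holds in Morrey's inequality with $C=C_*$. It is known (from earlier work) that a Morrey extremal satisfying the normalization in the claim exists and is unique, which is the reason for the word ''the''. *)

(* Defs.v *)
From HB Require Import structures.
From mathcomp Require Import all_boot all_order all_algebra.
From mathcomp Require Import all_classical all_reals all_analysis.

Set Implicit Arguments.
Unset Strict Implicit.
Unset Printing Implicit Defensive.

Import Order.TTheory GRing.Theory Num.Theory.
Import numFieldNormedType.Exports.

Local Open Scope classical_set_scope.
Local Open Scope ring_scope.

Definition rV_display : measure_display. Proof. exact. Qed.

Section rV_measurable.
Context {R : realType} {n : nat}.

(* Generated by the coordinates, as the library does for [n.-tuple T]; since R
   is second countable this is the Borel sigma-algebra. *)
Let coor (i : 'I_n) (v : 'rV[R]_n) : measurableTypeR R := v ord0 i.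

Let rV_set0 : g_sigma_preimage coor set0.
Proof. exact: sigma_algebra0. Qed.

Let rV_setC A : g_sigma_preimage coor A -> g_sigma_preimage coor (~` A).
Proof. exact: sigma_algebraC. Qed.

Let rV_bigcup (F : (set 'rV[R]_n)^nat) :
  (forall i, g_sigma_preimage coor (F i)) ->
  g_sigma_preimage coor (\bigcup_i (F i)).
Proof. exact: sigma_algebra_bigcup. Qed.

HB.instance Definition _ := @isMeasurable.Build rV_display
  'rV[R]_n (g_sigma_preimage coor) rV_set0 rV_setC rV_bigcup.

Lemma measurable_coor (i : 'I_n) :
  measurable_fun [set: 'rV[R]_n] (fun v => v ord0 i : measurableTypeR R).
Proof.
move=> _ Y mY; rewrite setTI; apply: sub_sigma_algebra => /=.
rewrite -bigcup_seq/=; exists i => /=; first by rewrite mem_index_enum.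
by exists Y => //; rewrite setTI.
Qed.

Lemma measurable_fun_rV d (T : measurableType d) (f : T -> 'rV[R]_n) :
  (forall i, measurable_fun [set: T]
               (fun x => f x ord0 i : measurableTypeR R)) ->
  measurable_fun [set: T] f.
Proof.
move=> mf; apply: (@measurability _ _ _ _ setT f
  (\big[setU/set0]_(i < n) preimage_set_system setT (coor i) measurable)) => //.
move=> _ [B + <-]; rewrite -bigcup_seq/= => -[i _ [A mA <-]].
by rewrite !setTI -[X in measurable X]setTI; exact: mf.
Qed.

End rV_measurable.

Section rV_cons.
Context {R : realType} {n : nat}.

Definition rV_cons (t : R) (v : 'rV[R]_n) : 'rV[R]_n.+1 :=
  \row_i (if unlift ord0 i is Some j then v ord0 j else t).

Definition rV_behead (w : 'rV[R]_n.+1) : 'rV[R]_n :=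
  \row_j w ord0 (lift ord0 j).

Lemma rV_cons0 t v : rV_cons t v ord0 ord0 = t.
Proof. by rewrite mxE unlift_none. Qed.

Lemma rV_consS t v j : rV_cons t v ord0 (lift ord0 j) = v ord0 j.
Proof. by rewrite mxE liftK. Qed.

Lemma rV_consK t v : rV_behead (rV_cons t v) = v.
Proof. by apply/rowP => j; rewrite mxE rV_consS. Qed.

Lemma rV_consE (w : 'rV[R]_n.+1) : rV_cons (w ord0 ord0) (rV_behead w) = w.
Proof.
apply/rowP => i; case: (unliftP ord0 i) => [j|] ->.
  by rewrite rV_consS mxE.
by rewrite rV_cons0.
Qed.

Lemma measurable_rV_cons :
  measurable_fun [set: measurableTypeR R * 'rV[R]_n]
    (fun x => rV_cons x.1 x.2).
Proof.
apply: measurable_fun_rV => i; case: (unliftP ord0 i) => [j|] ->.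
  under eq_fun do rewrite rV_consS.
  exact: (measurableT_comp (measurable_coor j) measurable_snd).
under eq_fun do rewrite rV_cons0.
exact: measurable_fst.
Qed.

Lemma measurable_rV_behead : measurable_fun [set: 'rV[R]_n.+1] rV_behead.
Proof.
apply: measurable_fun_rV => i; under eq_fun do rewrite mxE.
exact: measurable_coor.
Qed.

End rV_cons.

Section rV_cons_measure.
Context {R : realType} {n : nat} (m : {sigma_finite_measure set 'rV[R]_n -> \bar R}).
Local Open Scope ereal_scope.

Definition rV_cons_measure : set 'rV[R]_n.+1 -> \bar R :=
  pushforward (@lebesgue_measure R \x m) (fun x => rV_cons x.1 x.2).

Let rV_cons_measure0 : rV_cons_measure set0 = 0.
Proof. by rewrite /rV_cons_measure /pushforward preimage_set0 measure0. Qed.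

Let rV_cons_measure_ge0 A : 0 <= rV_cons_measure A.
Proof. by rewrite /rV_cons_measure /pushforward measure_ge0. Qed.

Let rV_cons_measure_sigma_additive : semi_sigma_additive rV_cons_measure.
Proof.
have mc (A : set 'rV[R]_n.+1) : measurable A ->
    measurable ((fun x : measurableTypeR R * 'rV[R]_n => rV_cons x.1 x.2) @^-1` A).
  by move=> mA; rewrite -[X in measurable X]setTI; exact: measurable_rV_cons.
move=> F mF tF mUF; rewrite /rV_cons_measure /pushforward preimage_bigcup.
apply: measure_semi_sigma_additive.
- by move=> k; exact: mc.
- apply/trivIsetP => /= i j _ _ ij; rewrite -preimage_setI.
  by move/trivIsetP : tF => /(_ _ _ _ _ ij) ->//; rewrite preimage_set0.
- by rewrite -preimage_bigcup; exact: mc.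
Qed.

HB.instance Definition _ := isMeasure.Build _ _ _ rV_cons_measure
  rV_cons_measure0 rV_cons_measure_ge0 rV_cons_measure_sigma_additive.

Lemma rV_cons_measureX (A : set (measurableTypeR R)) (B : set 'rV[R]_n) :
  measurable A -> measurable B ->
  rV_cons_measure [set w : 'rV[R]_n.+1 | A (w ord0 ord0) /\ B (rV_behead w)] =
  lebesgue_measure A * m B.
Proof.
move=> mA mB; rewrite -product_measure1E//; congr (product_measure1 _ _ _).
by apply/seteqP; split => -[t v]; rewrite /= rV_cons0 rV_consK.
Qed.

Let rV_cons_measure_sigma_finite : sigma_finite setT rV_cons_measure.
Proof.
have /sigma_finiteP[F [TF ndF Foo]] := sigma_finiteT (@lebesgue_measure R).
have /sigma_finiteP[G [TG ndG Goo]] := sigma_finiteT m.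
exists (fun k => [set w : 'rV[R]_n.+1 | F k (w ord0 ord0) /\ G k (rV_behead w)]).
  apply/seteqP; split => // w _.
  have : [set: R] (w ord0 ord0) by [].
  have : [set: 'rV[R]_n] (rV_behead w) by [].
  rewrite TF TG => -[k _ Gk] [l _ Fl]; exists (maxn k l) => //; split.
  - by move: Fl; exact/subsetPset/ndF/leq_maxr.
  - by move: Gk; exact/subsetPset/ndG/leq_maxl.
move=> k; have [mF Fk] := Foo k; have [mG Gk] := Goo k; split.
  apply: measurableI.
    by have := @measurable_coor R n.+1 ord0 measurableT _ mF; rewrite setTI.
  by have := @measurable_rV_behead R n measurableT _ mG; rewrite setTI.
by rewrite rV_cons_measureX// lte_mul_pinfty// ge0_fin_numE.
Qed.

HB.instance Definition _ := Measure_isSigmaFinite.Build _ _ _ rV_cons_measure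
  rV_cons_measure_sigma_finite.

End rV_cons_measure.

Fixpoint lebesgue_rV {R : realType} (n : nat) :
    {sigma_finite_measure set 'rV[R]_n -> \bar R} :=
  match n with
  | 0%N => \d_(0 : 'rV[R]_0)
  | n'.+1 => rV_cons_measure (lebesgue_rV n')
  end.

Lemma measurable_rV_box (R : realType) n (A : 'I_n -> set (measurableTypeR R)) :
  (forall i, measurable (A i)) ->
  measurable [set v : 'rV[R]_n | forall i, A i (v ord0 i)].
Proof.
move=> mA; rewrite [X in measurable X](_ : _ =
    \bigcap_(i in [set: 'I_n]) ((fun v : 'rV[R]_n => v ord0 i) @^-1` A i)).
  apply: fin_bigcap_measurable => // i _.
  by have := @measurable_coor R n i measurableT _ (mA i); rewrite setTI.
by apply/seteqP; split => v vA i; [move=> _|]; exact: vA.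
Qed.

Lemma lebesgue_rV_box (R : realType) n (A : 'I_n -> set (measurableTypeR R)) :
  (forall i, measurable (A i)) ->
  lebesgue_rV n [set v : 'rV[R]_n | forall i, A i (v ord0 i)] =
  (\prod_(i < n) lebesgue_measure (A i))%E.
Proof.
elim: n A => [|n IH] A mA.
  rewrite big_ord0 /= diracE mem_set// => -[].
  by [].
rewrite big_ord_recl -IH => [|i]; last exact: mA.
rewrite -[RHS](rV_cons_measureX _ (mA _) (measurable_rV_box (fun i => mA _))).
congr (rV_cons_measure _ _); apply/seteqP; split => w /=.
  by move=> wA; split => // j; rewrite mxE.
move=> [w0 wS] i; case: (unliftP ord0 i) => [j|] -> //.
by have := wS j; rewrite mxE.
Qed.

Section morrey.
Context {R : realType} {n : nat}.
Implicit Types (x y : 'rV[R]_n) (u v phi : 'rV[R]_n -> R).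
Implicit Types (G : 'rV[R]_n -> 'rV[R]_n) (p C : R).

Local Notation mu := (lebesgue_rV n : {measure set 'rV[R]_n -> \bar R}).

(* The library norm [`|x|] on row vectors is the sup norm. *)
Definition enorm x : R := Num.sqrt (\sum_(i < n) x ord0 i ^+ 2).

Definition basis_vec (i : 'I_n) : 'rV[R]_n := delta_mx ord0 i.

Definition partial (i : 'I_n) u : 'rV[R]_n -> R := 'D_(basis_vec i) u.

Definition smooth phi : Prop := forall s : seq 'I_n,
  continuous (foldr partial phi s) /\
  forall i x, derivable (foldr partial phi s) x (basis_vec i).

Definition test_function phi : Prop :=
  smooth phi /\ compact (closure [set x | phi x != 0]).

Definition locally_integrable_rV u : Prop :=
  measurable_fun [set: 'rV[R]_n] u /\
  forall K : set 'rV[R]_n, compact K -> (\int[mu]_(x in K) `|u x|%:E < +oo)%E.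

Definition weak_partial (i : 'I_n) u g : Prop :=
  [/\ locally_integrable_rV u, locally_integrable_rV g &
      forall phi, test_function phi ->
        (\int[mu]_x (u x * partial i phi x)%:E =
         - \int[mu]_x (g x * phi x)%:E)%E].

(* [D1p p u Du]: u is the continuous representative of an element of D^{1,p}
   whose weak gradient is Du.  The weak gradient is only determined almost
   everywhere, hence a relation rather than a function of u. *)
Definition D1p p u (Du : 'rV[R]_n -> 'rV[R]_n) : Prop :=
  continuous u /\
  forall i : 'I_n, weak_partial i u (fun x => Du x ord0 i) /\
                   (fun x => Du x ord0 i) \in Lfun mu p%:E.

Definition holder_quotient p u x y : R :=
  `|u x - u y| / enorm (x - y) `^ (1 - n%:R / p).

Definition holder_seminorm p u : \bar R :=
  ereal_sup [set (holder_quotient p u xy.1 xy.2)%:E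
            | xy in [set xy : 'rV[R]_n * 'rV[R]_n | xy.1 != xy.2]].

Definition gradient_norm p (Du : 'rV[R]_n -> 'rV[R]_n) : \bar R :=
  ((\int[mu]_x (enorm (Du x) `^ p)%:E) `^ p^-1)%E.

Definition morrey_inequality p C : Prop :=
  forall v Dv, D1p p v Dv ->
    (holder_seminorm p v <= C%:E * gradient_norm p Dv)%E.

Definition sharp_morrey_constant p C : Prop :=
  morrey_inequality p C /\ forall C', morrey_inequality p C' -> C <= C'.

Definition morrey_extremal p u : Prop :=
  exists C Du, [/\ sharp_morrey_constant p C,
    D1p p u Du,
    exists x y, u x != u y &
    holder_seminorm p u = (C%:E * gradient_norm p Du)%E].

End morrey.

(* Main.v *)
(* Normalize C |Dv|_p >= [v] >= |v(e_n) - v(-e_n)| / 2^(1 - n/p): an extremal u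
   attaining its Hoelder seminorm at e_n, -e_n minimizes |Dv|_p among all v with
   v(e_n) - v(-e_n) >= 2, and since p >= 2 Clarkson's inequality makes it unique
   up to a constant.  Comparing u with -u(x', -x_n) shows that u is odd in x_n,
   hence 0 on x_n = 0.  If x^1, x^2 have the same positive nth coordinate and
   |x^2| < |x^1|, let S be the reflection exchanging them; it acts on x_n > 0 and
   e_n lies on the side of x^2.  On x_n > 0 replace u by max(u, u o S) on that
   side and by min(u, u o S) on the other one.  This keeps the energy and the
   normalization, so by uniqueness it does not change u, i.e. u(x^1) <= u(x^2).
   Equality |x^2| = |x^1| and x_n = 0 follow by continuity, x_n < 0 by oddness.
   The weak chain rule for max(., 0) is proved by mollification. *)
Require Import Defs.
From HB Require Import structures.
From mathcomp Require Import all_boot all_order all_algebra.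
From mathcomp Require Import all_classical all_reals all_analysis.
From mathcomp Require Import measurable_realfun ring lra.

Set Implicit Arguments.
Unset Strict Implicit.
Unset Printing Implicit Defensive.

Import Order.TTheory GRing.Theory Num.Theory.
Import numFieldNormedType.Exports.

Local Open Scope classical_set_scope.
Local Open Scope ring_scope.

(** * Measure-preserving affine maps *)

(** Polarizing across [S] on the whole space would not do: the mirror is parallel to the last axis,
    so [e_n] and [- e_n] lie on the same side, both values could go up, and the gap between them
    would be out of control. Cutting off at [x_n = 0] confines the change near the two poles to the
    one at [e_n], and oddness makes this cut continuous, as [u] and [u o S] both vanish there. The
    price is an indicator factor, harmless for weak derivatives only because the function whose
    positive part it multiplies is at most [0] on the boundary of the cut. The chain rule is
    therefore proved in one piece for [chi l * max(f, 0)], with [max] approximated by functions that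
    vanish below a positive threshold. Written as [u + (E - E o S)], the polarized function arises
    from [u] by linear combinations, reflections and cut-off positive parts, three operations under
    which [D1p] is stable with explicit gradients. Lebesgue measure being an iterated product here,
    its invariance under a general reflection has itself to be derived. *)

Section measure_preserving.
Context {R : realType}.

Definition measure_preserving n (T : 'rV[R]_n -> 'rV[R]_n) :=
  measurable_fun [set: 'rV[R]_n] T /\
  forall A, measurable A -> lebesgue_rV n (T @^-1` A) = lebesgue_rV n A.

Lemma measure_preserving_comp n (S T : 'rV[R]_n -> 'rV[R]_n) :
  measure_preserving S -> measure_preserving T ->
  measure_preserving (S \o T).
Proof.
move=> [mS muS] [mT muT]; split; first exact: measurableT_comp.
move=> A mA; rewrite comp_preimage muT ?muS//.
by rewrite -[X in measurable X]setTI; exact: mS.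
Qed.

(** Lebesgue measure is determined by its values on the intervals []b, c]], and the preimage []b -
    a, c - a]] has the same length. *)
Lemma lebesgue_measure_shift (a : R) (A : set (measurableTypeR R)) :
  measurable A ->
  lebesgue_measure ((fun t : measurableTypeR R => t + a) @^-1` A) =
  lebesgue_measure A.
Proof.
move=> mA.
have mf : measurable_fun setT (fun t : measurableTypeR R =>
    (t + a : measurableTypeR R)).
  exact: measurable_funD.
pose Hf := isMeasurableFun.Build _ _ _ _ _ mf.
pose f : {mfun _ >-> _} := HB.pack (fun t : measurableTypeR R =>
    (t + a : measurableTypeR R)) Hf.
apply/esym.
apply: (@lebesgue_measure_unique R
  (pushforward (@lebesgue_measure R) f : {measure set _ -> \bar R})) => //.
move=> _ [[b c]] _ <-.
rewrite /pushforward [X in _ = lebesgue_measure X](_ : _ = `]b - a, c - a]%classic).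
  by rewrite !lebesgue_measure_itv/= !lte_fin ltrD2r !EFinB; case: ifPn => // _;
    rewrite -!EFinB; congr EFin; ring.
by apply/seteqP; split => x /=; rewrite !in_itv/= ltrBlDr lerBrDr.
Qed.

Lemma lebesgue_rVS n (A : set 'rV[R]_n.+1) : measurable A ->
  (lebesgue_rV n.+1 A =
   \int[@lebesgue_measure R]_t lebesgue_rV n [set v | A (rV_cons t v)])%E.
Proof.
move=> mA /=; rewrite /rV_cons_measure /pushforward /product_measure1.
apply: eq_integral => t _ /=; congr (lebesgue_rV n _).
by rewrite /xsection; apply/seteqP; split => v /=; rewrite inE.
Qed.

(** The measure is defined by slicing at a fixed first coordinate; slicing at a fixed tail gives the
    same value by uniqueness of the product measure. *)
Lemma lebesgue_rVS' n (A : set 'rV[R]_n.+1) : measurable A ->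
  (lebesgue_rV n.+1 A =
   \int[lebesgue_rV n]_v lebesgue_measure [set t | A (rV_cons t v)])%E.
Proof.
move=> mA.
have mA' : measurable ((fun x : measurableTypeR R * 'rV[R]_n =>
    rV_cons x.1 x.2) @^-1` A).
  by rewrite -[X in measurable X]setTI; exact: measurable_rV_cons.
transitivity ((@lebesgue_measure R \x^ lebesgue_rV n)%E
    ((fun x : measurableTypeR R * 'rV[R]_n => rV_cons x.1 x.2) @^-1` A)).
  rewrite /= /rV_cons_measure /pushforward.
  by apply: product_measure_unique => //= *; rewrite product_measure2E.
rewrite /product_measure2; apply: eq_integral => v _ /=.
congr lebesgue_measure.
by rewrite /ysection; apply/seteqP; split => t /=; rewrite inE.
Qed.

(** Slicing at a fixed first coordinate reduces the claim to each [tau t]. Joint measurability is a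
    separate hypothesis because it does not follow from that of the slices. *)
Lemma measure_preserving_behead n (tau : R -> 'rV[R]_n -> 'rV[R]_n) :
  measurable_fun [set: 'rV[R]_n.+1]
    (fun w : 'rV[R]_n.+1 => rV_cons (w ord0 ord0) (tau (w ord0 ord0) (rV_behead w))) ->
  (forall t, measure_preserving (tau t)) ->
  measure_preserving
    (fun w : 'rV[R]_n.+1 => rV_cons (w ord0 ord0) (tau (w ord0 ord0) (rV_behead w))).
Proof.
move=> mT ptau; split=> // A mA; rewrite !lebesgue_rVS//; last first.
  by rewrite -[X in measurable X]setTI; exact: mT.
apply: eq_integral => t _.
rewrite -((ptau t).2 [set v | A (rV_cons t v)]).
  by congr (lebesgue_rV n _); apply/seteqP; split => v /=;
    rewrite rV_cons0 rV_consK.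
have := @measurable_rV_cons R n measurableT _ mA.
rewrite setTI => /(@measurable_xsection _ _ _ _ _ t).
congr measurable; rewrite /xsection.
by apply/seteqP; split => v /=; rewrite inE.
Qed.

(** Slicing at a fixed tail leaves a one-dimensional statement about each [g v]. *)
Lemma measure_preserving_head n (g : 'rV[R]_n -> R -> R) :
  measurable_fun [set: 'rV[R]_n.+1]
    (fun w : 'rV[R]_n.+1 => rV_cons (g (rV_behead w) (w ord0 ord0)) (rV_behead w)) ->
  (forall v (A : set (measurableTypeR R)), measurable A ->
     lebesgue_measure (g v @^-1` A : set (measurableTypeR R)) =
     lebesgue_measure A) ->
  measure_preserving
    (fun w : 'rV[R]_n.+1 => rV_cons (g (rV_behead w) (w ord0 ord0)) (rV_behead w)).
Proof.
move=> mT pg; split=> // A mA; rewrite !lebesgue_rVS'//; last first.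
  by rewrite -[X in measurable X]setTI; exact: mT.
apply: eq_integral => v _.
rewrite -[RHS](pg v).
  by congr lebesgue_measure; apply/seteqP; split => t /=;
    rewrite rV_cons0 rV_consK.
have := @measurable_rV_cons R n measurableT _ mA.
rewrite setTI => /(@measurable_ysection _ _ _ _ _ v).
congr measurable; rewrite /ysection.
by apply/seteqP; split => t /=; rewrite inE.
Qed.

Lemma measurable_rV_coord n i : measurable_fun [set: 'rV[R]_n]
  (fun v => v ord0 i).
Proof. exact: measurable_coor. Qed.

Lemma measurable_dot n (a : 'rV[R]_n) : measurable_fun [set: 'rV[R]_n]
  (fun v : 'rV[R]_n => \sum_i a ord0 i * v ord0 i).
Proof.
apply: measurable_sum => i; apply: measurable_funM => //.
exact: measurable_rV_coord.
Qed.

Lemma rV_cons_row n (t : R) (v : 'rV[R]_n) (w : 'rV[R]_n.+1) :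
  w ord0 ord0 = t -> rV_behead w = v -> rV_cons t v = w.
Proof. by move=> <- <-; exact: rV_consE. Qed.

Lemma measurable_rV_cons_fun d (X : measurableType d) n (f : X -> R)
    (g : X -> 'rV[R]_n) :
  measurable_fun setT f -> measurable_fun setT g ->
  measurable_fun setT (fun x => rV_cons (f x) (g x)).
Proof.
move=> mf mg; apply: (measurableT_comp (@measurable_rV_cons R n)
  (g := fun x => (f x : measurableTypeR R, g x))).
exact: measurable_fun_pair.
Qed.

Lemma measurable_rV_translate n (v : 'rV[R]_n) :
  measurable_fun [set: 'rV[R]_n] (fun x => x + v).
Proof.
apply: measurable_fun_rV => i; under eq_fun do rewrite mxE.
by apply: measurable_funD => //; exact: measurable_rV_coord.
Qed.

(** Induction on the dimension: the head is moved by the one-dimensional shift, the tail by the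
    induction hypothesis. *)
Lemma measure_preserving_translate n (v : 'rV[R]_n) :
  measure_preserving (fun x => x + v).
Proof.
elim: n v => [|n IH] v.
  split; first exact: measurable_rV_translate.
  move=> A mA; congr (lebesgue_rV _ _); apply/seteqP; split => x /=;
  by rewrite (thinmx0 v) addr0.
have -> : (fun x => x + v) =
    (fun w : 'rV[R]_n.+1 => rV_cons (w ord0 ord0) (rV_behead w + rV_behead v)) \o
    (fun w : 'rV[R]_n.+1 => rV_cons (w ord0 ord0 + v ord0 ord0) (rV_behead w)).
  apply/funext => x /=; apply/esym/rV_cons_row.
    by rewrite mxE rV_cons0.
  by rewrite rV_consK; apply/rowP => j; rewrite !mxE.
apply: measure_preserving_comp.
  apply: (@measure_preserving_behead _ (fun=> (fun x => x + rV_behead v))) => //.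
  apply: measurable_rV_cons_fun; first exact: measurable_rV_coord.
  exact: measurableT_comp (measurable_rV_translate _) (@measurable_rV_behead R n).
apply: (@measure_preserving_head _ (fun _ t => t + v ord0 ord0)) => //.
  apply: measurable_rV_cons_fun; last exact: measurable_rV_behead.
  by apply: measurable_funD => //; exact: measurable_rV_coord.
by move=> _ A mA; exact: lebesgue_measure_shift.
Qed.

(** For a unit [nu], the orthogonal reflection in the hyperplane where the dot product with [nu]
    equals [c]. *)
Definition hrefl n (nu : 'rV[R]_n) (c : R) (x : 'rV[R]_n) : 'rV[R]_n :=
  x - (2 * (\sum_i nu ord0 i * x ord0 i - c)) *: nu.

Lemma measurable_hrefl n (nu : 'rV[R]_n) c :
  measurable_fun setT (hrefl nu c).
Proof.
apply: measurable_fun_rV => i; under eq_fun do rewrite !mxE.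
apply: measurable_funB; first exact: measurable_rV_coord.
apply: measurable_funM => //; apply: measurable_funM => //.
by apply: measurable_funB => //; exact: measurable_dot.
Qed.

(* When nu_0 != 0, put z_0 = (nu.x - c) / nu_0; the shear x_0 |-> z_0
   conjugates the reflection to z_0 |-> - z_0, x_j |-> x_j - 2 nu_0 z_0 nu_j,
   so only one-dimensional invariance and Fubini are needed. *)
Lemma measure_preserving_hrefl n (nu : 'rV[R]_n) (c : R) :
  \sum_i nu ord0 i ^+ 2 = 1 -> measure_preserving (hrefl nu c).
Proof.
elim: n nu c => [|n IH] nu c nu1.
  by move: nu1; rewrite big_ord0 => /eqP; rewrite eq_sym oner_eq0.
move: nu1; rewrite big_ord_recl.
set a := nu ord0 ord0; set b := rV_behead nu.
have -> : \sum_(i < n) nu ord0 (lift ord0 i) ^+ 2 = \sum_i b ord0 i ^+ 2.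
  by apply: eq_bigr => i _; rewrite mxE.
move=> ab1.
have dotE (x : 'rV[R]_n.+1) : \sum_i nu ord0 i * x ord0 i =
    a * x ord0 ord0 + \sum_i b ord0 i * rV_behead x ord0 i.
  by rewrite big_ord_recl; congr (_ + _); apply: eq_bigr => i _; rewrite !mxE.
(* If [nu] has no first component, the reflection only acts on the tail, with unit normal [b]. *)
have [a0|a0] := eqVneq a 0.
  have -> : hrefl nu c =
      fun w : 'rV[R]_n.+1 => rV_cons (w ord0 ord0) (hrefl b c (rV_behead w)).
    apply/funext => x; apply/esym/rV_cons_row.
      by rewrite !mxE -/a a0 mulr0 subr0.
    rewrite /hrefl dotE a0 mul0r add0r.
    by apply/rowP => j; rewrite !mxE.
  apply: (@measure_preserving_behead _ (fun=> hrefl b c)).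
    apply: measurable_rV_cons_fun; first exact: measurable_rV_coord.
    exact: measurableT_comp (measurable_hrefl _ _) (@measurable_rV_behead R n).
  by move=> _; apply: IH; rewrite -ab1 a0 expr0n add0r.
pose s (v : 'rV[R]_n) := (\sum_i b ord0 i * v ord0 i - c) / a.
have ms : measurable_fun setT s.
  apply: measurable_funM => //; apply: measurable_funB => //.
  exact: measurable_dot.
pose S1 (w : 'rV[R]_n.+1) := rV_cons (w ord0 ord0 + s (rV_behead w)) (rV_behead w).
pose S2 (w : 'rV[R]_n.+1) := rV_cons (w ord0 ord0 - s (rV_behead w)) (rV_behead w).
pose T1 (w : 'rV[R]_n.+1) :=
  rV_cons (w ord0 ord0) (rV_behead w + (- (2 * a * w ord0 ord0)) *: b).
pose T2 (w : 'rV[R]_n.+1) := rV_cons (- w ord0 ord0) (rV_behead w).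
have mbs : measurable_fun setT (fun w : 'rV[R]_n.+1 => s (rV_behead w)).
  exact: measurableT_comp ms (@measurable_rV_behead R n).
have pS1 : measure_preserving S1.
  apply: (@measure_preserving_head _ (fun v t => t + s v)).
    apply: measurable_rV_cons_fun; last exact: measurable_rV_behead.
    by apply: measurable_funD => //; exact: measurable_rV_coord.
  by move=> v A mA; exact: lebesgue_measure_shift.
have pS2 : measure_preserving S2.
  apply: (@measure_preserving_head _ (fun v t => t - s v)).
    apply: measurable_rV_cons_fun; last exact: measurable_rV_behead.
    by apply: measurable_funB => //; exact: measurable_rV_coord.
  by move=> v A mA; exact: lebesgue_measure_shift.
have pT2 : measure_preserving T2.
  apply: (@measure_preserving_head _ (fun _ t => - t)).
    apply: measurable_rV_cons_fun; last exact: measurable_rV_behead.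
    by apply: measurableT_comp => //; exact: measurable_rV_coord.
  by move=> v A mA; exact: lebesgue_measureN.
have pT1 : measure_preserving T1.
  apply: (@measure_preserving_behead _
      (fun t v => v + (- (2 * a * t)) *: b)).
    apply: measurable_rV_cons_fun; first exact: measurable_rV_coord.
    apply: measurable_fun_rV => i; under eq_fun do rewrite !mxE.
    apply: measurable_funD; first exact: measurable_rV_coord.
    apply: measurable_funM => //; apply: measurableT_comp => //.
    by apply: measurable_funM => //; exact: measurable_rV_coord.
  by move=> t; exact: measure_preserving_translate.
(* [S1] passes to [z_0], [T1] moves the tail while [z_0] still has its old sign, [T2] flips that
   sign, and [S2] undoes the shear with the new tail. *)
suff -> : hrefl nu c = S2 \o (T2 \o (T1 \o S1)).
  apply: measure_preserving_comp pS2 _; apply: measure_preserving_comp pT2 _.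
  exact: measure_preserving_comp pT1 pS1.
apply/funext => x; rewrite /hrefl dotE; apply/esym/rV_cons_row.
  have -> k : (x - k *: nu) ord0 ord0 = x ord0 ord0 - k * a by rewrite !mxE.
  rewrite /= /T2 /T1 /S1 ?(rV_cons0, rV_consK) /s.
  set P := \sum_i b ord0 i * rV_behead x ord0 i.
  (* [b] has squared length [1 - a ^+ 2], whence the last factor. *)
  have -> : \sum_i b ord0 i * (rV_behead x + (- (2 * a * (x ord0 ord0 + (P - c) / a))) *: b) ord0 i = P - 2 * a * (x ord0 ord0 + (P - c) / a) * (1 - a ^+ 2).
    rewrite (eq_bigr (fun i => b ord0 i * rV_behead x ord0 i + (- (2 * a * (x ord0 ord0 + (P - c) / a))) * b ord0 i ^+ 2)).
      rewrite big_split/= -mulr_sumr -/P -ab1; ring.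
    by move=> i _; rewrite !mxE; ring.
  by field.
rewrite /= /T2 /T1 /S1 ?(rV_cons0, rV_consK) /s.
set P := \sum_i b ord0 i * rV_behead x ord0 i.
by apply/rowP => j; rewrite !mxE; field.
Qed.

End measure_preserving.

(** * Topology of row vectors *)

Section rV_topology.
Context {R : realType} {n : nat}.
Implicit Types (x y : 'rV[R]_n) (f : 'rV[R]_n -> R).

Local Notation mu := (lebesgue_rV n : {measure set 'rV[R]_n -> \bar R}).

Lemma rV_norm_le x (e : R) : 0 <= e ->
  (`|x| <= e) <-> (forall i, `|x ord0 i| <= e).
Proof.
move=> e0; rewrite [`|x|]mx_normrE; split=> [xe i|xe].
  apply: le_trans xe; exact: (le_bigmax _ (fun ij => `|x ij.1 ij.2|) (ord0, i)).
by apply/bigmax_leP; split=> // -[i j] _ /=; rewrite (ord1 i).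
Qed.

Lemma rV_norm_lt x (e : R) : 0 < e ->
  (`|x| < e) <-> (forall i, `|x ord0 i| < e).
Proof.
move=> e0; rewrite [`|x|]mx_normrE; split=> [xe i|xe].
  apply: le_lt_trans xe; exact: (le_bigmax _ (fun ij => `|x ij.1 ij.2|) (ord0, i)).
by apply/bigmax_ltP; split=> // -[i j] _ /=; rewrite (ord1 i).
Qed.

Lemma rV_coord_le x i : `|x ord0 i| <= `|x|.
Proof. exact: (rV_norm_le x (normr_ge0 _)).1. Qed.

Lemma measurable_rV_ball x (e : R) : measurable (ball x e).
Proof.
have [e0|e0] := ltP 0 e; last first.
  rewrite (_ : ball x e = set0) ?measurable0//.
  by apply/seteqP; split=> y //= -[/lt_le_trans/(_ e0)]; rewrite ltxx.
rewrite (_ : ball x e = [set y | forall i, ball (x ord0 i) e (y ord0 i)]).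
  by apply: (measurable_rV_box (A := fun i => ball (x ord0 i) e)) => i; exact: measurable_ball.
apply/seteqP; split=> y /= => [[_ h] i //|h]; split=> // i j.
by rewrite (ord1 i).
Qed.

(** The sigma-algebra is generated by coordinates, not by open sets. An open set is the union of the
    balls with rational centre and radius [1 / (k + 1)] inside it; these are boxes, and there are
    countably many of them. *)
Lemma open_measurable_rV (U : set 'rV[R]_n) : open U -> measurable U.
Proof.
move=> oU.
pose B (q : 'rV[rat]_n * nat) := ball (map_mx ratr q.1 : 'rV[R]_n) q.2.+1%:R^-1.
have -> : U = \bigcup_q (if `[< B q `<=` U >] then B q else set0).
  apply/seteqP; split=> [x Ux|x [q _]]; last first.
    by case: ifPn => // /asboolP BU; exact: BU.
  have /nbhs_ballP[e /= e0 xeU] : nbhs x U by exact: open_nbhs_nbhs.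
  (* Twice the radius stays below [e], so a rational ball that contains [x] lies in [ball x e]. *)
  have [k ke] : exists k : nat, k.+1%:R^-1 < e / 2.
    have e20 : 0 < e / 2 by rewrite divr_gt0.
    have [k _ /(_ k (leqnn k))] := near_infty_natSinv_lt (PosNum e20).
    by exists k.
  have qP i : exists q : rat, `|x ord0 i - ratr q| < k.+1%:R^-1 :> R.
    have k0 : 0 < k.+1%:R^-1 :> R by rewrite invr_gt0.
    have /rat_in_itvoo[q] : x ord0 i - k.+1%:R^-1 < x ord0 i by rewrite ltrBlDr ltrDl.
    rewrite in_itv/= => /andP[q1 q2]; exists q.
    by rewrite ger0_norm; move: q1 q2; set r := ratr q : R; set s := _^-1; lra.
  have [q Hq] := choice qP.
  exists (\row_i q i, k) => //.
  have Bx : B (\row_i q i, k) x.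
    split; first by rewrite /= invr_gt0.
    by move=> i j; rewrite /ball/= !mxE (ord1 i) distrC.
  case: ifPn => // /asboolP[] y [_ By]; apply: xeU; split=> // i j.
  have [_ /(_ i j)] := Bx; have := By i j.
  rewrite /ball/= !mxE => h1 h2.
  rewrite -(subrKA (ratr (q j))) (le_lt_trans (ler_normD _ _))//.
  by move: h1 h2 ke; rewrite /= (distrC (ratr _) (x i j)); set r := _^-1; lra.
apply: countable_bigcupT_measurable; first exact: countableP.
move=> q; case: ifPn => // _; exact: measurable_rV_ball.
Qed.

Lemma closed_measurable_rV (U : set 'rV[R]_n) : closed U -> measurable U.
Proof.
move=> cU; rewrite -(setCK U); apply: measurableC.
by apply: open_measurable_rV; rewrite openC.
Qed.

Lemma continuous_measurable_rV f : continuous f -> measurable_fun setT f.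
Proof.
move=> cf; apply: (measurability _ (RGenOInfty.measurableE R)) => //.
move=> _ [_ [a ->] <-]; rewrite setTI; apply: open_measurable_rV.
by move/continuousP : cf; apply; exact: interval_open.
Qed.

Definition cube (M : R) : set 'rV[R]_n := [set x | `|x| <= M].

Lemma cube_box M : 0 <= M ->
  cube M = [set x : 'rV[R]_n | forall i, `[- M, M]%classic (x ord0 i)].
Proof.
move=> M0; apply/seteqP; split=> x; rewrite /cube/=.
  by move/(rV_norm_le x M0) => h i; rewrite in_itv/= -ler_norml.
by move=> h; apply/(rV_norm_le x M0) => i; have := h i; rewrite in_itv/= -ler_norml.
Qed.

Lemma cube_neg M : M < 0 -> cube M = set0.
Proof.
move=> M0; apply/seteqP; split=> x //=; rewrite /cube/= => /le_lt_trans/(_ M0).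
by rewrite ltNge normr_ge0.
Qed.

Lemma compact_cube M : compact (cube M).
Proof.
have [M0|M0] := leP 0 M; last by rewrite cube_neg//; exact: compact0.
rewrite cube_box//; apply: (@rV_compact _ _ (fun=> `[- M, M]%classic)) => i.
exact: segment_compact.
Qed.

Lemma measurable_cube M : measurable (cube M).
Proof.
have [M0|M0] := leP 0 M; last by rewrite cube_neg.
rewrite cube_box//; apply: (measurable_rV_box (A := fun=> `[- M, M]%classic)) => i.
exact: measurable_itv.
Qed.

Lemma lebesgue_cube M : 0 <= M -> mu (cube M) = ((M + M) ^+ n)%:E.
Proof.
move=> M0; rewrite cube_box//.
have /= -> := @lebesgue_rV_box R n (fun=> `[- M, M]%classic) (fun=> measurable_itv _).
suff -> : @lebesgue_measure R `[- M, M]%classic = (M + M)%:E.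
  by rewrite prodEFin prodr_const card_ord.
rewrite lebesgue_measure_itv/= lte_fin; case: ifPn => [_|]; first by rewrite -EFinB opprK.
rewrite -leNgt => h; have -> : M = 0 by lra.
by rewrite addr0.
Qed.

Lemma cube_lty M : (mu (cube M) < +oo)%E.
Proof.
have [M0|M0] := leP 0 M; last by rewrite cube_neg// measure0.
by rewrite lebesgue_cube// ltry.
Qed.

Lemma compact_sub_cube (K : set 'rV[R]_n) : compact K ->
  exists2 M : R, 0 <= M & K `<=` cube M.
Proof.
move=> /compact_bounded[M [_ KM]]; exists (`|M| + 1); first by rewrite addr_ge0.
by move=> x Kx; apply: (KM (`|M| + 1)) => //; rewrite (le_lt_trans (ler_norm M))// ltrDl.
Qed.

(** Heine-Cantor through the covering form of compactness, with [d] running along [0^'+]. Only [x]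
    is confined to the cube: its neighbour [y] may leave it, as happens in mollification. *)
Lemma unif_continuous_cube f (M : R) : continuous f -> forall e : R, 0 < e ->
  exists2 d : R, 0 < d &
    forall x y, `|x| <= M -> `|x - y| < d -> `|f x - f y| < e.
Proof.
move=> cf e e0.
have e20 : 0 < e / 2 by rewrite divr_gt0.
have := @compact_cube M; rewrite compact_near_coveringP => nc.
have := nc R (0^'+) (fun d x => forall y, `|x - y| < d -> `|f x - f y| < e) _.
case.
  move=> x Mx.
  have /cvgrPdist_lt/(_ _ e20) := cf x.
  move=> /nbhs_ballP[d /= d0 xd].
  (* Half of the radius is spent on moving [x] to [x'], the other half on moving [x'] to [y]. *)
  exists (ball x (d / 2), [set t : R | t < d / 2]) => /=.
    split.
      by apply: nbhsx_ballx; rewrite divr_gt0.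
    by apply: nbhs_right_lt; rewrite divr_gt0.
  move=> [x' t] [] /= x'x td y x'y.
  have {}x'x : `|x - x'| < d / 2.
    by move: x'x; rewrite -ball_normE.
  have h1 : `|f x - f x'| < e / 2.
    by apply: xd; rewrite -ball_normE /ball_/=; lra.
  have h2 : `|f x - f y| < e / 2.
    apply: xd; rewrite -ball_normE /ball_/= -(subrKA x').
    by rewrite (le_lt_trans (ler_normD _ _))//; lra.
  rewrite -(subrKA (f x)) (le_lt_trans (ler_normD _ _))//.
  by rewrite (distrC (f x')); lra.
move=> d /= d0 H.
exists (d / 2); first by rewrite divr_gt0.
move=> x y xM xy; apply: (H (d / 2)) => //=; last by rewrite divr_gt0.
by rewrite sub0r normrN gtr0_norm ?divr_gt0//; lra.
Qed.

Lemma bounded_cube f (M : R) : continuous f ->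
  exists2 C : R, 0 <= C & forall x, `|x| <= M -> `|f x| <= C.
Proof.
move=> cf.
have : compact (f @` cube M).
  apply: continuous_compact (@compact_cube M).
  exact: continuous_subspaceT.
move=> /compact_bounded[C [_ fC]]; exists (`|C| + 1); first by rewrite addr_ge0.
move=> x xM; apply: (fC (`|C| + 1)); last by exists x.
by rewrite (le_lt_trans (ler_norm C))// ltrDl.
Qed.

End rV_topology.

(** * Test functions *)

Section derive_eps.
Context {R : realType} {V : normedModType R}.
Implicit Types (f : V -> R) (x v : V).

(** Stating the derivative through the increment avoids division and covers [h = 0], so that chain
    rules reduce to triangle inequalities. *)
Lemma is_deriveP f x v (d : R) : is_derive x v f d <->
  forall e, 0 < e -> exists2 del, 0 < del & forall h : R, `|h| < del ->
    `|f (x + h *: v) - f x - h * d| <= e * `|h|.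
Proof.
have key : is_derive x v f d <->
    h^-1 *: ((f \o shift x) (h *: v) - f x) @[h --> 0^'] --> d.
  split=> [[df <-] //|H]; split; last exact: cvg_lim.
  by apply/cvg_ex; exists d.
rewrite key; split=> [/cvgrPdist_le H e e0|H].
  have [del /= del0 Hdel] := H _ e0.
  exists del => // h hd; have [->|h0] := eqVneq h 0.
    by rewrite scale0r addr0 subrr mul0r subrr normr0 mulr0.
  have := Hdel h; rewrite /= sub0r normrN => /(_ hd h0).
  rewrite /= (addrC (h *: v)) => hh.
  have -> : f (x + h *: v) - f x - h * d =
      - h * (d - h^-1 *: (f (x + h *: v) - f x)).
    by rewrite /GRing.scale/=; field.
  by rewrite normrM normrN mulrC ler_wpM2r.
apply/cvgrPdist_le => e e0; have [del del0 Hdel] := H _ e0.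
exists del => // h; rewrite /= sub0r normrN => hd h0.
have hn0 : 0 < `|h| by rewrite normr_gt0.
rewrite -(ler_pM2l hn0) -normrM /= (addrC (h *: v)).
have -> : h * (d - h^-1 *: (f (x + h *: v) - f x)) =
    - (f (x + h *: v) - f x - h * d).
  by rewrite /GRing.scale/=; field.
by rewrite normrN [leRHS]mulrC; exact: Hdel.
Qed.

End derive_eps.

(** * The flat function [exp (- 1 / t)] and its derivatives *)

Section bump_function.
Context {R : realType}.

(** [t ^ (- k) * exp (- 1 / t)], extended by zero. Differentiation raises the power of [1 / t], and
    it is the whole family that is closed under it, up to linear combinations. *)
Definition invexp (k : nat) (t : R) : R :=
  if 0 < t then t^-1 ^+ k * expR (- t^-1) else 0.

Lemma invexp_ge0 k t : 0 <= invexp k t.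
Proof.
rewrite /invexp; case: ifPn => // t0.
by rewrite mulr_ge0 ?expR_ge0// exprn_ge0// invr_ge0 ltW.
Qed.

Lemma invexp_le0 k t : t <= 0 -> invexp k t = 0.
Proof. by move=> t0; rewrite /invexp ltNge t0. Qed.

(** With [s = 1 / t], one term of the exponential series gives [exp s >= s ^ (k + 2) / (k + 2)!].
    The two extra powers leave [t ^+ 2], which makes the derivative at the origin zero. *)
Lemma invexp_sqr k t : invexp k t <= (k.+2)`!%:R * t ^+ 2.
Proof.
rewrite /invexp; case: ifPn => t0; last by rewrite mulr_ge0 ?sqr_ge0.
have s0 : 0 < t^-1 by rewrite invr_gt0.
have H : t^-1 ^+ k.+2 / (k.+2)`!%:R <= expR t^-1.
  by rewrite (le_trans _ (expR_ge1Dxn k.+1 (ltW s0)))// lerDr.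
rewrite ler_pdivrMr ?ltr0n ?fact_gt0// in H.
rewrite expRN ler_pdivrMr ?expR_gt0//.
have -> : t^-1 ^+ k = t^-1 ^+ k.+2 * t ^+ 2.
  by rewrite -addn2 exprD -mulrA -exprMn mulVf ?gt_eqF// expr1n mulr1.
rewrite [leRHS]mulrAC ler_wpM2r ?sqr_ge0// (le_trans H)// mulrC //.
Qed.

Lemma is_derive_invexp k (t : R) :
  is_derive t (1:R) (invexp k) (invexp k.+2 t - k%:R * invexp k.+1 t).
Proof.
have [t0|t0|->] := ltgtP t 0.
- rewrite !invexp_le0 ?(ltW t0)// mulr0 subr0.
  have H0 : is_derive t (1:R) (cst (0:R)) (0:R) by exact: is_derive_cst.
  apply: (near_eq_is_derive _ H0).
  near=> s; rewrite invexp_le0//; apply/ltW; near: s.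
  exact: lt_nbhsl.
- pose g (s : R) := s^-1.
  have dg : is_derive t (1:R) g (- t ^- 2).
    apply: DeriveDef; first by apply: derivableV => //; rewrite gt_eqF.
    by rewrite deriveV ?gt_eqF// derive_id /GRing.scale/= mulr1.
  have Hg : \forall s \near t, (g ^+ k * (expR \o (- g))) s = invexp k s.
    near=> s; have s0 : 0 < s by near: s; exact: lt_nbhsr.
    by rewrite /invexp s0 /= fctE exprfctE.
  have de : is_derive t (1:R) (expR \o (- g)) (expR (- t^-1) * t ^- 2).
    have := @is_derive1_comp _ expR (- g) t _ _ (is_derive_expR _) (is_deriveN dg).
    by rewrite opprK.
  apply: (near_eq_is_derive Hg); apply: is_derive_eq.
  rewrite /invexp t0 /GRing.scale/= !(fctE, exprfctE) /g.
  case: k {Hg} => [|k]; rewrite /= ?mul0r ?oppr0.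
    by rewrite !expr0 !mul1r mulr0 !addr0 exprVn mulrC.
  by rewrite !exprS; field; rewrite gt_eqF.
- apply/is_deriveP => e e0.
  rewrite !(@invexp_le0 _ 0)// mulr0 subrr.
  set C : R := (k.+2)`!%:R.
  have C0 : 0 < C by rewrite ltr0n fact_gt0.
  exists (e / C); first by rewrite divr_gt0.
  move=> h hd; rewrite add0r mulr0 !subr0 ger0_norm ?invexp_ge0//.
  rewrite [_%:A]mulr1 (le_trans (invexp_sqr k h))// -/C -real_normK ?num_real//.
  rewrite expr2 mulrA ler_wpM2r//.
  by rewrite mulrC -ler_pdivlMr// ltW.
Unshelve. all: by end_near. Qed.


End bump_function.

Section line.
Context {R : realType} {V : normedModType R}.
Implicit Types (f df : V -> R) (x v : V).

Lemma is_derive_line f x v (t d : R) : is_derive (x + t *: v) v f d ->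
  is_derive t (1 : R) (fun s : R => f (x + s *: v)) d.
Proof.
move=> /is_deriveP H; apply/is_deriveP => e e0.
have [del del0 Hdel] := H _ e0; exists del => // h hd.
rewrite [h *: 1]mulr1 scalerDl addrA; exact: Hdel.
Qed.

(** The mean value theorem on a segment; for [a < 0] it is run from the other endpoint, so the
    intermediate parameter is only located by its absolute value. *)
Lemma MVT_line f df x v (a : R) : (forall y, is_derive y v f (df y)) ->
  exists2 c, `|c| <= `|a| & f (x + a *: v) - f x = a * df (x + c *: v).
Proof.
move=> fdf.
have dline y (t : R) : is_derive t (1 : R) (fun s : R => f (y + s *: v))
    (df (y + t *: v)) by exact: is_derive_line.
have pos y (b : R) : 0 <= b -> exists2 c, 0 <= c <= b &
    f (y + b *: v) - f y = b * df (y + c *: v).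
  move=> b0.
  have cline : {within `[0, b], continuous (fun s : R => f (y + s *: v))}.
    apply: derivable_within_continuous => z _.
    by have [] := dline y z.
  have [c] := MVT_segment b0 (fun z _ => dline y z) cline.
  rewrite in_itv/= => cb; rewrite scale0r addr0 subr0 => ->.
  by exists c => //; rewrite mulrC.
have [a0|a0] := leP 0 a.
  have [c /andP[c0 ca] ->] := pos x a a0; exists c => //.
  by rewrite !ger0_norm.
have [|c /andP[c0 ca]] := pos (x + a *: v) (- a); first by rewrite oppr_ge0 ltW.
rewrite scaleNr addrK -addrA -scalerDl => /eqP.
rewrite mulNr -opprB eqr_opp => /eqP ->; exists (a + c) => //.
by rewrite (ltr0_norm a0) ler0_norm; lra.
Qed.

End line.

(** * Smooth functions: directional derivatives, generated algebras, affine substitution *)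

Section smooth.
Context {R : realType} {n : nat}.
Implicit Types (x y v : 'rV[R]_n) (phi : 'rV[R]_n -> R).

(** [smooth] speaks of all iterated partials; a class stable under partials contains each of them by
    induction on the list of directions. *)
Lemma smooth_class (P : ('rV[R]_n -> R) -> Prop) :
  (forall phi, P phi -> continuous phi /\ forall i,
     (forall x, derivable phi x (basis_vec i)) /\ P (partial i phi)) ->
  forall phi, P phi -> smooth phi.
Proof.
move=> H phi Pphi s.
have Ps : P (foldr partial phi s).
  by elim: s => //= i s /H [_ /(_ i)[]].
by have [cs ds] := H _ Ps; split=> // i; have [] := ds i.
Qed.

Lemma smooth_continuous phi : smooth phi -> continuous phi.
Proof. by move=> /(_ [::]) []. Qed.

Lemma smooth_partial phi i : smooth phi -> smooth (partial i phi).
Proof. by move=> sphi s; have := sphi (rcons s i); rewrite foldr_rcons. Qed.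

Lemma smooth_is_derive_basis phi i x : smooth phi ->
  is_derive x (basis_vec i) phi (partial i phi x).
Proof. by move=> /(_ [::]) [_ /(_ i x) d]; exact: DeriveDef. Qed.

(* The coordinate directions of [v] are added one at a time, each increment
   being controlled by the mean value theorem and continuity of the partials. *)
Lemma smooth_is_derive phi x v : smooth phi ->
  is_derive x v phi (\sum_i v ord0 i * partial i phi x).
Proof.
move=> sphi.
rewrite [in X in is_derive _ X](row_sum_delta v).
elim: (index_enum _) => [|j s IH].
  rewrite !big_nil; apply/is_deriveP => e e0; exists 1 => // h _.
  by rewrite scaler0 addr0 subrr mulr0 subrr normr0 mulr_ge0// ltW.
rewrite !big_cons; set w := \sum_(i <- s) _; set d := \sum_(i <- s) _.
set a := v ord0 j; rewrite -/(basis_vec j).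
apply/is_deriveP => e e0.
have e20 : 0 < e / 2 by rewrite divr_gt0.
have [del1 del10 Hdel1] := (is_deriveP _ _ _ _).1 IH _ e20.
have e3 : 0 < e / 2 / (`|a| + 1) by rewrite divr_gt0// ltr_wpDl.
have cj : continuous (partial j phi).
  exact/smooth_continuous/smooth_partial.
have /cvgrPdist_lt/(_ _ e3) := cj x.
move=> /nbhs_ballP[del2 /= del20 Hdel2].
(* Bounds the displacement of the mean value point [z] from [x] per unit of [h]; the [+ 1] makes it
   positive. *)
set N := `|w| + `|a| * `|basis_vec j : 'rV[R]_n| + 1.
have N0 : 0 < N by rewrite ltr_wpDl// addr_ge0// mulr_ge0.
exists (Num.min del1 (del2 / N)); first by rewrite lt_min del10 divr_gt0.
move=> h; rewrite lt_min ltr_pdivlMr// => /andP[h1 h2].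
have [c ca E] := MVT_line (x + h *: w) (h * a)
  (fun y => smooth_is_derive_basis j y sphi).
have -> : x + h *: (a *: basis_vec j + w) =
    x + h *: w + (h * a) *: basis_vec j.
  by rewrite scalerDr scalerA addrA addrAC.
set z := x + h *: w + c *: basis_vec j in E.
have xz : `|partial j phi x - partial j phi z| < e / 2 / (`|a| + 1).
  apply: Hdel2; rewrite -ball_normE /ball_/= /z -addrA opprD addNKr normrN.
  apply: le_lt_trans h2; apply: (le_trans (ler_normD _ _)).
  rewrite !normrZ /N !mulrDr mulr1 -addrA lerD// ler_wpDr// mulrA.
  by rewrite ler_wpM2r// -normrM.
have -> : phi (x + h *: w + (h * a) *: basis_vec j) - phi x -
    h * (a * partial j phi x + d) =
    (phi (x + h *: w) - phi x - h * d) +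
    h * a * (partial j phi z - partial j phi x).
  by rewrite mulrBr -E; ring.
apply: (le_trans (ler_normD _ _)).
rewrite [e](splitr e) mulrDl lerD ?Hdel1//.
rewrite !normrM -mulrA mulrC ler_wpM2r//.
rewrite distrC in xz.
apply: (@le_trans _ _ (`|a| * (e / 2 / (`|a| + 1)))).
  by rewrite ler_wpM2l// ltW.
by rewrite mulrA ler_pdivrMr ?ltr_wpDl// mulrC ler_wpM2l ?lerDl// ltW.
Qed.

Inductive gen_alg (G : set ('rV[R]_n -> R)) : ('rV[R]_n -> R) -> Prop :=
| gen_alg_gen g : G g -> gen_alg G g
| gen_alg_cst (c : R) : gen_alg G (cst c)
| gen_alg_add f g : gen_alg G f -> gen_alg G g -> gen_alg G (f + g)
| gen_alg_mul f g : gen_alg G f -> gen_alg G g -> gen_alg G (f * g).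

(** By the sum and Leibniz rules, the partials of a polynomial expression in members of [G] are
    again such expressions once this holds for the members themselves; [smooth_class] does the
    rest. *)
Lemma smooth_gen_alg (G : set ('rV[R]_n -> R)) :
  (forall g, G g -> continuous g /\ forall i,
    exists2 dg, gen_alg G dg & forall x, is_derive x (basis_vec i) g (dg x)) ->
  forall phi, gen_alg G phi -> smooth phi.
Proof.
move=> HG; apply: smooth_class => phi.
suff H : gen_alg G phi -> continuous phi /\ forall i,
    exists2 dg, gen_alg G dg & forall x, is_derive x (basis_vec i) phi (dg x).
  move=> /H[cphi dphi]; split=> // i; have [dg Gdg Hdg] := dphi i.
  split=> [x|]; first by have [] := Hdg x.
  suff -> : partial i phi = dg by [].
  by apply/funext => x; rewrite /partial; have [_ ->] := Hdg x.
elim=> [g /HG //|c|f g Gf [cf df] Gg [cg dg]|f g Gf [cf df] Gg [cg dg]].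
- split; first exact: cst_continuous.
  by move=> i; exists (cst 0); [exact: gen_alg_cst|move=> x; exact: is_derive_cst].
- split; first by move=> x; apply: continuousD; [exact: cf|exact: cg].
  move=> i; have [f' Gf' Hf] := df i; have [g' Gg' Hg] := dg i.
  exists (f' + g'); first exact: gen_alg_add.
  by move=> x; exact: is_deriveD.
- split; first by move=> x; apply: continuousM; [exact: cf|exact: cg].
  move=> i; have [f' Gf' Hf] := df i; have [g' Gg' Hg] := dg i.
  exists (f * g' + g * f').
    by apply: gen_alg_add; exact: gen_alg_mul.
  by move=> x; exact: is_deriveM.
Qed.

Lemma continuous_rV (f : 'rV[R]_n -> 'rV[R]_n) :
  (forall i, continuous (fun x => f x ord0 i)) -> continuous f.
Proof.
move=> cf x; apply/(@cvgrPdist_lt _ _ _ (nbhs x) _ f) => e e0.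
have : \forall y \near x, forall i, `|f x ord0 i - f y ord0 i| < e.
  apply: (@filter_forall _ _ (fun i => [set y | `|f x ord0 i - f y ord0 i| < e]) (nbhs x)) => i.
  by have /cvgrPdist_lt/(_ _ e0) := cf i x.
by apply: filterS => y H; apply/(rV_norm_lt _ e0) => i; rewrite !mxE.
Qed.

Lemma continuous_dot (a : 'I_n -> R) :
  continuous (fun x : 'rV[R]_n => \sum_j x ord0 j * a j).
Proof.
apply: (@continuous_big R 'I_n +%R 0 xpredT _ 'rV[R]_n _
  (fun j x => x ord0 j * a j)); first exact: add_continuous.
move=> j _ x; apply: continuousM; last exact: cst_continuous.
exact: coord_continuous.
Qed.

Lemma continuous_affine (A : 'M[R]_n) (b : 'rV[R]_n) :
  continuous (fun x : 'rV[R]_n => x *m A + b).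
Proof.
apply: continuous_rV => i.
rewrite [X in continuous X](_ : _ = fun x => \sum_j x ord0 j * A j i + b ord0 i).
  move=> x; apply: continuousD; last exact: cst_continuous.
  exact: continuous_dot.
by apply/funext => y; rewrite !mxE.
Qed.

Lemma is_derive_affine phi (A : 'M[R]_n) (b : 'rV[R]_n) x v d :
  is_derive (x *m A + b) (v *m A) phi d ->
  is_derive x v (fun y => phi (y *m A + b)) d.
Proof.
move=> /is_deriveP H; apply/is_deriveP => e e0.
have [del del0 Hdel] := H e e0; exists del => // h hd.
suff -> : (x + h *: v) *m A + b = x *m A + b + h *: (v *m A) by exact: Hdel.
by rewrite mulmxDl -scalemxAl addrAC.
Qed.

(** The direction [basis_vec i] is sent to row [i] of [A], in general not a coordinate direction:
    this is what derivatives along arbitrary vectors are for. *)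
Lemma partial_affine phi (A : 'M[R]_n) (b : 'rV[R]_n) i x : smooth phi ->
  is_derive x (basis_vec i) (fun y => phi (y *m A + b))
    (\sum_j A i j * partial j phi (x *m A + b)).
Proof.
move=> sphi; apply: is_derive_affine.
rewrite /basis_vec -rowE.
have := smooth_is_derive (x *m A + b) (row i A) sphi.
by under eq_bigr do rewrite mxE.
Qed.

(** Partials of a composite are linear combinations of composites of other smooth functions with the
    same affine map, so these composites can serve as generators. *)
Lemma smooth_affine phi (A : 'M[R]_n) (b : 'rV[R]_n) : smooth phi ->
  smooth (fun x => phi (x *m A + b)).
Proof.
move=> sphi.
pose G : set ('rV[R]_n -> R) := [set g | exists2 psi, smooth psi &
  g = fun x => psi (x *m A + b)].
apply: (@smooth_gen_alg G); last by apply: gen_alg_gen; exists phi.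
move=> _ [psi spsi ->]; split.
  move=> x; apply: (@continuous_comp _ _ _ (fun x => x *m A + b) psi).
    exact: continuous_affine.
  exact: smooth_continuous.
move=> i; exists (\sum_j (cst (A i j) * (fun x => partial j psi (x *m A + b)))).
  elim/big_ind : _ => [|f g|j _]; first exact: (gen_alg_cst _ 0).
    exact: gen_alg_add.
  apply: gen_alg_mul; first exact: gen_alg_cst.
  by apply: gen_alg_gen; exists (partial j psi); [exact: smooth_partial|reflexivity].
move=> x; rewrite fct_sumE; exact: partial_affine.
Qed.

Lemma compact_closure_cube (S : set 'rV[R]_n) (M : R) :
  S `<=` cube M -> compact (closure S).
Proof.
move=> SM; apply: (subclosed_compact _ (@compact_cube R n M)).
  exact: closed_closure.
rewrite [X in _ `<=` X](_ : _ = closure (cube M)); first exact: closureS.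
apply: (iffLR (closure_id _)); apply: compact_closed (@compact_cube R n M).
exact: norm_hausdorff.
Qed.

Lemma test_functionP phi : test_function phi <->
  smooth phi /\ exists2 M : R, 0 <= M & forall x, phi x != 0 -> `|x| <= M.
Proof.
split=> [[sphi /compact_sub_cube[M M0 HM]]|[sphi [M M0 HM]]]; split=> //.
  by exists M => // x px; apply: HM; exact: subset_closure.
exact: compact_closure_cube HM.
Qed.

Lemma mulmx_bounded (A : 'M[R]_n) : exists2 C : R, 0 <= C &
  forall x : 'rV[R]_n, `|x *m A| <= C * `|x|.
Proof.
exists (\sum_i \sum_j `|A i j|).
  by apply: sumr_ge0 => i _; apply: sumr_ge0.
move=> x; apply/rV_norm_le => [|j].
  by rewrite mulr_ge0//; apply: sumr_ge0 => i _; apply: sumr_ge0.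
rewrite mxE (le_trans (ler_norm_sum _ _ _))// mulr_suml.
apply: ler_sum => i _; rewrite normrM mulrC ler_pM//.
  by rewrite (bigD1 j)//= lerDl sumr_ge0.
exact: rV_coord_le.
Qed.

(** The inverse [B] recovers [x] from [x *m A + b], and being bounded it bounds the support. *)
Lemma test_function_affine phi (A B : 'M[R]_n) (b : 'rV[R]_n) :
  A *m B = 1%:M -> test_function phi ->
  test_function (fun x => phi (x *m A + b)).
Proof.
move=> AB /test_functionP[sphi [M M0 HM]]; apply/test_functionP; split.
  exact: smooth_affine.
have [C C0 HC] := mulmx_bounded B.
exists (C * (M + `|b|)); first by rewrite mulr_ge0// addr_ge0.
move=> x /HM xM.
have -> : x = (x *m A + b - b) *m B by rewrite addrK -mulmxA AB mulmx1.
rewrite (le_trans (HC _))// ler_wpM2l// (le_trans (ler_normB _ _))//.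
by rewrite lerD2r.
Qed.

End smooth.

(** * Integration against bounded compactly supported functions *)

Section integration.
Context {R : realType} {n : nat}.
Implicit Types (x y v : 'rV[R]_n) (f g psi : 'rV[R]_n -> R).

Local Notation mu := (lebesgue_rV n : {measure set 'rV[R]_n -> \bar R}).

Lemma EFin_Rintegral f : mu.-integrable setT (EFin \o f) ->
  (\int[mu]_x (f x)%:E)%E = (\int[mu]_x f x)%:E.
Proof. by move=> fi; rewrite /Rintegral fineK// integrable_fin_num. Qed.

Lemma locally_integrable_rVP f : locally_integrable_rV f <->
  measurable_fun setT f /\ forall M : R, mu.-integrable (cube M) (EFin \o f).
Proof.
split=> [[mf fK]|[mf fM]]; split=> //.
  move=> M; apply/integrableP; split.
    by apply/measurable_EFinP; exact: measurable_funS mf.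
  by rewrite /=; apply: fK; exact: compact_cube.
move=> K cK; have [M M0 KM] := compact_sub_cube cK.
have /integrableP[_] := fM M; apply: le_lt_trans.
apply: ge0_subset_integral => //.
- apply: closed_measurable_rV; apply: compact_closed cK; exact: norm_hausdorff.
- exact: measurable_cube.
- by apply/measurable_EFinP/measurableT_comp => //; exact: measurable_funS mf.
Qed.

(** Products of test functions with indicators are no longer continuous but stay in this class.
    Bound and radius are parameters because the estimates name them. *)
Record bounded_csupp (C M : R) psi : Prop := BoundedCsupp {
  bcs_meas : measurable_fun setT psi ;
  bcs_bound : forall x, `|psi x| <= C ;
  bcs_supp : forall x, psi x != 0 -> `|x| <= M }.

Lemma bounded_csupp_sup_ge0 C M psi : bounded_csupp C M psi -> 0 <= C.
Proof. by move=> [_ H _]; apply: le_trans (H 0); exact: normr_ge0. Qed.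

Lemma integrable_cube_restrict f (M : R) : measurable_fun setT f ->
  (forall x, f x != 0 -> `|x| <= M) ->
  mu.-integrable (cube M) (EFin \o f) -> mu.-integrable setT (EFin \o f).
Proof.
move=> mf fM /(integrable_mkcond _ (measurable_cube M)) H.
rewrite (_ : EFin \o f = (EFin \o f) \_ (cube M))//.
apply/funext => x; rewrite patchE; case: ifPn => //=.
by rewrite notin_setE/= => xM; case: (eqVneq (f x) 0) => [->//|/fM /xM].
Qed.

Lemma locally_integrableM f C M psi : locally_integrable_rV f ->
  bounded_csupp C M psi ->
  mu.-integrable setT (EFin \o (fun x => f x * psi x)).
Proof.
move=> /locally_integrable_rVP[mf fM] [mpsi psiC psiM].
apply: (integrable_cube_restrict (M := M)).
- exact: measurable_funM.
- by move=> x; rewrite mulf_eq0 negb_or => /andP[_ /psiM].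
have mfM : measurable_fun (cube M) f by exact: measurable_funS mf.
apply: (le_integrable (measurable_cube M) _ (g := EFin \o (fun x => C * f x))).
- apply/measurable_EFinP; apply: measurable_funM => //.
  exact: measurable_funS mpsi.
- move=> x _ /=; rewrite lee_fin !normrM mulrC ler_wpM2r//.
  exact: le_trans (psiC x) (ler_norm _).
- have := integrableZl (measurable_cube M) C (fM M).
  by congr (_.-integrable _ _); apply/funext => x /=; rewrite EFinM.
Qed.

Lemma le_Rintegral_locally f C M psi : locally_integrable_rV f ->
  bounded_csupp C M psi ->
  `|\int[mu]_x (f x * psi x)| <= C * \int[mu]_(x in cube M) `|f x|.
Proof.
move=> lf bpsi; have C0 := bounded_csupp_sup_ge0 bpsi.
have fpsi := locally_integrableM lf bpsi.
have /locally_integrable_rVP[mf fM] := lf.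
have [mpsi psiC psiM] := bpsi.
apply: (le_trans (le_normr_Rintegral _ fpsi)) => //.
have nfM : mu.-integrable (cube M) (EFin \o (fun x => `|f x|)).
  exact: (integrable_norm (fM M)).
rewrite -RintegralZl//; last exact: measurable_cube.
rewrite [leRHS]Rintegral_mkcond.
apply: le_Rintegral => //.
- exact: (integrable_norm fpsi).
- have := integrableZl (measurable_cube M) C nfM.
  move/(integrable_mkcond _ (measurable_cube M)).
  congr (_.-integrable _ _); apply/funext => x /=; rewrite !patchE.
  by case: ifPn.
- move=> x _; rewrite patchE; case: ifPn => [_|].
    by rewrite normrM mulrC ler_wpM2r.
  rewrite notin_setE/= => xM; have [->|/psiM /xM//] := eqVneq (psi x) 0.
  by rewrite mulr0 normr0.
Qed.

Lemma continuous_locally_integrable f : continuous f -> locally_integrable_rV f.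
Proof.
move=> cf; apply/locally_integrable_rVP; split.
  exact: continuous_measurable_rV.
move=> M; have [C C0 HC] := bounded_cube M cf.
apply: measurable_bounded_integrable.
- exact: measurable_cube.
- exact: cube_lty.
- by apply: measurable_funTS; exact: continuous_measurable_rV.
- exists C; split; first exact: num_real.
  by move=> D CD x /= /HC /le_trans -> //; exact: ltW.
Qed.

Lemma test_function_bcs psi : test_function psi -> exists C M,
  0 <= M /\ bounded_csupp C M psi.
Proof.
move=> /test_functionP[spsi [M M0 HM]].
have cpsi := smooth_continuous spsi.
have [C C0 HC] := bounded_cube M cpsi.
exists C, M; split => //; split => //; first exact: continuous_measurable_rV.
move=> x; have [->|/HM /HC//] := eqVneq (psi x) 0.
by rewrite normr0.
Qed.

(** Outside the closed cube that contains the support, the function vanishes in a whole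
    neighbourhood, and so do its partials. *)
Lemma test_function_partial psi i : test_function psi ->
  test_function (partial i psi).
Proof.
move=> /test_functionP[spsi [M M0 HM]]; apply/test_functionP; split.
  exact: smooth_partial.
exists M => // x; apply: contraNT; rewrite -ltNge => Mx.
have [_ <-] : is_derive x (basis_vec i) psi 0; last exact/eqP.
have H0 : is_derive x (basis_vec i) (cst (0:R)) (0:R) by exact: is_derive_cst.
apply: near_eq_is_derive H0.
have xMpos : 0 < `|x| - M by rewrite subr_gt0.
apply/nbhs_ballP; exists (`|x| - M) => //= y.
rewrite -ball_normE /ball_/= => xy.
apply/esym/eqP; apply/negP => /negP /HM yM.
have := ler_normD (x - y) y; rewrite subrK.
by move: xy; lra.
Qed.

(** Each integrand is a locally integrable function times a bounded one of bounded support, so both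
    integrals are finite and the identity can be read in [R]. *)
Lemma weak_partialP i f g : weak_partial i f g <->
  [/\ locally_integrable_rV f, locally_integrable_rV g &
      forall phi, test_function phi ->
        \int[mu]_x (f x * partial i phi x) = - \int[mu]_x (g x * phi x)].
Proof.
split=> -[lf lg H]; split=> // phi tphi; have := H phi tphi;
  have [C [M [_ bphi]]] := test_function_bcs tphi;
  have [D [N [_ bdphi]]] := test_function_bcs (test_function_partial i tphi);
  have H1 := EFin_Rintegral (locally_integrableM lf bdphi);
  have H2 := EFin_Rintegral (locally_integrableM lg bphi).
  by rewrite H1 H2 -EFinN => -[].
by rewrite H1 H2 -EFinN => ->.
Qed.

Lemma ge0_integral_preserving (T : 'rV[R]_n -> 'rV[R]_n)
    (f : 'rV[R]_n -> \bar R) (D : set 'rV[R]_n) :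
  measure_preserving T -> measurable D -> measurable_fun D f ->
  (forall x, D x -> 0 <= f x)%E ->
  (\int[mu]_(x in T @^-1` D) f (T x) = \int[mu]_(x in D) f x)%E.
Proof.
move=> [mT muT] mD mf f0.
pose HT := isMeasurableFun.Build _ _ _ _ _ mT.
pose T' : {mfun _ >-> _} := HB.pack T HT.
transitivity (\int[pushforward mu T']_(y in D) f y)%E.
  by rewrite ge0_integral_pushforward// => x /[!inE]; exact: f0.
by apply: eq_measure_integral => A mA _; exact: muT.
Qed.

Lemma integrable_preserving (T : 'rV[R]_n -> 'rV[R]_n) f :
  measure_preserving T -> mu.-integrable setT (EFin \o f) ->
  mu.-integrable setT (EFin \o (f \o T)).
Proof.
move=> pT /integrableP[mf fi]; apply/integrableP; split.
  exact: measurableT_comp mf pT.1.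
have := @ge0_integral_preserving T (fun x => `|(f x)%:E|)%E setT pT measurableT.
by rewrite preimage_setT => ->//; exact: measurableT_comp.
Qed.

Lemma Rintegral_preserving (T : 'rV[R]_n -> 'rV[R]_n) f :
  measure_preserving T -> mu.-integrable setT (EFin \o f) ->
  \int[mu]_x f (T x) = \int[mu]_x f x.
Proof.
move=> pT fi; have [mT muT] := pT.
pose HT := isMeasurableFun.Build _ _ _ _ _ mT.
pose T' : {mfun _ >-> _} := HB.pack T HT.
rewrite /Rintegral; congr fine.
have mf := measurable_int _ fi.
transitivity (\int[pushforward mu T']_y (f y)%:E)%E.
  rewrite (@integral_pushforward _ _ _ _ _ T' mT mu setT _ mf)//.
  by rewrite preimage_setT; exact: (integrable_preserving pT fi).
by apply: eq_measure_integral => A mA _; exact: muT.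
Qed.

End integration.

(** * Construction of an even mollifier *)

Section mollifier.
Context {R : realType} {n : nat}.
Implicit Types (x y v : 'rV[R]_n).

Local Notation mu := (lebesgue_rV n : {measure set 'rV[R]_n -> \bar R}).

Lemma is_derive_coord (eta : R -> R) (d b s : R) (i : 'I_n) x v :
  is_derive (b + s * x ord0 i) (1 : R) eta d ->
  is_derive x v (fun y => eta (b + s * y ord0 i)) (s * v ord0 i * d).
Proof.
move=> /is_deriveP H; apply/is_deriveP => e e0.
set k := s * v ord0 i.
(* [k] may vanish, so the tolerances are divided by its absolute value plus [1]. *)
have k0 : 0 < `|k| + 1 by rewrite ltr_wpDl.
have [|del del0 Hdel] := H (e / (`|k| + 1)); first by rewrite divr_gt0.
exists (del / (`|k| + 1)); first by rewrite divr_gt0.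
move=> h; rewrite ltr_pdivlMr// => hd.
have hkd : `|h * k| < del.
  by rewrite normrM (le_lt_trans _ hd)// ler_wpM2l// lerDl.
have := Hdel _ hkd.
have -> : b + s * (x + h *: v) ord0 i = b + s * x ord0 i + (h * k) *: 1.
  by rewrite [(h * k) *: 1]mulr1 !mxE /k; ring.
rewrite [h * (k * d)]mulrA => /le_trans; apply.
rewrite (normrM h) mulrCA [leRHS]mulrC ler_wpM2l// mulrAC ler_pdivrMr//.
by rewrite ler_wpM2l ?(ltW e0)// lerDl.
Qed.

(** The factor for one coordinate [t] is [exp (- 1 / (r + t)) * exp (- 1 / (r - t))] if [|t| < r]
    and [0] otherwise. The coefficients [1] and [-1] are written out so that both arguments have the
    form [b + s * t]. *)
Definition bump (r : R) x : R :=
  \prod_i (invexp 0 (r + 1 * x ord0 i) * invexp 0 (r + (-1) * x ord0 i)).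

Lemma smooth_bump r : smooth (bump r).
Proof.
pose G : set ('rV[R]_n -> R) := [set g | exists k b s i,
  g = fun x : 'rV[R]_n => invexp k (b + s * x ord0 i)].
apply: (@smooth_gen_alg _ _ G).
  move=> _ [k [b [s [i ->]]]]; split.
    move=> x; apply: (@continuous_comp _ _ _
        (fun x : 'rV[R]_n => b + s * x ord0 i) (invexp k)).
      apply: continuousD; first exact: cst_continuous.
      apply: continuousM; first exact: cst_continuous.
      exact: coord_continuous.
    apply/differentiable_continuous/derivable1_diffP.
    by have [] := is_derive_invexp k (b + s * x ord0 i).
  move=> j; exists (cst (s * basis_vec j ord0 i) *
     ((fun x => invexp k.+2 (b + s * x ord0 i)) +
      cst (- k%:R) * (fun x => invexp k.+1 (b + s * x ord0 i)))).
    apply: gen_alg_mul; first exact: gen_alg_cst.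
    apply: gen_alg_add; last apply: gen_alg_mul; try exact: gen_alg_cst.
      by apply: gen_alg_gen; exists k.+2, b, s, i.
    by apply: gen_alg_gen; exists k.+1, b, s, i.
  move=> x; apply: (is_derive_coord (d := invexp k.+2 (b + s * x ord0 i) +
    - k%:R * invexp k.+1 (b + s * x ord0 i))).
  by rewrite mulNr; exact: is_derive_invexp.
have -> : bump r = \prod_i ((fun x => invexp 0 (r + 1 * x ord0 i)) *
    (fun x => invexp 0 (r + (-1) * x ord0 i))).
  by apply/funext => x; rewrite fct_prodE.
elim/big_ind : _ => [|f g|i _]; first exact: (gen_alg_cst _ 1).
  exact: gen_alg_mul.
by apply: gen_alg_mul; apply: gen_alg_gen;
  [exists 0%N, r, 1, i|exists 0%N, r, (-1), i].
Qed.

Lemma bump_ge0 r x : 0 <= bump r x.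
Proof. by apply: prodr_ge0 => i _; rewrite mulr_ge0// invexp_ge0. Qed.

Lemma bumpN r x : bump r (- x) = bump r x.
Proof.
apply: eq_bigr => i _; rewrite mulrC !mxE.
by congr (invexp _ _ * invexp _ _); ring.
Qed.

Lemma bump_supp r x : 0 < r -> bump r x != 0 -> `|x| <= r.
Proof.
move=> r0; apply: contraNT; rewrite -ltNge => rx.
have [i ri] : exists i, r < `|x ord0 i|.
  apply: contrapT => /forallNP H; move: rx; apply/negP; rewrite -leNgt.
  by apply/rV_norm_le => [|i]; [exact: ltW|rewrite leNgt; exact/negP].
rewrite /bump (bigD1 i)//= mulf_eq0; apply/orP; left.
rewrite mulf_eq0; case: (lerP 0 (x ord0 i)) => xi.
  rewrite ger0_norm// in ri.
  by rewrite [X in _ || X](_ : _ = true) ?orbT//; apply/eqP/invexp_le0; lra.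
rewrite ltr0_norm// in ri.
by rewrite [X in X || _](_ : _ = true)//; apply/eqP/invexp_le0; lra.
Qed.

(** On the cube of half the size both arguments are at least [r / 2], and [invexp 0] increases on
    positive arguments. The bound serves to make the integral of the bump positive. *)
Lemma bump_lb r x : 0 < r -> `|x| <= r / 2 ->
  expR (- (r / 2)^-1) ^+ 2 ^+ n <= bump r x.
Proof.
move=> r0 xr; have r20 : 0 < r / 2 by rewrite divr_gt0.
rewrite -[X in _ ^+ X](card_ord n) -prodr_const.
have H t : r / 2 <= t -> expR (- (r / 2)^-1) <= invexp 0 t.
  move=> rt; have t0 := lt_le_trans r20 rt.
  rewrite /invexp t0 expr0 mul1r ler_expR lerN2.
  by rewrite lef_pV2// posrE.
apply: ler_prod => i _; rewrite exprn_ge0 ?expR_ge0//= expr2.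
have xi := le_trans (rV_coord_le x i) xr.
move: xi; rewrite ler_norml => /andP[xi1 xi2].
by rewrite ler_pM ?expR_ge0//; apply: H; lra.
Qed.

(** Evenness is included because exchanging the two variables in Fubini's theorem reverses the sign
    in [rho (x - y)]. *)
Definition mollifier (r : R) (rho : 'rV[R]_n -> R) : Prop :=
  [/\ test_function rho, forall x, 0 <= rho x,
      forall x, rho x != 0 -> `|x| <= r,
      forall x, rho (- x) = rho x & \int[mu]_x rho x = 1].

Lemma mollifier_exists (r : R) : 0 < r -> exists rho, mollifier r rho.
Proof.
move=> r0.
have tb : test_function (bump r).
  apply/test_functionP; split; first exact: smooth_bump.
  by exists r; [exact: ltW|move=> x; exact: bump_supp].
have [C [M [M0 bb]]] := test_function_bcs tb.
have ib : mu.-integrable setT (EFin \o bump r).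
  have c1 : locally_integrable_rV (cst 1 : 'rV[R]_n -> R).
    by apply: continuous_locally_integrable; exact: cst_continuous.
  have := locally_integrableM c1 bb.
  by congr (_.-integrable _ _); apply/funext => x /=; rewrite mul1r.
set I := \int[mu]_x bump r x.
have I0 : 0 < I.
  rewrite -lte_fin -EFin_Rintegral//.
  set c := expR (- (r / 2)^-1) ^+ 2 ^+ n.
  have c0 : 0 < c by rewrite !exprn_gt0// expR_gt0.
  have mb : measurable_fun setT (EFin \o bump r) by exact: measurable_int ib.
  apply: (@lt_le_trans _ _ (\int[mu]_(x in cube (r / 2)) (bump r x)%:E)%E); last first.
    apply: ge0_subset_integral => //; first exact: measurable_cube.
    by move=> x _; rewrite lee_fin bump_ge0.
  apply: (@lt_le_trans _ _ (\int[mu]_(x in cube (r / 2)) c%:E)%E).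
    rewrite integral_cst/=; last exact: measurable_cube.
    rewrite [X in (_ * X)%E](lebesgue_cube (R := R)) ?divr_ge0 ?ltW//.
    by rewrite -EFinM lte_fin mulr_gt0// exprn_gt0// addr_gt0// divr_gt0.
  apply: ge0_le_integral => //.
  - exact: measurable_cube.
  - by move=> x _; rewrite lee_fin ltW.
  - exact: measurable_funS mb.
  - by move=> x; rewrite lee_fin; exact: bump_lb.
exists (fun x => I^-1 * bump r x); split.
- apply/test_functionP; split.
    pose G : set ('rV[R]_n -> R) := [set g | smooth g].
    apply: (@smooth_gen_alg _ _ G).
      move=> g sg; split; first exact: smooth_continuous.
      move=> i; exists (partial i g); last by move=> x; exact: smooth_is_derive_basis.
      by apply: gen_alg_gen; exact: smooth_partial.
    have -> : (fun x => I^-1 * bump r x) = cst I^-1 * bump r by [].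
    apply: gen_alg_mul; first exact: gen_alg_cst.
    by apply: gen_alg_gen; exact: smooth_bump.
  exists r; first exact: ltW.
  by move=> x; rewrite mulf_eq0 negb_or => /andP[_]; exact: bump_supp.
- by move=> x; rewrite mulr_ge0 ?bump_ge0// invr_ge0 ltW.
- by move=> x; rewrite mulf_eq0 negb_or => /andP[_]; exact: bump_supp.
- by move=> x; rewrite bumpN.
- by rewrite RintegralZl// -/I mulVf// gt_eqF.
Qed.

End mollifier.

(** * Mollification *)

Section convolution.
Context {R : realType} {n : nat}.
Implicit Types (x y v : 'rV[R]_n) (f g psi rho : 'rV[R]_n -> R).

Local Notation mu := (lebesgue_rV n : {measure set 'rV[R]_n -> \bar R}).

Lemma is_derive_Rintegral (F dF : R -> 'rV[R]_n -> R) (G : 'rV[R]_n -> R) :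
  (forall t, mu.-integrable setT (EFin \o F t)) ->
  (forall t x, is_derive t (1 : R) (F^~ x) (dF t x)) ->
  (forall x, 0 <= G x) -> mu.-integrable setT (EFin \o G) ->
  (forall t x, `|t| < 1 -> `|dF t x| <= G x) ->
  is_derive (0 : R) (1 : R) (fun t => \int[mu]_x F t x) (\int[mu]_x dF 0 x).
Proof.
move=> iF dFP G0 iG GdF.
have I0 : `](- 1 : R), 1[%classic 0 by rewrite /= in_itv/= ltrN10 ltr01.
have d1 t x : partial1of2 F t x = dF t x.
  by rewrite partial1of2E; have [_ ->] := dFP t x.
have dF1 t x : `](- 1 : R), 1[%classic t -> setT x -> derivable (F^~ x) t 1.
  by move=> _ _; have [] := dFP t x.
have GF t x : `](- 1 : R), 1[%classic t -> setT x -> `|partial1of2 F t x| <= G x.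
  by rewrite /= in_itv/= -ltr_norml d1 => t1 _; exact: GdF.
have iF' t : `](- 1 : R), 1[%classic t -> mu.-integrable setT (EFin \o F t) by [].
split.
  exact: (derivable_under_integral measurableT I0 iF' dF1 G0 iG GF).
rewrite -derive1E (differentiation_under_integral measurableT I0 iF' dF1 G0 iG GF).
by apply: eq_Rintegral => x _; rewrite d1.
Qed.

Lemma is_derive_oppv f x v (d : R) : is_derive x v f d ->
  is_derive x (- v) f (- d).
Proof.
move=> /is_deriveP H; apply/is_deriveP => e e0.
have [del del0 Hdel] := H e e0; exists del => // h hd.
have := Hdel (- h); rewrite normrN => /(_ hd).
by rewrite scaleNr scalerN mulNr mulrN.
Qed.

Lemma is_derive_lineP f x v (d : R) :
  is_derive (0 : R) (1 : R) (fun t : R => f (x + t *: v)) d <->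
  is_derive x v f d.
Proof.
split=> [/is_deriveP H|H]; last by apply: is_derive_line; rewrite scale0r addr0.
apply/is_deriveP => e e0; have [del del0 Hdel] := H e e0.
exists del => // h hd; have := Hdel h hd.
by rewrite add0r [h *: 1]mulr1 scale0r addr0.
Qed.

Lemma is_derive_compR f (eta : R -> R) x v (d d' : R) :
  is_derive (f x) (1 : R) eta d -> is_derive x v f d' ->
  is_derive x v (eta \o f) (d * d').
Proof.
move=> deta /is_derive_lineP df; apply/is_derive_lineP.
apply: (@is_derive1_comp _ eta (fun t : R => f (x + t *: v))) => //.
by rewrite scale0r addr0.
Qed.

Lemma bounded_csupp_translate C M psi y : bounded_csupp C M psi ->
  bounded_csupp C (M + `|y|) (fun x => psi (x - y)).
Proof.
move=> [mpsi pC pM]; split => //.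
  exact: measurableT_comp mpsi (measurable_rV_translate _).
move=> x /pM xy; rewrite -(subrK y x) (le_trans (ler_normD _ _))//.
by rewrite lerD2r.
Qed.

Lemma indic_bcs (M : R) : bounded_csupp 1 M (\1_(cube M) : 'rV[R]_n -> R).
Proof.
split=> [|x|x].
- by apply: measurable_indic; exact: measurable_cube.
- by rewrite indicE; case: (_ \in _); rewrite ?normr1// normr0 ler01.
- by rewrite indicE; case: (boolP (x \in _)) => [/[!inE]//|_ /=]; rewrite eqxx.
Qed.

Lemma bcs_indic C M psi : bounded_csupp C M psi ->
  forall x, `|psi x| <= C * \1_(cube M) x.
Proof.
move=> [mpsi pC pM] x; rewrite indicE.
have [->|px] := eqVneq (psi x) 0.
  by rewrite normr0 mulr_ge0// (le_trans _ (pC 0)).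
by rewrite mem_set ?mulr1 //; exact: pM.
Qed.

Lemma bcs_integrable C M psi : bounded_csupp C M psi ->
  mu.-integrable setT (EFin \o psi).
Proof.
move=> bpsi.
have c1 : locally_integrable_rV (cst 1 : 'rV[R]_n -> R).
  by apply: continuous_locally_integrable; exact: cst_continuous.
have := locally_integrableM c1 bpsi.
by congr (_.-integrable _ _); apply/funext => x /=; rewrite mul1r.
Qed.

Lemma locally_integrable_norm f : locally_integrable_rV f ->
  locally_integrable_rV (fun x => `|f x|).
Proof.
move=> /locally_integrable_rVP[mf fM]; apply/locally_integrable_rVP; split.
  exact: measurableT_comp.
by move=> M; exact: (integrable_norm (fM M)).
Qed.

Lemma Rintegral_translate psi y : mu.-integrable setT (EFin \o psi) ->
  \int[mu]_x psi (x - y) = \int[mu]_x psi x.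
Proof.
by move=> ipsi; rewrite -(Rintegral_preserving (measure_preserving_translate (- y)) ipsi).
Qed.

(** By translation invariance the integral of [w (x + t *: v)] does not depend on [t];
    differentiating under the integral sign gives the claim, which stands in for integration by
    parts. *)
Lemma Rintegral_is_derive0 (w w' : 'rV[R]_n -> R) v C M C' M' :
  (forall x, is_derive x v w (w' x)) ->
  bounded_csupp C M w -> bounded_csupp C' M' w' ->
  \int[mu]_x w' x = 0.
Proof.
move=> dw bw bw'.
have iw := bcs_integrable bw.
have C'0 := bounded_csupp_sup_ge0 bw'.
have [_ w'C w'M] := bw'.
(* For [|t| < 1] the translated supports all lie in this cube. *)
pose G x := C' * \1_(cube (M' + `|v|)) x.
have := @is_derive_Rintegral (fun t x => w (x + t *: v))
  (fun t x => w' (x + t *: v)) G.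
case.
- move=> t; apply: (integrable_preserving _ iw).
  exact: measure_preserving_translate.
- by move=> t x; apply: is_derive_line.
- by move=> x; rewrite /G mulr_ge0// indicE.
- have := integrableZl measurableT C' (bcs_integrable (indic_bcs (M' + `|v|))).
  by congr (_.-integrable _ _); apply/funext => x.
- move=> t x t1; apply: (le_trans (bcs_indic bw' _)).
  rewrite /G ler_wpM2l// !indicE ler_nat.
  case: (boolP (_ \in cube M')) => // /[!inE] h.
  rewrite mem_set//=; rewrite /cube/= in h *.
  rewrite -(addrK (t *: v) x) (le_trans (ler_normB _ _))// lerD//.
  by rewrite normrZ ler_piMl// ltW.
rewrite (_ : (fun t : R => _) = cst (\int[mu]_x w x)); last first.
  apply/funext => t /=.
  exact: (Rintegral_preserving (measure_preserving_translate _) iw).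
move=> _; rewrite derive_cst => /esym.
by under eq_Rintegral do rewrite scale0r addr0.
Qed.

(** The kernel is reflected with respect to the usual convolution, hence the sign in
    [is_derive_convol]; for even mollifiers the two agree. *)
Definition convol f psi y := \int[mu]_x (f x * psi (x - y)).

Lemma is_derive_convol f psi i y : locally_integrable_rV f ->
  test_function psi ->
  is_derive y (basis_vec i) (convol f psi) (- convol f (partial i psi) y).
Proof.
move=> lf tpsi; have spsi := tpsi.1.
have [C [M [M0 bpsi]]] := test_function_bcs tpsi.
have [D [N [N0 bdpsi]]] := test_function_bcs (test_function_partial i tpsi).
have lnf := locally_integrable_norm lf.
set e := basis_vec i : 'rV[R]_n.
pose K := N + (`|y| + `|e|).
pose G x := `|f x| * (D * \1_(cube K) x).
have D0 := bounded_csupp_sup_ge0 bdpsi.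
have bG : bounded_csupp D K (fun x => D * \1_(cube K) x).
  have [mi iC iM] := indic_bcs K; split.
  - exact: measurable_funM.
  - by move=> x; rewrite normrM ger0_norm// ler_piMr.
  - by move=> x; rewrite mulf_eq0 negb_or => /andP[_ /iM].
have H := @is_derive_Rintegral (fun t x => f x * psi (x - (y + t *: e)))
  (fun t x => f x * - partial i psi (x - (y + t *: e))) G.
have {}H : is_derive (0 : R) (1 : R)
    (fun t : R => convol f psi (y + t *: e)) (- convol f (partial i psi) y).
  have -> : - convol f (partial i psi) y =
      \int[mu]_x (f x * - partial i psi (x - (y + 0 *: e))).
    rewrite /convol scale0r addr0.
    under [RHS]eq_Rintegral do rewrite mulrN -mulN1r.
    rewrite RintegralZl ?mulN1r//.
    exact: (locally_integrableM lf (bounded_csupp_translate y bdpsi)).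
  apply: H.
  - move=> t; apply: (locally_integrableM lf).
    exact: bounded_csupp_translate bpsi.
  - move=> t x.
    have E s : x - (y + s *: e) = x - y + s *: (- e).
      by rewrite scalerN opprD addrA.
    have := is_derive_oppv (smooth_is_derive_basis i (x - (y + t *: e)) spsi).
    rewrite {1}E => /is_derive_line /(is_deriveZ (f x)).
    by congr is_derive; apply/funext => s; rewrite E.
  - by move=> x; rewrite /G !mulr_ge0// indicE.
  - exact: (locally_integrableM lnf bG).
  - move=> t x t1; rewrite normrM normrN /G ler_wpM2l//.
    apply: (le_trans (bcs_indic (bounded_csupp_translate (y + t *: e) bdpsi) x)).
    rewrite ler_wpM2l// !indicE ler_nat.
    case: (boolP (_ \in cube _)) => // /[!inE] h.
    rewrite mem_set//=; rewrite /cube/= in h *.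
    rewrite (le_trans h)// lerD2l (le_trans (ler_normD _ _))// lerD2l.
    by rewrite normrZ ler_piMl// ltW.
exact/is_derive_lineP.
Qed.

Lemma continuous_convol f psi : locally_integrable_rV f -> test_function psi ->
  continuous (convol f psi).
Proof.
move=> lf tpsi y; have cpsi : continuous psi := smooth_continuous tpsi.1.
have [C [M [M0 bpsi]]] := test_function_bcs tpsi.
have [mpsi _ psiM] := bpsi.
apply/(@cvgrPdist_le _ _ _ (nbhs y) _ (convol f psi)) => e e0.
(* The distance to [y'] is capped by [1], so both kernels are supported in this cube; the tolerance
   [e / (K + 1)] is set against the mass [K], which may be zero. *)
set K := \int[mu]_(x in cube (M + 1 + `|y|)) `|f x|.
have K0 : 0 <= K by apply: Rintegral_ge0.
have K1 : 0 < K + 1 by rewrite ltr_wpDl.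
have e10 : 0 < e / (K + 1) by rewrite divr_gt0.
have [d d0 Hd] := unif_continuous_cube (M + 1) cpsi e10.
have d10 : 0 < Num.min d 1 by rewrite lt_min d0 ltr01.
apply/nbhs_ballP; exists (Num.min d 1) => //= y'.
rewrite -ball_normE /ball_/= lt_min => /andP[yy'd yy'1].
have bdiff : bounded_csupp (e / (K + 1)) (M + 1 + `|y|)
    (fun x => psi (x - y) - psi (x - y')).
  have supp x : psi (x - y) - psi (x - y') != 0 -> `|x - y| <= M + 1.
    have [h|/psiM h] := eqVneq (psi (x - y)) 0; last by move=> _; lra.
    rewrite h sub0r oppr_eq0 => /psiM {}h.
    have := ler_normD (x - y') (y' - y); rewrite (distrC y') addrA subrK; lra.
  split.
  - by apply: measurable_funB;
      exact: measurableT_comp mpsi (measurable_rV_translate _).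
  - move=> x; have [->|/supp xy] := eqVneq (psi (x - y) - psi (x - y')) 0.
      by rewrite normr0 ltW.
    apply/ltW/Hd => //.
    by rewrite opprB addrC addrA subrK distrC.
  - move=> x /supp xy; have := ler_normD (x - y) y; rewrite subrK; lra.
rewrite /convol -RintegralB//; last 2 first.
- exact: (locally_integrableM lf (bounded_csupp_translate y bpsi)).
- exact: (locally_integrableM lf (bounded_csupp_translate y' bpsi)).
under eq_Rintegral do rewrite -mulrBr.
apply: (le_trans (le_Rintegral_locally lf bdiff)); rewrite -/K.
by rewrite mulrAC ler_pdivrMr// ler_wpM2l ?ltW// ltrDl.
Qed.

(** The constant [c] is its own mollification because [rho] has integral one, so the difference
    averages [f x - c] with nonnegative weights. *)
Lemma convol_approx f rho (r e c : R) y : locally_integrable_rV f ->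
  mollifier r rho -> (forall x, `|x - y| <= r -> `|f x - c| <= e) ->
  `|convol f rho y - c| <= e.
Proof.
move=> lf [trho rho0 rhor _ rho1] fe.
have [C [M [M0 brho]]] := test_function_bcs trho.
have brhoy := bounded_csupp_translate y brho.
have irho := bcs_integrable brhoy.
have cst_li k : locally_integrable_rV (cst k : 'rV[R]_n -> R).
  by apply: continuous_locally_integrable; exact: cst_continuous.
have int1 k : \int[mu]_x (k * rho (x - y)) = k.
  by rewrite RintegralZl// Rintegral_translate ?rho1 ?mulr1//; exact: bcs_integrable brho.
have i1 := locally_integrableM lf brhoy.
have i2 := locally_integrableM (cst_li c) brhoy.
rewrite /convol -[X in _ - X]int1 -RintegralB//.
have i3 : mu.-integrable setT (EFin \o (fun x => f x * rho (x - y) - c * rho (x - y))).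
  have := integrableB measurableT i1 i2.
  by congr (_.-integrable _ _); apply/funext => x /=; rewrite EFinB.
apply: (le_trans (le_normr_Rintegral measurableT i3)).
rewrite -[leRHS]int1; apply: le_Rintegral => //.
- exact: (integrable_norm i3).
- exact: (locally_integrableM (cst_li e) brhoy).
- move=> x _; rewrite -mulrBl normrM (ger0_norm (rho0 _)).
  have [->|/rhor xy] := eqVneq (rho (x - y)) 0; first by rewrite !mulr0.
  by rewrite ler_wpM2r//; exact: fe.
Qed.

Lemma measurable_subr_rV :
  measurable_fun [set: 'rV[R]_n * 'rV[R]_n] (fun z => z.1 - z.2).
Proof.
apply: measurable_fun_rV => i; under eq_fun do rewrite !mxE.
apply: measurable_funB.
  exact: (measurableT_comp (measurable_coor i) measurable_fst).
exact: (measurableT_comp (measurable_coor i) measurable_snd).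
Qed.

(** Moves the mollifier from [g], which is only locally integrable, to the bounded [psi]; removing
    the mollification then only concerns bounded functions. *)
Lemma convol_Fubini g psi rho C M : locally_integrable_rV g ->
  bounded_csupp C M psi -> test_function rho ->
  (forall x, rho (- x) = rho x) ->
  \int[mu]_y (convol g rho y * psi y) = \int[mu]_x (g x * convol psi rho x).
Proof.
move=> lg bpsi trho rhoN; have [mpsi psiC psiM] := bpsi.
have [D [N [N0 brho]]] := test_function_bcs trho.
have [mrho rhoD rhoN'] := brho.
have C0 := bounded_csupp_sup_ge0 bpsi.
have D0 := bounded_csupp_sup_ge0 brho.
have /locally_integrable_rVP[mg gM] := lg.
pose F (z : 'rV[R]_n * 'rV[R]_n) : \bar R :=
  (g z.1 * (rho (z.1 - z.2) * psi z.2))%:E.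
have mF : measurable_fun setT F.
  apply/measurable_EFinP; apply: measurable_funM.
    exact: measurableT_comp mg measurable_fst.
  apply: measurable_funM; last exact: measurableT_comp mpsi measurable_snd.
  exact: measurableT_comp mrho measurable_subr_rV.
(* A nonzero product has [|y| <= M] and [|x - y| <= N], hence [|x| <= N + M]: the integrand is
   dominated by [G x] times the indicator of [cube M] at [y], which is integrable on the product. *)
pose G x := `|g x| * (C * D * \1_(cube (N + M)) x).
have bG : bounded_csupp (C * D) (N + M) (fun x => C * D * \1_(cube (N + M)) x).
  have [mi iC iM] := indic_bcs (N + M); split.
  - exact: measurable_funM.
  - by move=> x; rewrite normrM ger0_norm ?mulr_ge0// ler_piMr// mulr_ge0.
  - by move=> x; rewrite mulf_eq0 negb_or => /andP[_ /iM].
have iG := locally_integrableM (locally_integrable_norm lg) bG.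
have FG x y : `|g x * (rho (x - y) * psi y)| <= G x * \1_(cube M) y.
  rewrite /G normrM -mulrA ler_wpM2l//.
  have [->|py] := eqVneq (psi y) 0.
    by rewrite mulr0 normr0 !mulr_ge0// indicE.
  have [->|rxy] := eqVneq (rho (x - y)) 0.
    by rewrite mul0r normr0 !mulr_ge0// indicE.
  have yM := psiM _ py; have xyN := rhoN' _ rxy.
  rewrite !indicE !mem_set//= ?mulr1.
    by rewrite normrM mulrC ler_pM.
  by rewrite /cube/= -(subrK y x) (le_trans (ler_normD _ _))// lerD.
have iF : (lebesgue_rV n \x lebesgue_rV n)%E.-integrable setT F.
  apply/integrable12ltyP => //.
  apply: (@le_lt_trans _ _ (\int[mu]_x ((G x)%:E * mu (cube M)))%E).
    apply: ge0_le_integral => //.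
    - by move=> x _; exact: integral_ge0.
    - apply: (@measurable_fun_fubini_tonelli_F _ _ _ _ _ (lebesgue_rV n) (fun z => `|F z|)%E) => //.
      exact: measurableT_comp.
    - apply: emeasurable_funM => //; exact: measurable_int iG.
    - move=> x _.
      have -> : ((G x)%:E * mu (cube M) = \int[mu]_y (G x * \1_(cube M) y)%:E)%E.
        under eq_integral do rewrite EFinM.
        rewrite ge0_integralZl//; last 2 first.
        + apply/measurable_EFinP; apply: measurable_indic; exact: measurable_cube.
        + by rewrite lee_fin /G !mulr_ge0// indicE.
        by rewrite integral_indic// ?setIT//; exact: measurable_cube.
      apply: ge0_le_integral => //.
      + apply/measurableT_comp => //.
        exact: (measurable_comp measurableT _ mF (@measurable_pair1 _ _ _ _ x)).
      + apply/measurable_EFinP; apply: measurable_funM => //.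
        by apply: measurable_indic; exact: measurable_cube.
      + by move=> y _; rewrite lee_fin; exact: FG.
  rewrite ge0_integralZr//; last 2 first.
  - exact: measurable_int iG.
  - by move=> x _; rewrite lee_fin /G !mulr_ge0// indicE.
  rewrite lte_mul_pinfty//.
  - by apply: integral_ge0 => x _; rewrite lee_fin /G !mulr_ge0// indicE.
  - exact: integrable_fin_num iG.
  - exact: cube_lty.
have ipsi x : mu.-integrable setT (EFin \o (fun y => psi y * rho (y - x))).
  have lpsi : locally_integrable_rV psi.
    apply/locally_integrable_rVP; split => // K.
    apply: (integrableS measurableT (measurable_cube K)) => //.
    exact: bcs_integrable bpsi.
  exact: (locally_integrableM lpsi (bounded_csupp_translate x brho)).
have igr y := locally_integrableM lg (bounded_csupp_translate y brho).
have Fy y : (\int[mu]_x F (x, y) = (convol g rho y * psi y)%:E)%E.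
  transitivity (\int[mu]_x (g x * rho (x - y) * psi y)%:E)%E.
    by apply: eq_integral => x _; rewrite /F /= mulrA.
  rewrite EFin_Rintegral ?RintegralZr//.
  have := integrableZr measurableT (psi y) (igr y).
  by congr (_.-integrable _ _); apply/funext => x /=; rewrite EFinM.
have Fx x : (\int[mu]_y F (x, y) = (g x * convol psi rho x)%:E)%E.
  transitivity (\int[mu]_y (g x * (psi y * rho (y - x)))%:E)%E.
    apply: eq_integral => y _; rewrite /F /= [rho _ * _]mulrC.
    by rewrite -[rho (x - y)]rhoN opprB.
  rewrite EFin_Rintegral ?RintegralZl//.
  have := integrableZl measurableT (g x) (ipsi x).
  by congr (_.-integrable _ _); apply/funext => y /=; rewrite EFinM.
have := Fubini iF.
under eq_integral do rewrite Fx.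
under [in X in _ = X -> _]eq_integral do rewrite Fy.
by rewrite /Rintegral => ->.
Qed.

End convolution.

(** * The positive part of a weakly differentiable function *)

Section smooth_pospart.
Context {R : realType}.
Implicit Types (t a b d : R).

Definition sqpos t : R := Num.max t 0 ^+ 2.

(** The first-order remainder is at most [h ^+ 2], whatever the signs of [t] and [t + h]. *)
Lemma is_derive_sqpos t : is_derive t (1 : R) sqpos (2 * Num.max t 0).
Proof.
apply/is_deriveP => e e0; exists e => // h he.
rewrite [h *: 1]mulr1 /sqpos.
have H : `|Num.max (t + h) 0 ^+ 2 - Num.max t 0 ^+ 2 - h * (2 * Num.max t 0)|
    <= `|h| ^+ 2.
  rewrite real_normK ?num_real// ler_norml.
  by case: (lerP (t + h) 0) => th; case: (lerP t 0) => t0; apply/andP; split; nra.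
by apply: (le_trans H); rewrite expr2 ler_wpM2r// ltW.
Qed.

(* A C^1 approximation of [max t 0] that vanishes for [t <= d]; the vanishing
   is what lets a cut-off along a set where [f <= 0] stay differentiable. *)
Definition pos_approx d t : R := (2 * d)^-1 * (sqpos (t - d) - sqpos (t - 2 * d)).

(** The derivative of [pos_approx d]: a piecewise linear ramp that rises from [0] at [d] to [1] at
    [2 * d]. *)
Definition pos_approx' d t : R :=
  d^-1 * (Num.max (t - d) 0 - Num.max (t - 2 * d) 0).

Lemma is_derive_pos_approx d t : 0 < d ->
  is_derive t (1 : R) (pos_approx d) (pos_approx' d t).
Proof.
move=> d0.
have H c : is_derive t (1 : R) (sqpos \o (fun s => s - c)) (2 * Num.max (t - c) 0 * 1).
  apply: is_derive1_comp; first exact: is_derive_sqpos.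
  have := is_deriveB (is_derive_id t (1 : R)) (is_derive_cst c t (1 : R)).
  by rewrite subr0.
have K := is_deriveZ (2 * d)^-1 (is_deriveB (H d) (H (2 * d))).
apply: (is_derive_eq K); rewrite /GRing.scale/= /pos_approx'.
by field; rewrite gt_eqF.
Qed.

Lemma pos_approx_small d t : 0 < d -> t <= d ->
  (pos_approx d t = 0) * (pos_approx' d t = 0).
Proof.
move=> d0 td; rewrite /pos_approx /pos_approx' /sqpos.
have -> : Num.max (t - d) 0 = 0 by apply/max_idPr; lra.
have -> : Num.max (t - 2 * d) 0 = 0 by apply/max_idPr; lra.
by rewrite subrr mulr0 subrr mulr0.
Qed.

Lemma pos_approx'_itv d t : 0 < d -> 0 <= pos_approx' d t <= 1.
Proof.
move=> d0; rewrite /pos_approx' mulrC.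
rewrite ler_pdivrMr// mul1r pmulr_lge0 ?invr_gt0//.
by case: (lerP (t - d) 0) => ?; case: (lerP (t - 2 * d) 0) => ?; apply/andP; split; lra.
Qed.

Lemma pos_approx'_lip d a b : 0 < d ->
  `|pos_approx' d a - pos_approx' d b| <= 2 / d * `|a - b|.
Proof.
move=> d0; have di : 0 <= d^-1 by rewrite invr_ge0 ltW.
rewrite /pos_approx' -mulrBr (normrM d^-1) (ger0_norm di).
rewrite [2 / d]mulrC -[leRHS]mulrA ler_wpM2l//.
have H c : `|Num.max (a - c) 0 - Num.max (b - c) 0| <= `|a - b|.
  have := ler_norm (a - b); have := ler_norm (b - a); rewrite (distrC b) => ? ?.
  by rewrite ler_norml; case: (lerP (a - c) 0) => ?; case: (lerP (b - c) 0) => ?;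
    apply/andP; split; lra.
have := ler_normB (Num.max (a - d) 0 - Num.max (b - d) 0)
  (Num.max (a - 2 * d) 0 - Num.max (b - 2 * d) 0).
have := H d; have := H (2 * d).
set u := Num.max (a - d) 0; set v := Num.max (b - d) 0.
set w := Num.max (a - 2 * d) 0; set z := Num.max (b - 2 * d) 0.
have -> : u - v - (w - z) = u - w - (v - z) by ring.
lra.
Qed.

Lemma pos_approx'_continuous d : 0 < d -> continuous (pos_approx' d).
Proof.
move=> d0 a; apply/cvgrPdist_lt => e e0.
have k0 : 0 < 2 / d by rewrite divr_gt0.
apply/nbhs_ballP; exists (e / (2 / d)) => /=; first by rewrite divr_gt0.
move=> b; rewrite /ball/= ltr_pdivlMr// mulrC; apply: le_lt_trans.
exact: pos_approx'_lip.
Qed.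

Lemma pos_approx_continuous d : 0 < d -> continuous (pos_approx d).
Proof.
move=> d0 a; apply/differentiable_continuous/derivable1_diffP.
by have [] := is_derive_pos_approx a d0.
Qed.

Lemma pos_approx_lip d a b : 0 < d -> `|pos_approx d a - pos_approx d b| <= `|a - b|.
Proof.
move=> d0.
have [c _] := MVT_line b (a - b : R) (fun y => is_derive_pos_approx y d0).
rewrite [(a - b) *: 1]mulr1 [b + (a - b)]addrC subrK => ->.
have /andP[h1 h2] := @pos_approx'_itv d (b + c *: 1) d0.
by rewrite normrM (ger0_norm h1) ler_piMr.
Qed.

(** From [t = 2 * d] on, the approximation is [t - 3 / 2 * d]; below, both terms lie between [0] and
    [2 * d]. *)
Lemma pos_approx_cvg d t : 0 < d -> `|pos_approx d t - Num.max t 0| <= 2 * d.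
Proof.
move=> d0; rewrite /pos_approx /sqpos.
case: (lerP t 0) => t0.
  have -> : Num.max (t - d) 0 = 0 by apply/max_idPr; lra.
  have -> : Num.max (t - 2 * d) 0 = 0 by apply/max_idPr; lra.
  by rewrite subrr mulr0 subrr normr0; lra.
have d2 : 0 < 2 * d by lra.
have di : 0 <= (2 * d)^-1 by rewrite invr_ge0 ltW.
rewrite -[X in _ - X](mulKf (lt0r_neq0 d2)) -mulrBr (normrM (2 * d)^-1).
rewrite (ger0_norm di) mulrC ler_pdivrMr//.
rewrite ler_norml.
by case: (lerP (t - d) 0) => ?; case: (lerP (t - 2 * d) 0) => ?; apply/andP; split; nra.
Qed.

Lemma pos_approx'_cvg d t : 0 < d -> 2 * d <= t -> pos_approx' d t = 1.
Proof.
move=> d0 dt; rewrite /pos_approx'.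
have -> : Num.max (t - d) 0 = t - d by apply/max_idPl; lra.
have -> : Num.max (t - 2 * d) 0 = t - 2 * d by apply/max_idPl; lra.
by field; rewrite gt_eqF.
Qed.

End smooth_pospart.

(** * The chain rule for a mollified function, with cut-off *)

Section weak_chain_rule.
Context {R : realType} {n : nat}.
Implicit Types (x y v : 'rV[R]_n) (f g l phi psi rho : 'rV[R]_n -> R).

Local Notation mu := (lebesgue_rV n : {measure set 'rV[R]_n -> \bar R}).

(** For continuous [l], the indicator of an open set that can jump only where [l = 0]; with [l := f]
    it is also the factor in the weak derivative of the positive part. *)
Definition chi l x : R := if 0 < l x then 1 else 0.

Lemma chi_itv l x : 0 <= chi l x <= 1.
Proof. by rewrite /chi; case: ifP; rewrite ?ler01 ?lexx. Qed.

Lemma normr_chi l x : `|chi l x| <= 1.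
Proof. by have /andP[h0 h1] := chi_itv l x; rewrite ger0_norm. Qed.

Lemma measurable_chi l : continuous l -> measurable_fun setT (chi l).
Proof.
move=> cl; have ml := continuous_measurable_rV cl.
by apply: measurable_fun_ifT => //; exact: measurable_fun_ltr.
Qed.

(** Where [l] does not vanish the indicator is locally constant; where it does, [f <= 0 < d] gives
    [f < d] nearby. A factor that vanishes for [f < d] therefore hides the jump. *)
Lemma near_chi f l d : continuous f -> continuous l -> 0 < d ->
  (forall x, l x = 0 -> f x <= 0) ->
  forall x, \forall y \near x, chi l y = chi l x \/ f y < d.
Proof.
move=> cf cl d0 fl x; have [lx|lx|lx] := ltgtP (l x) 0.
- have : \forall y \near x, l y < 0 by exact: (cvgr_lt (l x) (cl x)).
  by apply: filterS => y ly; left; rewrite /chi !ltNge !ltW.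
- have : \forall y \near x, 0 < l y by exact: (cvgr_gt (l x) (cl x)).
  by apply: filterS => y ly; left; rewrite /chi ly lx.
- have fx : f x < d by rewrite (le_lt_trans (fl _ lx)).
  have : \forall y \near x, f y < d by exact: (cvgr_lt (f x) (cf x)).
  by apply: filterS => y; right.
Qed.

Lemma continuous_chi f l d (h : R -> R) : continuous f -> continuous l ->
  0 < d -> (forall x, l x = 0 -> f x <= 0) -> continuous h ->
  (forall t, t <= d -> h t = 0) -> continuous (fun x => chi l x * h (f x)).
Proof.
move=> cf cl d0 fl ch h0 x.
have c1 : (chi l x * h (f y)) @[y --> x] --> chi l x * h (f x).
  have chf : {for x, continuous (h \o f)} by apply: continuous_comp; [exact: cf|exact: ch].
  have cc : {for x, continuous (cst (chi l x) : 'rV[R]_n -> R)} by exact: cst_continuous.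
  exact: (continuousM cc chf).
have E : \forall y \near x, chi l x * h (f y) = chi l y * h (f y).
  have := near_chi cf cl d0 fl x; apply: filterS => y [->//|fy].
  by rewrite h0 ?mulr0// ltW.
exact: (cvg_trans (near_eq_cvg E) c1).
Qed.

Lemma continuous_bcs psi (M : R) : continuous psi ->
  (forall x, psi x != 0 -> `|x| <= M) -> exists C, bounded_csupp C M psi.
Proof.
move=> cpsi psiM; have [C C0 HC] := bounded_cube M cpsi.
exists C; split => //; first exact: continuous_measurable_rV.
move=> x; have [->|/psiM /HC//] := eqVneq (psi x) 0.
by rewrite normr0.
Qed.

Lemma bounded_csuppM C M D psi (h : 'rV[R]_n -> R) : measurable_fun setT h ->
  (forall x, `|h x| <= D) -> bounded_csupp C M psi ->
  bounded_csupp (D * C) M (fun x => h x * psi x).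
Proof.
move=> mh hD [mpsi psiC psiM]; split.
- exact: measurable_funM.
- by move=> x; rewrite normrM ler_pM.
- by move=> x; rewrite mulf_eq0 negb_or => /andP[_ /psiM].
Qed.

Lemma le0_eq0_arch (a A : R) : (forall e, 0 < e -> `|a| <= A * e) -> a = 0.
Proof.
move=> H; apply/eqP; rewrite -normr_eq0 eq_le normr_ge0 andbT.
apply/ler_addgt0Pl => e e0; rewrite addr0.
have A1 : 0 < `|A| + 1 by rewrite ltr_wpDl.
apply: (le_trans (H (e / (`|A| + 1)) _)); first by rewrite divr_gt0.
rewrite mulrA ler_pdivrMr// mulrC ler_wpM2l//; first exact: ltW.
by have := ler_norm A; lra.
Qed.

Section fixed_d.
Variables (i : 'I_n) (f g l : 'rV[R]_n -> R) (d : R).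
Hypotheses (d0 : 0 < d) (cf : continuous f) (cl : continuous l).
Hypothesis fl : forall x, l x = 0 -> f x <= 0.
Hypothesis wfg : weak_partial i f g.

(** The weak identity is tested against the translate [rho (x - y)] with [y] fixed. Derivatives in
    [x] and in [y] differ by a sign, which cancels the one in the definition. *)
Lemma weak_partial_mollify rho (r : R) y : mollifier r rho ->
  is_derive y (basis_vec i) (convol f rho) (convol g rho y).
Proof.
move=> [trho _ _ _ _].
have /weak_partialP[lf lg H] := wfg.
suff -> : convol g rho y = - convol f (partial i rho) y by exact: is_derive_convol.
have tphi : test_function (fun x => rho (x *m 1%:M + - y)).
  by apply: (test_function_affine (B := 1%:M)) => //; rewrite mulmx1.
have E1 : (fun x => rho (x *m 1%:M - y)) = (fun x => rho (x - y)).
  by apply/funext => x; rewrite mulmx1.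
rewrite E1 in tphi; have E := H _ tphi.
transitivity (- \int[mu]_x (f x * partial i (fun x => rho (x - y)) x)).
  by rewrite E opprK.
apply: (congr1 -%R); apply: eq_Rintegral => x _; apply: (congr1 ( *%R (f x))).
have := smooth_is_derive_basis i (x - y) trho.1 => /is_derive_lineP K.
have : is_derive x (basis_vec i) (fun x => rho (x - y)) (partial i rho (x - y)).
  apply/is_derive_lineP; move: K; congr is_derive.
  by apply/funext => t; congr rho; rewrite addrAC.
by case.
Qed.

(* The product of [chi l], [pos_approx d] of the mollified [f], and [phi] is
   classically differentiable because the middle factor vanishes near [l = 0];
   its derivative has zero integral, and Fubini moves the mollifier from [g]. *)
Lemma weak_chain_mollified rho (r : R) phi (C M : R) :
  mollifier r rho -> test_function phi -> bounded_csupp C M phi ->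
  (forall y, `|y| <= M + 1 -> `|convol f rho y - f y| <= d / 2) ->
  \int[mu]_x (chi l x * pos_approx d (convol f rho x) * partial i phi x) =
  - \int[mu]_x (g x * convol (fun y => chi l y * pos_approx' d (convol f rho y) * phi y)
                  rho x).
Proof.
move=> mrho tphi bphi Uf.
have [trho rho0 rhor rhoN rho1] := mrho.
have /weak_partialP[lf lg _] := wfg.
set U := convol f rho; set V := convol g rho.
have cU : continuous U by exact: continuous_convol.
have cV : continuous V by exact: continuous_convol.
have cphi : continuous phi := smooth_continuous tphi.1.
have tdphi := test_function_partial i tphi.
have cdphi : continuous (partial i phi) := smooth_continuous tdphi.1.
have [D [N [N0 bdphi]]] := test_function_bcs tdphi.
have [mphi phiC phiM] := bphi.
have mchi := measurable_chi cl.
have cPU : continuous (pos_approx d \o U).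
  by move=> x; apply: continuous_comp; [exact: cU|exact: pos_approx_continuous].
have cP'U : continuous (pos_approx' d \o U).
  by move=> x; apply: continuous_comp; [exact: cU|exact: pos_approx'_continuous].
have [D1 b1] : exists D1, bounded_csupp D1 M (fun x => pos_approx d (U x) * phi x).
  apply: continuous_bcs.
    by move=> x; exact: (continuousM (cPU x) (cphi x)).
  by move=> x; rewrite mulf_eq0 negb_or => /andP[_ /phiM].
have [D2 b2] : exists D2, bounded_csupp D2 M
    (fun x => V x * (pos_approx' d (U x) * phi x)).
  apply: continuous_bcs.
    by move=> x; exact: (continuousM (cV x) (continuousM (cP'U x) (cphi x))).
  by move=> x; rewrite !mulf_eq0 !negb_or => /and3P[_ _ /phiM].
have [D3 b3] : exists D3, bounded_csupp D3 N
    (fun x => pos_approx d (U x) * partial i phi x).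
  apply: continuous_bcs.
    by move=> x; exact: (continuousM (cPU x) (cdphi x)).
  by move=> x; rewrite !mulf_eq0 !negb_or => /andP[_ /(bcs_supp bdphi)].
have bw := bounded_csuppM mchi (normr_chi l) b1.
have b2' := bounded_csuppM mchi (normr_chi l) b2.
have b3' := bounded_csuppM mchi (normr_chi l) b3.
pose w x := chi l x * (pos_approx d (U x) * phi x).
pose w' x := chi l x * (V x * (pos_approx' d (U x) * phi x)) +
  chi l x * (pos_approx d (U x) * partial i phi x).
have dw x : is_derive x (basis_vec i) w (w' x).
  have dU : is_derive x (basis_vec i) U (V x) by exact: (weak_partial_mollify _ mrho).
  have dPU := is_derive_compR (is_derive_pos_approx (U x) d0) dU.
  (* The indicator is frozen at its value at [x]. This changes nothing near [x]: either it is
     locally constant, or [f < d / 2], so that [U <= d] and [pos_approx d] vanishes, or [phi]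
     vanishes near [x]. *)
  have dW := is_deriveZ (chi l x) (is_deriveM dPU (smooth_is_derive_basis i x tphi.1)).
  have -> : w' x = chi l x *: ((pos_approx d \o U) x *: partial i phi x +
      phi x *: (pos_approx' d (U x) * V x)).
    by rewrite /w' /GRing.scale/=; ring.
  apply: near_eq_is_derive dW.
  change (\forall y \near x,
    chi l x * (pos_approx d (U y) * phi y) = chi l y * (pos_approx d (U y) * phi y)).
  have [xM|Mx] := leP `|x| M.
    have d20 : 0 < d / 2 by rewrite divr_gt0.
    have := near_chi cf cl d20 fl x.
    have : \forall y \near x, `|y| <= M + 1.
      apply/nbhs_ballP; exists 1 => //= y; rewrite -ball_normE /ball_/= => xy.
      have := ler_normB x (x - y); rewrite opprB addrC subrK.
      by move: xM xy; lra.
    apply: filterS2 => y yM [->//|fy].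
    have Uyd : U y <= d.
      have := Uf y yM; rewrite -/U => /(le_trans (ler_norm _)).
      by move: fy; lra.
    by rewrite (pos_approx_small d0 Uyd).1 !mul0r !mulr0.
  have : \forall y \near x, phi y = 0.
    have xMpos : 0 < `|x| - M by rewrite subr_gt0.
    apply/nbhs_ballP; exists (`|x| - M) => //= y.
    rewrite -ball_normE /ball_/= => xy.
    apply/eqP; apply/negP => /negP /phiM yM.
    have := ler_normD (x - y) y; rewrite subrK.
    by move: xy; lra.
  by apply: filterS => y ->; rewrite !mulr0.
have bw' : bounded_csupp (1 * D2 + 1 * D3) (Num.max M N) w'.
  split.
  - by apply: measurable_funD; [exact: bcs_meas b2'|exact: bcs_meas b3'].
  - move=> x; apply: (le_trans (ler_normD _ _)).
    by rewrite lerD//; [exact: (bcs_bound b2')|exact: (bcs_bound b3')].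
  - move=> x; rewrite le_max /w'.
    case: (eqVneq (chi l x * (V x * (pos_approx' d (U x) * phi x))) 0) => [->|].
      by rewrite add0r => /(bcs_supp b3') ->; rewrite orbT.
    by move=> /(bcs_supp b2') ->.
have := Rintegral_is_derive0 dw bw bw'.
rewrite /w' RintegralD//; last 2 first.
- exact: bcs_integrable b2'.
- exact: bcs_integrable b3'.
move/eqP; rewrite addrC addr_eq0 => /eqP E.
transitivity (\int[mu]_x (chi l x * (pos_approx d (U x) * partial i phi x))).
  by apply: eq_Rintegral => x _; rewrite mulrA.
rewrite E; apply: (congr1 -%R).
have bPsi : bounded_csupp (1 * (1 * C)) M
    (fun y => chi l y * (pos_approx' d (U y) * phi y)).
  apply: bounded_csuppM => //; first exact: normr_chi.
  apply: bounded_csuppM => //; first exact: continuous_measurable_rV.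
  move=> x; have /andP[h0 h1] := pos_approx'_itv (U x) d0.
  by rewrite ger0_norm.
have -> : (fun y => chi l y * pos_approx' d (U y) * phi y) =
    (fun y => chi l y * (pos_approx' d (U y) * phi y)).
  by apply/funext => y; rewrite mulrA.
rewrite -(convol_Fubini lg bPsi trho rhoN).
by apply: eq_Rintegral => x _; rewrite -/V; ring.
Qed.

End fixed_d.

End weak_chain_rule.

(** * Removal of the mollification *)

Section weak_positive_part.
Context {R : realType} {n : nat}.
Implicit Types (x y v : 'rV[R]_n) (phi psi rho : 'rV[R]_n -> R).

Local Notation mu := (lebesgue_rV n : {measure set 'rV[R]_n -> \bar R}).

Variables (i : 'I_n) (f g l : 'rV[R]_n -> R).
Hypotheses (cf : continuous f) (cl : continuous l).
Hypothesis fl : forall x, l x = 0 -> f x <= 0.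
Hypothesis wfg : weak_partial i f g.

(** The mollified identity is compared with its limit quantitatively: both sides change by at most a
    constant times [e], the constant depending on [d], [g] and [phi] but not on the mollifier. *)
Lemma weak_chain_pos_approx (d : R) phi : 0 < d -> test_function phi ->
  \int[mu]_x (chi l x * pos_approx d (f x) * partial i phi x) =
  - \int[mu]_x (g x * (chi l x * pos_approx' d (f x) * phi x)).
Proof.
move=> d0 tphi; have /weak_partialP[lf lg _] := wfg.
have [C [M [M0 bphi]]] := test_function_bcs tphi.
have tdphi := test_function_partial i tphi.
have [D [N [N0 bdphi]]] := test_function_bcs tdphi.
have cphi : continuous phi := smooth_continuous tphi.1.
have cdphi : continuous (partial i phi) := smooth_continuous tdphi.1.
have C0 := bounded_csupp_sup_ge0 bphi.
have D0 := bounded_csupp_sup_ge0 bdphi.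
have [mphi phiC phiM] := bphi; have [mdphi dphiD dphiN] := bdphi.
have mchi := measurable_chi cl.
pose Psi x := chi l x * pos_approx' d (f x) * phi x.
have cPsi : continuous Psi.
  have H : continuous (fun x => chi l x * pos_approx' d (f x)).
    apply: (continuous_chi cf cl d0 fl); first exact: pos_approx'_continuous.
    by move=> t td; rewrite (pos_approx_small d0 td).2.
  by move=> x; exact: (continuousM (H x) (cphi x)).
have chi1 (h : 'rV[R]_n -> R) x : `|chi l x * h x| <= `|h x|.
  by rewrite normrM ler_piMl// normr_chi.
have P'1 (h : 'rV[R]_n -> R) x : `|pos_approx' d (h x)| <= 1.
  have /andP[h0 h1] := pos_approx'_itv (h x) d0.
  by rewrite ger0_norm.
have cP'h (h : 'rV[R]_n -> R) : continuous h -> continuous (pos_approx' d \o h).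
  by move=> ch x; apply: continuous_comp; [exact: ch|exact: pos_approx'_continuous].
have cPh (h : 'rV[R]_n -> R) : continuous h -> continuous (pos_approx d \o h).
  by move=> ch x; apply: continuous_comp; [exact: ch|exact: pos_approx_continuous].
have bPsih (h : 'rV[R]_n -> R) : continuous h ->
    bounded_csupp (1 * C) M (fun x => chi l x * pos_approx' d (h x) * phi x).
  move=> ch; apply: bounded_csuppM => //.
    apply: measurable_funM => //.
    by apply: (@continuous_measurable_rV _ _ (pos_approx' d \o h)); exact: cP'h.
  by move=> x; apply: (le_trans (chi1 (pos_approx' d \o h) x)); exact: P'1.
have bPsi : bounded_csupp (1 * C) M Psi := bPsih f cf.
have bPh (h : 'rV[R]_n -> R) : continuous h -> exists E,
    bounded_csupp E N (fun x => chi l x * pos_approx d (h x) * partial i phi x).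
  move=> ch; have [E bE] : exists E, bounded_csupp E N
      (fun x => (pos_approx d \o h) x * partial i phi x).
    apply: continuous_bcs => [x|x]; last first.
      by rewrite mulf_eq0 negb_or => /andP[_ /dphiN].
    exact: (continuousM (cPh _ ch x) (cdphi x)).
  exists (1 * E); have := bounded_csuppM mchi (normr_chi l) bE.
  by congr bounded_csupp; apply/funext => x /=; rewrite mulrA.
set I1 := \int[mu]_(x in cube N) `|1 : R|.
set I2 := \int[mu]_(x in cube (M + 1)) `|g x|.
have I10 : 0 <= I1 by apply: Rintegral_ge0.
have I20 : 0 <= I2 by apply: Rintegral_ge0.
have B0 : 0 <= 2 / d * C + 1 by rewrite addr_ge0// mulr_ge0// divr_ge0// ltW.
apply/eqP; rewrite -addr_eq0; apply/eqP.
apply: (@le0_eq0_arch _ _ (D * I1 + (2 / d * C + 1) * I2)) => e' e'0.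
(* The cap [d / 2] is the closeness of [U] to [f] that [weak_chain_mollified] demands. *)
set e := Num.min e' (d / 2).
have e0 : 0 < e by rewrite lt_min e'0 divr_gt0.
apply: (@le_trans _ _ ((D * I1 + (2 / d * C + 1) * I2) * e)); last first.
  by rewrite ler_wpM2l ?ge_min ?lexx// addr_ge0// mulr_ge0.
have ed : e <= d / 2 by rewrite ge_min lexx orbT.
have [r1 r10 Hr1] := unif_continuous_cube (M + N + 1) cf e0.
have [r2 r20 Hr2] := unif_continuous_cube (M + 1) cPsi e0.
(* [r < r1] controls [f], [r < r2] controls [Psi], and [r <= 1] keeps the mollified supports within
   one unit of the old ones. *)
set r := Num.min 1 (Num.min (r1 / 2) (r2 / 2)).
have r0 : 0 < r by rewrite !lt_min ltr01 !divr_gt0.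
have rr1 : r < r1.
  by rewrite /r !gt_min [r1 / 2 < r1](_ : _ = true) ?orbT//; lra.
have rr2 : r < r2.
  by rewrite /r !gt_min [r2 / 2 < r2](_ : _ = true) ?orbT//; lra.
have r1' : r <= 1 by rewrite ge_min lexx.
have [rho mrho] := @mollifier_exists R n r r0.
have [trho _ rhor _ _] := mrho.
set U := convol f rho.
have cU : continuous U by exact: continuous_convol.
have Uf y : `|y| <= M + N + 1 -> `|U y - f y| <= e.
  move=> yM; apply: (convol_approx lf mrho) => x xy.
  by rewrite distrC; apply/ltW/Hr1 => //; rewrite distrC (le_lt_trans xy).
have Ud y : `|y| <= M + 1 -> `|U y - f y| <= d / 2.
  by move=> yM; apply: le_trans ed; apply: Uf; lra.
have E := weak_chain_mollified d0 cf cl fl wfg mrho tphi bphi Ud.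
set Psie := (fun y => chi l y * pos_approx' d (U y) * phi y).
rewrite -/U -/Psie in E.
have bPsie : bounded_csupp (1 * C) M Psie := bPsih U cU.
have lPsie : locally_integrable_rV Psie.
  apply/locally_integrable_rVP; split; first exact: bcs_meas bPsie.
  move=> K; apply: (integrableS measurableT (measurable_cube K)) => //.
  exact: bcs_integrable bPsie.
have [E1 bE1] := bPh f cf; have [E2 bE2] := bPh U cU.
have bA : bounded_csupp (D * e) N (fun x =>
    chi l x * pos_approx d (f x) * partial i phi x -
    chi l x * pos_approx d (U x) * partial i phi x).
  split.
  - by apply: measurable_funB; [exact: bcs_meas bE1|exact: bcs_meas bE2].
  - move=> x; rewrite -mulrBl normrM.
    have [->|/dphiN xN] := eqVneq (partial i phi x) 0.
      by rewrite normr0 mulr0 mulr_ge0// ltW.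
    rewrite mulrC ler_pM// -mulrBr.
    apply: (le_trans (chi1 (fun x => pos_approx d (f x) - pos_approx d (U x)) x)).
    rewrite (le_trans (pos_approx_lip _ _ d0))// distrC Uf//; lra.
  - by move=> x; rewrite -mulrBl mulf_eq0 negb_or => /andP[_ /dphiN].
(* Replacing [U] by [f] costs [2 / d * C * e], since [2 / d] is a Lipschitz constant of
   [pos_approx' d]; averaging [Psi] over distance [r] costs one more [e]. *)
have bB : bounded_csupp ((2 / d * C + 1) * e) (M + 1)
    (fun x => Psi x - convol Psie rho x).
  have approx x (a : R) : 0 <= a -> (forall y, `|y - x| <= r -> `|Psie y - Psi x| <= a) ->
      `|Psi x - convol Psie rho x| <= a.
    by move=> a0 H; rewrite distrC; apply: (convol_approx lPsie mrho).
  split.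
  - apply: measurable_funB; first exact: bcs_meas bPsi.
    by apply: continuous_measurable_rV; exact: continuous_convol.
  - move=> x; apply: approx; first by rewrite mulr_ge0// ltW.
    move=> y yx; have -> : Psie y - Psi x = (Psie y - Psi y) + (Psi y - Psi x) by ring.
    rewrite (le_trans (ler_normD _ _))// mulrDl mul1r lerD//.
      rewrite /Psie /Psi -mulrBl normrM.
      have [->|/phiM yM] := eqVneq (phi y) 0.
        by rewrite normr0 mulr0 mulr_ge0 ?(ltW e0)// mulr_ge0// divr_ge0// ltW.
      rewrite mulrAC ler_pM// -mulrBr.
      apply: (le_trans (chi1 (fun x => pos_approx' d (U x) - pos_approx' d (f x)) y)).
      rewrite (le_trans (pos_approx'_lip _ _ d0))// ler_wpM2l//.
        by rewrite divr_ge0// ltW.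
      by apply: Uf; lra.
    have [xM|Mx] := leP `|x| (M + 1).
      apply/ltW; rewrite distrC; apply: Hr2 => //.
      by rewrite distrC (le_lt_trans yx).
    have Psi0 z : M < `|z| -> Psi z = 0.
      by move=> Mz; apply/eqP/negP => /negP /(bcs_supp bPsi); rewrite leNgt Mz.
    rewrite !Psi0 ?subrr ?normr0 ?ltW//; first lra.
    have := ler_normB y (y - x); rewrite subKr.
    by move: yx r1' Mx; lra.
  - move=> x; apply: contraNT; rewrite -ltNge => Mx.
    have Psi0 : Psi x = 0.
      apply/eqP/negP => /negP /(bcs_supp bPsi).
      by move: Mx; lra.
    rewrite -normr_le0; apply: approx => // y yx.
    rewrite Psi0 subr0.
    suff -> : Psie y = 0 by rewrite normr0.
    apply/eqP/negP => /negP /(bcs_supp bPsie) yM.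
    have := ler_normB y (y - x); rewrite subKr.
    by move: yx r1' Mx; lra.
have iA1 := bcs_integrable bE1; have iA2 := bcs_integrable bE2.
have iB1 := locally_integrableM lg bPsi.
have mconv : measurable_fun setT (convol Psie rho).
  by apply: continuous_measurable_rV; exact: continuous_convol.
have bconv : bounded_csupp (1 * C + (2 / d * C + 1) * e) (M + 1) (convol Psie rho).
  have E3 x : convol Psie rho x = Psi x - (Psi x - convol Psie rho x) by ring.
  split => // x; first rewrite E3 (le_trans (ler_normB _ _))// lerD//.
  - exact: (bcs_bound bPsi).
  - exact: (bcs_bound bB).
  apply: contraNT; rewrite -ltNge => Mx; rewrite E3.
  have -> : Psi x - convol Psie rho x = 0.
    by apply/eqP/negP => /negP /(bcs_supp bB); rewrite leNgt Mx.
  by rewrite subr0; apply/negP => /negP /(bcs_supp bPsi); move: Mx; lra.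
have iB2 := locally_integrableM lg bconv.
have c1 : locally_integrable_rV (cst 1 : 'rV[R]_n -> R).
  by apply: continuous_locally_integrable; exact: cst_continuous.
have HA : `|\int[mu]_x (chi l x * pos_approx d (f x) * partial i phi x) -
    \int[mu]_x (chi l x * pos_approx d (U x) * partial i phi x)| <= D * I1 * e.
  rewrite -(RintegralB measurableT iA1 iA2).
  have := le_Rintegral_locally c1 bA; rewrite -/I1 mulrAC.
  by under eq_Rintegral do rewrite mul1r.
have HB : `|\int[mu]_x (g x * Psi x) - \int[mu]_x (g x * convol Psie rho x)| <=
    (2 / d * C + 1) * I2 * e.
  rewrite -(RintegralB measurableT iB1 iB2).
  have := le_Rintegral_locally lg bB; rewrite -/I2 mulrAC.
  by under eq_Rintegral do rewrite mulrBr.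
move: HA HB; rewrite E.
set a1 := \int[mu]_x (chi l x * pos_approx d (f x) * partial i phi x).
set a2 := \int[mu]_x (g x * Psi x).
set a3 := \int[mu]_x (g x * convol Psie rho x).
move=> HA HB.
have -> : a1 + a2 = (a1 - - a3) + (a2 - a3) by ring.
rewrite (le_trans (ler_normD _ _))// mulrDl lerD//.
Qed.

End weak_positive_part.

(** * Passage from the approximations to the positive part itself *)

Section weak_positive_part_limit.
Context {R : realType} {n : nat}.
Implicit Types (x y v : 'rV[R]_n) (a f g h l phi : 'rV[R]_n -> R).

Local Notation mu := (lebesgue_rV n : {measure set 'rV[R]_n -> \bar R}).

(** Dominated convergence: the common bound and radius give the dominating function [C * |a|] on
    [cube M]. *)
Lemma Rintegral_bcs_cvg a (h_ : nat -> 'rV[R]_n -> R) h (C M : R) :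
  locally_integrable_rV a -> (forall k, bounded_csupp C M (h_ k)) ->
  bounded_csupp C M h -> (forall x, h_ k x @[k --> \oo] --> h x) ->
  \int[mu]_x (a x * h_ k x) @[k --> \oo] --> \int[mu]_x (a x * h x).
Proof.
move=> la bh_ bh hh.
have C0 := bounded_csupp_sup_ge0 bh.
have bI : bounded_csupp C M (fun x => C * \1_(cube M) x).
  have [mi iC iM] := @indic_bcs R n M; split.
  - exact: measurable_funM.
  - by move=> x; rewrite normrM ger0_norm// ler_piMr.
  - by move=> x; rewrite mulf_eq0 negb_or => /andP[_ /iM].
have iG := locally_integrableM (locally_integrable_norm la) bI.
have mh k := measurable_int _ (locally_integrableM la (bh_ k)).
have mh0 := measurable_int _ (locally_integrableM la bh).
have i0 := locally_integrableM la bh.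
have cvg_ah : {ae mu, forall x, setT x ->
    (a x * h_ k x)%:E @[k --> \oo] --> (a x * h x)%:E}.
  apply/aeW => x _; apply/fine_cvgP; split; first exact: nearW.
  exact: (cvgM (cvg_cst (a x)) (hh x)).
have dom : {ae mu, forall x k, setT x ->
    (`|(a x * h_ k x)%:E| <= (`|a x| * (C * \1_(cube M) x))%:E)%E}.
  apply/aeW => x k _; rewrite lee_fin normrM ler_wpM2l//.
  exact: bcs_indic (bh_ k) x.
have [_ _ H] := dominated_convergence measurableT mh mh0 cvg_ah iG dom.
rewrite /Rintegral; apply: fine_cvg.
by rewrite fineK//; exact: integrable_fin_num i0.
Qed.

Lemma locally_integrable_bounded g h : locally_integrable_rV g ->
  measurable_fun setT h -> (forall x, `|h x| <= 1) ->
  locally_integrable_rV (fun x => h x * g x).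
Proof.
move=> /locally_integrable_rVP[mg gM] mh h1; apply/locally_integrable_rVP; split.
  exact: measurable_funM.
move=> M; apply: (le_integrable (measurable_cube M) _ _ (gM M)).
- apply/measurable_EFinP; apply: measurable_funM; first exact: measurable_funS mh.
  exact: measurable_funS mg.
- by move=> x _ /=; rewrite lee_fin normrM ler_piMl.
Qed.

Lemma pos_approx_cvg_seq (t : R) :
  pos_approx k.+1%:R^-1 t @[k --> \oo] --> Num.max t 0.
Proof.
apply/cvgrPdist_le => e e0.
have e2 : 0 < e / 2 by rewrite divr_gt0.
near=> k; rewrite distrC (le_trans (pos_approx_cvg _ _))// mulrC -ler_pdivlMr//.
by apply/ltW; near: k; exact: (near_infty_natSinv_lt (PosNum e2)).
Unshelve. all: by end_near. Qed.

(** Every ramp vanishes for [t <= 0], so the limit at [0] is [0], in agreement with the strict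
    inequality in [chi]; for [t > 0] the ramps are eventually [1]. *)
Lemma pos_approx'_cvg_seq (t : R) :
  pos_approx' k.+1%:R^-1 t @[k --> \oo] --> (if 0 < t then 1 else 0 : R).
Proof.
have [t0|t0] := ltP 0 t; last first.
  rewrite (_ : (fun k => _) = cst 0); first exact: cvg_cst.
  apply/funext => k; rewrite (pos_approx_small _ _).2//.
  exact: le_trans t0 _.
apply/cvgrPdist_le => e e0.
have e2 : 0 < t / 2 by rewrite divr_gt0.
near=> k; rewrite pos_approx'_cvg ?subrr ?normr0 ?ltW//.
rewrite -ltr_pdivlMl// mulrC.
by near: k; exact: (near_infty_natSinv_lt (PosNum e2)).
Unshelve. all: by end_near. Qed.

(** A uniform limit: [chi l * pos_approx d f] is continuous and within [2 * d] of the function;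
    [d = e / 8] leaves [e / 4] for each of the two replacements. *)
Lemma continuous_pos_part f l : continuous f -> continuous l ->
  (forall x, l x = 0 -> f x <= 0) ->
  continuous (fun x => chi l x * Num.max (f x) 0).
Proof.
move=> cf cl fl x.
apply/(@cvgrPdist_le _ _ _ (nbhs x) _ (fun x => chi l x * Num.max (f x) 0)) => e e0.
have d0 : 0 < e / 8 by rewrite divr_gt0.
have e20 : 0 < e / 2 by rewrite divr_gt0.
pose P x := chi l x * pos_approx (e / 8) (f x).
have cP : continuous P.
  apply: (continuous_chi cf cl d0 fl); first exact: pos_approx_continuous.
  by move=> t td; rewrite (pos_approx_small d0 td).1.
have PE z : `|P z - chi l z * Num.max (f z) 0| <= e / 4.
  rewrite /P -mulrBr normrM (le_trans (ler_piMl _ (normr_chi l z)))//.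
  by rewrite (le_trans (pos_approx_cvg _ d0))//; lra.
have /cvgrPdist_le/(_ _ e20) := cP x; apply: filterS => y Pxy.
have -> : chi l x * Num.max (f x) 0 - chi l y * Num.max (f y) 0 =
   - (P x - chi l x * Num.max (f x) 0) + (P x - P y) +
   (P y - chi l y * Num.max (f y) 0) by ring.
rewrite (le_trans (ler_normD _ _))// [leRHS](_ : e = e / 4 + e / 2 + e / 4); last by field.
rewrite lerD// (le_trans (ler_normD _ _))// lerD// normrN; exact: PE.
Qed.

(** The limit of [weak_chain_pos_approx] along [d = 1 / (k + 1)]. The approximations are dominated
    by [|f|], being 1-Lipschitz and zero at [0], and their slopes by [1]. *)
Lemma weak_partial_pos_part i f g l : continuous f -> continuous l ->
  (forall x, l x = 0 -> f x <= 0) -> weak_partial i f g ->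
  weak_partial i (fun x => chi l x * Num.max (f x) 0)
                 (fun x => chi l x * chi f x * g x).
Proof.
move=> cf cl fl wfg; have /weak_partialP[lf lg _] := wfg.
have mcl := measurable_chi cl; have mcf := measurable_chi cf.
have cE := continuous_pos_part cf cl fl.
have chichi x : `|chi l x * chi f x| <= 1.
  by rewrite normrM mulr_ile1// normr_chi.
apply/weak_partialP; split.
- exact: continuous_locally_integrable.
- apply: locally_integrable_bounded => //; exact: measurable_funM.
move=> phi tphi.
have [C [M [M0 bphi]]] := test_function_bcs tphi.
have [D [N [N0 bdphi]]] := test_function_bcs (test_function_partial i tphi).
have C0 := bounded_csupp_sup_ge0 bphi.
have D0 := bounded_csupp_sup_ge0 bdphi.
have [F F0 HF] := bounded_cube N cf.
pose dd (k : nat) : R := k.+1%:R^-1.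
have dd0 k : 0 < dd k by rewrite invr_gt0.
have c1 : locally_integrable_rV (cst 1 : 'rV[R]_n -> R).
  by apply: continuous_locally_integrable; exact: cst_continuous.
have boundN (h : 'rV[R]_n -> R) : measurable_fun setT h ->
    (forall x, `|h x| <= `|f x|) -> bounded_csupp (F * D) N (fun x => h x * partial i phi x).
  move=> mh hf; have [mdphi dphiD dphiN] := bdphi; split.
  - exact: measurable_funM.
  - move=> x; have [->|/dphiN xN] := eqVneq (partial i phi x) 0.
      by rewrite mulr0 normr0 mulr_ge0.
    by rewrite normrM ler_pM// (le_trans (hf x))// HF.
  - by move=> x; rewrite mulf_eq0 negb_or => /andP[_ /dphiN].
have cPd k : continuous (fun x => chi l x * pos_approx (dd k) (f x)).
  apply: (continuous_chi cf cl (dd0 k) fl); first exact: pos_approx_continuous.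
  by move=> t td; rewrite (pos_approx_small (dd0 k) td).1.
have cPd' k : continuous (fun x => chi l x * pos_approx' (dd k) (f x)).
  apply: (continuous_chi cf cl (dd0 k) fl); first exact: pos_approx'_continuous.
  by move=> t td; rewrite (pos_approx_small (dd0 k) td).2.
(* The factor [cst 1] gives the integral the shape of [Rintegral_bcs_cvg]. *)
pose A k := \int[mu]_x
  (cst 1 x * (chi l x * pos_approx (dd k) (f x) * partial i phi x)).
pose B k := \int[mu]_x (g x * (chi l x * pos_approx' (dd k) (f x) * phi x)).
have cvgA : A k @[k --> \oo] -->
    \int[mu]_x (cst 1 x * (chi l x * Num.max (f x) 0 * partial i phi x)).
  apply: (Rintegral_bcs_cvg (C := F * D) (M := N) c1).
  - move=> k; apply: boundN; first exact: continuous_measurable_rV.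
    move=> x; rewrite normrM (le_trans (ler_piMl _ (normr_chi l x)))//.
    have := pos_approx_lip (f x) 0 (dd0 k).
    by rewrite (pos_approx_small (dd0 k) (ltW (dd0 k))).1 !subr0.
  - apply: boundN; first exact: continuous_measurable_rV.
    move=> x; rewrite normrM (le_trans (ler_piMl _ (normr_chi l x)))//.
    by case: (lerP (f x) 0) => fx; rewrite ?normr0.
  - move=> x; apply: cvgM; last exact: cvg_cst.
    by apply: cvgM; [exact: cvg_cst|exact: pos_approx_cvg_seq].
have cvgB : B k @[k --> \oo] --> \int[mu]_x (g x * (chi l x * chi f x * phi x)).
  apply: (Rintegral_bcs_cvg (C := 1 * C) (M := M) lg).
  - move=> k; apply: bounded_csuppM => //; first exact: continuous_measurable_rV.
    move=> x; rewrite normrM (le_trans (ler_piMl _ (normr_chi l x)))//.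
    by have /andP[h0 h1] := pos_approx'_itv (f x) (dd0 k); rewrite ger0_norm.
  - by apply: bounded_csuppM => //; exact: measurable_funM.
  - move=> x; apply: cvgM; last exact: cvg_cst.
    by apply: cvgM; [exact: cvg_cst|exact: pos_approx'_cvg_seq].
have one (h : 'rV[R]_n -> R) : \int[mu]_x (cst 1 x * h x) = \int[mu]_x h x.
  by apply: eq_Rintegral => x _; rewrite mul1r.
have AB : A = (fun k => - B k).
  apply/funext => k; rewrite /A one.
  exact: weak_chain_pos_approx.
rewrite one AB in cvgA.
have -> : \int[mu]_x (chi l x * chi f x * g x * phi x) =
    \int[mu]_x (g x * (chi l x * chi f x * phi x)).
  by apply: eq_Rintegral => x _; ring.
have H1 := cvg_lim (@Rhausdorff R) cvgA.
by have H2 := cvg_lim (@Rhausdorff R) (cvgN cvgB); rewrite -H1 -H2.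
Qed.

End weak_positive_part_limit.

(** * Operations on D^{1,p} *)

Section D1p_closure.
Context {R : realType} {n : nat}.
Implicit Types (x y v w nu : 'rV[R]_n) (f g h l u phi : 'rV[R]_n -> R).
Implicit Types (Du Dv : 'rV[R]_n -> 'rV[R]_n) (p c : R).

Local Notation mu := (lebesgue_rV n : {measure set 'rV[R]_n -> \bar R}).

Lemma LfunE p f : 0 < p -> (f \in Lfun mu p%:E) <->
  (measurable_fun setT f /\ (\int[mu]_x (`|f x| `^ p)%:E < +oo)%E).
Proof.
move=> p0.
have powK (z : \bar R) : (0 <= z)%E -> (z `^ p^-1 < +oo)%E <-> (z < +oo)%E.
  move=> z0; split; last exact: poweR_lty.
  by apply: lty_poweRy; rewrite invr_eq0 gt_eqF.
have int0 : (0 <= \int[mu]_x (`|f x| `^ p)%:E)%E.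
  by apply: integral_ge0 => x _; rewrite lee_fin powR_ge0.
split=> [/andP[/[!inE]/= mf]|[mf fi]].
  rewrite /finite_norm unlock /Lnorm => H; split=> //.
  by apply/powK => //; apply: le_lt_trans H.
apply/andP; split; rewrite inE//=.
by rewrite /finite_norm unlock /Lnorm; apply/powK.
Qed.

Lemma Lfun_lin p (a b : R) f g : 1 <= p ->
  f \in Lfun mu p%:E -> g \in Lfun mu p%:E ->
  (fun x => a * f x + b * g x) \in Lfun mu p%:E.
Proof.
move=> p1 fL gL; have p1' : (1 <= p%:E)%E by rewrite lee_fin.
have [H0 H] := Lfun_submod_closed mu p1'.
have := H b _ _ gL H0; rewrite addr0 => bg.
by have := H a _ _ fL bg.
Qed.

Lemma weak_partial_lin i (a b : R) f g f' g' :
  weak_partial i f f' -> weak_partial i g g' ->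
  weak_partial i (fun x => a * f x + b * g x) (fun x => a * f' x + b * g' x).
Proof.
have loc_lin (f1 g1 : 'rV[R]_n -> R) : locally_integrable_rV f1 ->
    locally_integrable_rV g1 -> locally_integrable_rV (fun x => a * f1 x + b * g1 x).
  move=> /locally_integrable_rVP[mf fi] /locally_integrable_rVP[mg gi].
  apply/locally_integrable_rVP; split.
    by apply: measurable_funD; exact: measurable_funM.
  move=> M; have mC := @measurable_cube R n M.
  have := integrableD mC (integrableZl mC a (fi M)) (integrableZl mC b (gi M)).
  by congr (_.-integrable _ _); apply/funext => x /=; rewrite EFinD !EFinM.
have int_lin (f1 g1 psi : 'rV[R]_n -> R) C M : locally_integrable_rV f1 ->
    locally_integrable_rV g1 -> bounded_csupp C M psi ->
    \int[mu]_x ((a * f1 x + b * g1 x) * psi x) =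
    a * \int[mu]_x (f1 x * psi x) + b * \int[mu]_x (g1 x * psi x).
  move=> lf lg bpsi.
  have i1 := locally_integrableM lf bpsi.
  have i2 := locally_integrableM lg bpsi.
  rewrite -!RintegralZl// -RintegralD//.
  - by apply: eq_Rintegral => x _; ring.
  - have := integrableZl measurableT a i1.
    by congr (_.-integrable _ _); apply/funext => x /=; rewrite EFinM.
  - have := integrableZl measurableT b i2.
    by congr (_.-integrable _ _); apply/funext => x /=; rewrite EFinM.
move=> /weak_partialP[lf lf' Hf] /weak_partialP[lg lg' Hg].
apply/weak_partialP; split; [exact: loc_lin|exact: loc_lin|].
move=> phi tphi.
have [C [M [_ bphi]]] := test_function_bcs tphi.
have [D [N [_ bdphi]]] := test_function_bcs (test_function_partial i tphi).
rewrite (int_lin _ _ _ _ _ lf lg bdphi) (int_lin _ _ _ _ _ lf' lg' bphi).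
by rewrite Hf// Hg//; ring.
Qed.

Lemma D1p_lin p (a b : R) f g Df Dg : 1 <= p -> D1p p f Df -> D1p p g Dg ->
  D1p p (fun x => a * f x + b * g x) (fun x => a *: Df x + b *: Dg x).
Proof.
move=> p1 [cf Hf] [cg Hg]; split.
  have cst_c (k : R) x : {for x, continuous (cst k : 'rV[R]_n -> R)}.
    exact: cst_continuous.
  move=> x; exact: (continuousD (continuousM (cst_c a x) (cf x))
    (continuousM (cst_c b x) (cg x))).
move=> i; have [wf Lf] := Hf i; have [wg Lg] := Hg i.
have E : (fun x => (a *: Df x + b *: Dg x) ord0 i) =
    (fun x => a * Df x ord0 i + b * Dg x ord0 i).
  by apply/funext => x; rewrite !mxE.
by rewrite E; split; [exact: weak_partial_lin|exact: Lfun_lin].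
Qed.

Lemma D1p_pos_part p f Df l : 1 <= p -> continuous l ->
  (forall x, l x = 0 -> f x <= 0) -> D1p p f Df ->
  D1p p (fun x => chi l x * Num.max (f x) 0)
        (fun x => (chi l x * chi f x) *: Df x).
Proof.
move=> p1 cl fl [cf Hf]; split; first exact: continuous_pos_part.
move=> i; have [wf Lf] := Hf i.
have E : (fun x => ((chi l x * chi f x) *: Df x) ord0 i) =
    (fun x => chi l x * chi f x * Df x ord0 i).
  by apply/funext => x; rewrite !mxE.
rewrite E; split; first exact: weak_partial_pos_part.
have p0 : 0 < p := lt_le_trans ltr01 p1.
have /(LfunE _ p0)[mf fi] := Lf.
have mcl := measurable_chi cl; have mcf := measurable_chi cf.
have mpow (h : 'rV[R]_n -> R) : measurable_fun setT h ->
    measurable_fun setT (fun x => (`|h x| `^ p)%:E).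
  move=> mh; apply/measurable_EFinP.
  by apply: (measurableT_comp (@measurable_powR R p)); exact: measurableT_comp.
have mh : measurable_fun setT (fun x => chi l x * chi f x * Df x ord0 i).
  by apply: measurable_funM => //; exact: measurable_funM.
apply/(LfunE _ p0); split; first exact: mh.
apply: le_lt_trans fi.
apply: ge0_le_integral => //.
- exact: mpow.
- exact: mpow.
- move=> x _; rewrite lee_fin; apply: ge0_ler_powR => //.
  + exact: ltW.
  + by rewrite normrM ler_piMl// normrM mulr_ile1// normr_chi.
Qed.

(** The Householder matrix, linear part of [hrefl nu c]. Being symmetric, it also transforms
    gradients, as row vectors, by right multiplication. *)
Definition reflmx nu : 'M[R]_n := 1%:M - 2 *: (nu^T *m nu).

Lemma reflmxE nu i j : reflmx nu i j = (i == j)%:R - 2 * (nu ord0 i * nu ord0 j).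
Proof. by rewrite !mxE big_ord1 !mxE. Qed.

Lemma reflmx_sym nu i j : reflmx nu i j = reflmx nu j i.
Proof. by rewrite !reflmxE eq_sym [nu _ i * _]mulrC. Qed.

Lemma hreflE nu c x : hrefl nu c x = x *m reflmx nu + (2 * c) *: nu.
Proof.
apply/rowP => i.
have -> : (x *m reflmx nu + (2 * c) *: nu) ord0 i =
    \sum_j x ord0 j * reflmx nu j i + 2 * c * nu ord0 i.
  by rewrite [LHS]mxE; apply: f_equal2; rewrite mxE.
have -> : hrefl nu c x ord0 i =
    x ord0 i - 2 * (\sum_j nu ord0 j * x ord0 j - c) * nu ord0 i.
  by rewrite !mxE.
under [X in _ = X + _]eq_bigr do rewrite reflmxE mulrBr.
rewrite sumrB.
have -> : \sum_j x ord0 j * (j == i)%:R = x ord0 i.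
  rewrite (bigD1 i)//= eqxx mulr1 big1 ?addr0// => j ji.
  by rewrite (negbTE ji) mulr0.
have -> : \sum_j x ord0 j * (2 * (nu ord0 j * nu ord0 i)) =
    2 * (\sum_j nu ord0 j * x ord0 j) * nu ord0 i.
  by rewrite mulr_sumr mulr_suml; apply: eq_bigr => j _; ring.
by ring.
Qed.

Lemma enorm_sqr x : enorm x ^+ 2 = \sum_i x ord0 i ^+ 2.
Proof. by rewrite sqr_sqrtr// sumr_ge0// => i _; exact: sqr_ge0. Qed.

Lemma dot_hrefl nu c x : \sum_i nu ord0 i ^+ 2 = 1 ->
  \sum_i nu ord0 i * hrefl nu c x ord0 i - c = - (\sum_i nu ord0 i * x ord0 i - c).
Proof.
move=> nu1; rewrite /hrefl; set s := \sum_i nu ord0 i * x ord0 i.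
have -> : \sum_i nu ord0 i * (x - (2 * (s - c)) *: nu) ord0 i = s - 2 * (s - c).
  rewrite [RHS](_ : _ = s - 2 * (s - c) * \sum_i nu ord0 i ^+ 2); last first.
    by rewrite nu1 mulr1.
  rewrite mulr_sumr {2}/s -sumrB.
  by apply: eq_bigr => i _; rewrite !mxE; ring.
by ring.
Qed.

Lemma hreflK nu c : \sum_i nu ord0 i ^+ 2 = 1 -> involutive (hrefl nu c).
Proof.
move=> nu1 x; rewrite {1}/hrefl dot_hrefl// /hrefl mulrN scaleNr opprK.
by rewrite subrK.
Qed.

Lemma reflmxK nu : \sum_i nu ord0 i ^+ 2 = 1 -> reflmx nu *m reflmx nu = 1%:M.
Proof.
move=> nu1; apply/row_matrixP => i; rewrite !rowE mulmxA.
have E x : x *m reflmx nu = hrefl nu 0 x by rewrite hreflE mulr0 scale0r addr0.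
by rewrite !E hreflK// mulmx1.
Qed.

Lemma enorm_reflmx nu x : \sum_i nu ord0 i ^+ 2 = 1 ->
  enorm (x *m reflmx nu) = enorm x.
Proof.
move=> nu1; rewrite /enorm; congr Num.sqrt.
have -> : x *m reflmx nu = hrefl nu 0 x by rewrite hreflE mulr0 scale0r addr0.
rewrite /hrefl subr0; set s := \sum_i nu ord0 i * x ord0 i.
transitivity (\sum_i (x ord0 i ^+ 2 - 4 * s * (nu ord0 i * x ord0 i) +
    4 * s ^+ 2 * nu ord0 i ^+ 2)).
  by apply: eq_bigr => i _; rewrite !mxE; ring.
by rewrite big_split/= sumrB -!mulr_sumr nu1 -/s; ring.
Qed.

Lemma locally_integrable_hrefl nu c f : \sum_i nu ord0 i ^+ 2 = 1 ->
  locally_integrable_rV f -> locally_integrable_rV (f \o hrefl nu c).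
Proof.
move=> nu1 /locally_integrable_rVP[mf fi].
have pS := measure_preserving_hrefl c nu1; have [mS _] := pS.
apply/locally_integrable_rVP; split; first exact: measurableT_comp mf mS.
move=> M; have [B B0 HB] := mulmx_bounded (reflmx nu).
set K := B * M + `|(2 * c) *: nu|.
have fK : mu.-integrable setT (EFin \o (fun x => f x * \1_(cube K) x)).
  apply: (locally_integrableM _ (@indic_bcs R n K)).
  by apply/locally_integrable_rVP; split.
have := integrable_preserving pS fK.
move=> /(integrableS measurableT (measurable_cube M) (@subsetT _ _)).
apply: eq_integrable; first exact: measurable_cube.
move=> x /[!inE] xM; rewrite /= indicE mem_set ?mulr1// hreflE /cube/=.
rewrite (le_trans (ler_normD _ _))// lerD2r (le_trans (HB x))//.
by rewrite ler_wpM2l.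
Qed.

Lemma Rintegral_sumr (I : Type) (s : seq I) (h : I -> 'rV[R]_n -> R) :
  (forall j, mu.-integrable setT (EFin \o h j)) ->
  \int[mu]_x (\sum_(j <- s) h j x) = \sum_(j <- s) \int[mu]_x h j x.
Proof.
move=> ih.
suff [H1 H2] : mu.-integrable setT (EFin \o (fun x => \sum_(j <- s) h j x)) /\
  \int[mu]_x (\sum_(j <- s) h j x) = \sum_(j <- s) \int[mu]_x h j x by [].
elim: s => [|j s [IH1 IH2]].
  have E : (fun x : 'rV[R]_n => \sum_(j <- [::]) h j x) = (fun x => 0 * 0).
    by apply/funext => x; rewrite big_nil mulr0.
  rewrite big_nil E; split; last first.
    by rewrite /Rintegral integral0_eq// => x _; rewrite mulr0.
  have := @integrable0 _ _ _ mu setT.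
  by congr (_.-integrable _ _); apply/funext => x /=; rewrite mulr0.
have E : (fun x => \sum_(j <- j :: s) h j x) =
    (fun x => h j x + \sum_(j <- s) h j x).
  by apply/funext => x; rewrite big_cons.
rewrite E big_cons; split; last by rewrite RintegralD// IH2.
have := integrableD measurableT (ih j) IH1.
by congr (_.-integrable _ _); apply/funext => x /=; rewrite EFinD.
Qed.

End D1p_closure.

(** * Reflection of functions in D^{1,p} *)

Section D1p_reflection.
Context {R : realType} {n : nat}.
Implicit Types (x y v w nu : 'rV[R]_n) (f g h u phi : 'rV[R]_n -> R).

Local Notation mu := (lebesgue_rV n : {measure set 'rV[R]_n -> \bar R}).

Lemma continuous_hrefl nu (c : R) : continuous (hrefl nu c).
Proof.
have -> : hrefl nu c = fun x => x *m reflmx nu + (2 * c) *: nu.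
  by apply/funext => x; exact: hreflE.
exact: continuous_affine.
Qed.

Lemma Lfun_preserving (p : R) (T : 'rV[R]_n -> 'rV[R]_n) f : 0 < p ->
  measure_preserving T -> f \in Lfun mu p%:E -> (f \o T) \in Lfun mu p%:E.
Proof.
move=> p0 pT /(LfunE _ p0)[mf fi]; apply/(LfunE _ p0); split.
  exact: measurableT_comp mf pT.1.
have := @ge0_integral_preserving R n T (fun x => (`|f x| `^ p)%:E) setT pT measurableT.
rewrite preimage_setT => -> //.
- apply/measurable_EFinP.
  by apply: (measurableT_comp (@measurable_powR R p)); exact: measurableT_comp.
Qed.

Lemma Lfun_sumr (p : R) (I : Type) (s : seq I) (a : I -> R) (h : I -> 'rV[R]_n -> R) :
  1 <= p -> (forall j, h j \in Lfun mu p%:E) ->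
  (fun x => \sum_(j <- s) a j * h j x) \in Lfun mu p%:E.
Proof.
move=> p1 hL; elim: s => [|j s IH].
  have -> : (fun x => \sum_(j <- [::]) a j * h j x) = 0.
    by apply/funext => x; rewrite big_nil.
  have p1' : (1 <= p%:E)%E by rewrite lee_fin.
  by have [] := Lfun_submod_closed mu p1'.
have -> : (fun x => \sum_(j <- j :: s) a j * h j x) =
    (fun x => a j * h j x + 1 * \sum_(j <- s) a j * h j x).
  by apply/funext => x; rewrite big_cons mul1r.
exact: Lfun_lin.
Qed.

Lemma locally_integrable_sumr (I : Type) (s : seq I) (a : I -> R)
    (h : I -> 'rV[R]_n -> R) : (forall j, locally_integrable_rV (h j)) ->
  locally_integrable_rV (fun x => \sum_(j <- s) a j * h j x).
Proof.
move=> hL; apply/locally_integrable_rVP; split.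
  apply: measurable_sum => j; apply: measurable_funM => //.
  by have /locally_integrable_rVP[] := hL j.
move=> M; elim: s => [|j s IH].
  have := @integrable0 _ _ _ mu (cube M).
  by congr (_.-integrable _ _); apply/funext => x /=; rewrite big_nil.
have /locally_integrable_rVP[_ hM] := hL j.
have mC := @measurable_cube R n M.
have := integrableD mC (integrableZl mC (a j) (hM M)) IH.
by congr (_.-integrable _ _); apply/funext => x /=; rewrite big_cons EFinD EFinM.
Qed.

(** Substituting the involution [S] moves the reflection from [u] to the test function; the chain
    rule for [psi := phi o S] then produces the matrix entries. *)
Lemma weak_partial_hrefl i nu (c : R) u (Du : 'rV[R]_n -> 'rV[R]_n) :
  \sum_i nu ord0 i ^+ 2 = 1 ->
  (forall j, weak_partial j u (fun x => Du x ord0 j)) ->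
  weak_partial i (u \o hrefl nu c)
    (fun x => \sum_j reflmx nu i j * Du (hrefl nu c x) ord0 j).
Proof.
move=> nu1 wu; set S := hrefl nu c; set A := reflmx nu.
have pS : measure_preserving S := measure_preserving_hrefl c nu1.
have SK : involutive S := hreflK c nu1.
have AA : A *m A = 1%:M := reflmxK nu1.
have SE x : S x = x *m A + (2 * c) *: nu := hreflE nu c x.
have lu : locally_integrable_rV u by have [] := wu i.
have lDu j : locally_integrable_rV (fun x => Du x ord0 j) by have [] := wu j.
have tS phi : test_function phi -> test_function (phi \o S).
  move=> /(test_function_affine ((2 * c) *: nu) AA).
  by congr test_function; apply/funext => x /=; rewrite SE.
apply/weak_partialP; split.
- exact: locally_integrable_hrefl.
- apply: locally_integrable_sumr => j.
  exact: (locally_integrable_hrefl c nu1 (lDu j)).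
move=> phi tphi; set psi := phi \o S.
have tpsi : test_function psi := tS _ tphi.
(* [phi] is [psi o S] because [S] is an involution; the chain rule at [S y] expresses its partial by
   those of [psi] at [y]. *)
have dphiS y : partial i phi (S y) = \sum_j A i j * partial j psi y.
  have := partial_affine A ((2 * c) *: nu) i (S y) tpsi.1.
  have -> : (fun y => psi (y *m A + (2 * c) *: nu)) = phi.
    by apply/funext => z; rewrite -SE /psi /= SK.
  by rewrite -SE SK => -[_ <-].
have bpsi j := test_function_bcs (test_function_partial j tpsi).
have [C [M [_ bphi]]] := test_function_bcs tpsi.
have iu j : mu.-integrable setT (EFin \o (fun x => u x * partial j psi x)).
  by have [D [N [_ bd]]] := bpsi j; exact: locally_integrableM lu bd.
have iDu j : mu.-integrable setT (EFin \o (fun x => Du x ord0 j * psi x)).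
  exact: locally_integrableM (lDu j) bphi.
have iZ (a : R) (h : 'rV[R]_n -> R) : mu.-integrable setT (EFin \o h) ->
    mu.-integrable setT (EFin \o (fun x => a * h x)).
  move=> /(integrableZl measurableT a).
  by congr (_.-integrable _ _); apply/funext => x /=; rewrite EFinM.
have lhs : \int[mu]_x (u (S x) * partial i phi x) =
    \sum_j A i j * \int[mu]_x (u x * partial j psi x).
  have bdphi := test_function_bcs (test_function_partial i tphi).
  have iL : mu.-integrable setT (EFin \o (fun x => (u \o S) x * partial i phi x)).
    have [D [N [_ bd]]] := bdphi.
    exact: (locally_integrableM (locally_integrable_hrefl c nu1 lu) bd).
  rewrite -(Rintegral_preserving pS iL).
  transitivity (\int[mu]_x (\sum_j A i j * (u x * partial j psi x))).
    apply: eq_Rintegral => x _; rewrite /= SK dphiS mulr_sumr.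
    by apply: eq_bigr => j _; ring.
  rewrite Rintegral_sumr; last by move=> j; exact: iZ.
  by apply: eq_bigr => j _; rewrite RintegralZl.
have rhs : \int[mu]_x ((\sum_j A i j * Du (S x) ord0 j) * phi x) =
    \sum_j A i j * \int[mu]_x (Du x ord0 j * psi x).
  have iR : mu.-integrable setT
      (EFin \o (fun x => (\sum_j A i j * Du (S x) ord0 j) * phi x)).
    have [D [N [_ bd]]] := test_function_bcs tphi.
    apply: (locally_integrableM _ bd).
    apply: locally_integrable_sumr => j.
    exact: (locally_integrable_hrefl c nu1 (lDu j)).
  rewrite -(Rintegral_preserving pS iR).
  transitivity (\int[mu]_x (\sum_j A i j * (Du x ord0 j * psi x))).
    apply: eq_Rintegral => x _; rewrite /= SK mulr_suml.
    by apply: eq_bigr => j _; rewrite mulrA.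
  rewrite Rintegral_sumr; last by move=> j; exact: iZ.
  by apply: eq_bigr => j _; rewrite RintegralZl.
transitivity (\sum_j A i j * \int[mu]_x (u x * partial j psi x)); first exact: lhs.
transitivity (- \sum_j A i j * \int[mu]_x (Du x ord0 j * psi x)); last first.
  by rewrite -rhs.
rewrite -sumrN; apply: eq_bigr => j _.
by have /weak_partialP[_ _ ->//] := wu j; rewrite mulrN.
Qed.

Lemma D1p_hrefl (p : R) nu (c : R) u (Du : 'rV[R]_n -> 'rV[R]_n) :
  1 <= p -> \sum_i nu ord0 i ^+ 2 = 1 -> D1p p u Du ->
  D1p p (u \o hrefl nu c) (fun x => Du (hrefl nu c x) *m reflmx nu).
Proof.
move=> p1 nu1 [cu Hu]; have p0 : 0 < p := lt_le_trans ltr01 p1.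
have pS := measure_preserving_hrefl c nu1.
split; first by move=> x; apply: continuous_comp; [exact: continuous_hrefl|exact: cu].
move=> i.
have -> : (fun x => (Du (hrefl nu c x) *m reflmx nu) ord0 i) =
    (fun x => \sum_j reflmx nu i j * Du (hrefl nu c x) ord0 j).
  apply/funext => x; rewrite [LHS]mxE; apply: eq_bigr => j _.
  by rewrite reflmx_sym mulrC.
split; first by apply: weak_partial_hrefl => // j; have [] := Hu j.
apply: (Lfun_sumr _ _ (h := fun j x => Du (hrefl nu c x) ord0 j)) => // j.
by apply: (Lfun_preserving p0 pS (f := fun x => Du x ord0 j)); have [] := Hu j.
Qed.

End D1p_reflection.

(** * Energy and uniqueness *)

(** The [p]-th power of [gradient_norm]. Without the root it is additive in the integrand, on which
    Clarkson's inequality and the exchange of regions both rely. *)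
HB.lock Definition energy {R : realType} {n : nat} (p : R)
    (D : 'rV[R]_n -> 'rV[R]_n) : \bar R :=
  (\int[lebesgue_rV n : {measure set 'rV[R]_n -> \bar R}]_x (enorm (D x) `^ p)%:E)%E.
Canonical energy_unlockable := Unlockable energy.unlock.

Section energy.
Context {R : realType} {n : nat}.
Implicit Types (x y a b w nu : 'rV[R]_n) (u v l : 'rV[R]_n -> R).
Implicit Types (D Du Dv : 'rV[R]_n -> 'rV[R]_n) (p r : R).

Local Notation mu := (lebesgue_rV n : {measure set 'rV[R]_n -> \bar R}).

Lemma powR_half_convex r (s t : R) : 1 <= r -> 0 <= s -> 0 <= t ->
  (2^-1 * s + 2^-1 * t) `^ r <= 2^-1 * s `^ r + 2^-1 * t `^ r.
Proof.
move=> r1 s0 t0.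
rewrite {2 4}(_ : 2^-1 = 1 - 2^-1); last by rewrite {2}(splitr 1) div1r addrK.
by apply: (convex_powR r1 (Itv01 _ _)) => //=;
  rewrite ?inE/= ?in_itv/= ?s0 ?t0// ?invr_ge0// invf_le1 ?ler1n.
Qed.

(** If [0 <= q <= 1] then [q ^ r <= q]; this is applied to the shares [s / (s + t)] and
    [t / (s + t)], which add up to [1]. *)
Lemma powR_superadd r (s t : R) : 1 <= r -> 0 <= s -> 0 <= t ->
  s `^ r + t `^ r <= (s + t) `^ r.
Proof.
move=> r1 s0 t0; have r0 : 0 < r := lt_le_trans ltr01 r1.
have [st0|st0] := eqVneq (s + t) 0.
  have -> : s = 0 by lra.
  have -> : t = 0 by lra.
  by rewrite addr0 powR0 ?gt_eqF// addr0.
have stp : 0 < s + t by rewrite lt_neqAle eq_sym st0 addr_ge0.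
have key z : 0 <= z -> z <= s + t -> z `^ r <= z / (s + t) * (s + t) `^ r.
  move=> z0 zst.
  have q0 : 0 <= z / (s + t) by rewrite divr_ge0// ltW.
  have q1 : z / (s + t) <= 1 by rewrite ler_pdivrMr// mul1r.
  rewrite -{1}(divfK st0 z) powRM//; last exact: ltW.
  rewrite ler_wpM2r ?powR_ge0//.
  have [->|qn0] := eqVneq (z / (s + t)) 0; first by rewrite powR0 ?gt_eqF.
  by apply: ge1r_powR => //; rewrite lt_neqAle eq_sym qn0 q0.
apply: (@le_trans _ _ (s / (s + t) * (s + t) `^ r + t / (s + t) * (s + t) `^ r)).
  by rewrite lerD// key// ?lerDl ?lerDr.
by rewrite -mulrDl -mulrDl divff// mul1r.
Qed.

Lemma enorm_powR p x : enorm x `^ p = (\sum_i x ord0 i ^+ 2) `^ (p / 2).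
Proof.
by rewrite mulrC powRrM powR12_sqrt// sumr_ge0// => i _; exact: sqr_ge0.
Qed.

(** The parallelogram law for squared norms, placed between superadditivity and convexity of
    [t ^ (p / 2)], for which [p / 2 >= 1]. *)
Lemma enorm_clarkson p a b : 2 <= p ->
  enorm (2^-1 *: a + 2^-1 *: b) `^ p + enorm (2^-1 *: a + (- 2^-1) *: b) `^ p <=
  2^-1 * enorm a `^ p + 2^-1 * enorm b `^ p.
Proof.
move=> p2; have r1 : 1 <= p / 2 by rewrite ler_pdivlMr// mul1r.
have sq0 x : 0 <= \sum_i x ord0 i ^+ 2 :> R by rewrite sumr_ge0// => i _; exact: sqr_ge0.
rewrite !enorm_powR; apply: (le_trans (powR_superadd r1 (sq0 _) (sq0 _))).
apply: le_trans (powR_half_convex r1 (sq0 _) (sq0 _)).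
rewrite le_eqVlt; apply/orP; left; apply/eqP; congr (_ `^ _).
rewrite !mulr_sumr -!big_split/=; apply: eq_bigr => i _.
by rewrite !mxE; field.
Qed.

Lemma enorm_gt0 x : x != 0 -> 0 < enorm x.
Proof.
move=> x0; rewrite sqrtr_gt0 lt_neqAle sumr_ge0 ?andbT; last by move=> i _; exact: sqr_ge0.
apply: contra_neq x0 => /esym /eqP; rewrite psumr_eq0; last by move=> i _; exact: sqr_ge0.
move=> /allP H; apply/rowP => i; rewrite mxE.
by have /(_ (mem_index_enum i)) := H i; rewrite sqrf_eq0 => /eqP.
Qed.

Lemma enormN x : enorm (- x) = enorm x.
Proof. by rewrite /enorm; congr Num.sqrt; apply: eq_bigr => i _; rewrite mxE sqrrN. Qed.

Lemma energy_ge0 p D : (0 <= energy p D)%E.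
Proof. by rewrite unlock; apply: integral_ge0 => x _; rewrite lee_fin powR_ge0. Qed.

Lemma gradient_normE p D : gradient_norm p D = (energy p D `^ p^-1)%E.
Proof. by rewrite unlock. Qed.

Lemma energyE p D : p != 0 -> energy p D = (gradient_norm p D `^ p)%E.
Proof. by move=> p0; rewrite gradient_normE -poweRrM mulVf// poweRe1// energy_ge0. Qed.

Lemma measurable_energy p u Du : D1p p u Du ->
  measurable_fun setT (fun x => enorm (Du x) `^ p).
Proof.
move=> [_ H]; under eq_fun do rewrite enorm_powR.
apply: (measurableT_comp (@measurable_powR R (p / 2))).
apply: measurable_sum => i; apply: measurable_funX.
by have [[_ [mD _] _] _] := H i.
Qed.

Lemma le_gradient_norm p D D' : 0 < p ->
  (gradient_norm p D <= gradient_norm p D')%E -> (energy p D <= energy p D')%E.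
Proof.
move=> p0 H; have pn0 := lt0r_neq0 p0.
rewrite (energyE D pn0) (energyE D' pn0); apply: gt0_ler_poweR => //.
- exact: ltW.
- by rewrite in_itv/= leey andbT poweR_ge0.
- by rewrite in_itv/= leey andbT poweR_ge0.
Qed.

Lemma holder_quotient_le_seminorm p u x y : x != y ->
  ((holder_quotient p u x y)%:E <= holder_seminorm p u)%E.
Proof. by move=> xy; apply: ereal_sup_ubound; exists (x, y). Qed.

Lemma energy_clarkson p u Du v Dv : 2 <= p -> D1p p u Du -> D1p p v Dv ->
  (energy p (fun x => 2^-1 *: Du x + 2^-1 *: Dv x)%R +
   energy p (fun x => 2^-1 *: Du x + (- 2^-1) *: Dv x)%R <=
   (2^-1)%:E * energy p Du + (2^-1)%:E * energy p Dv)%E.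
Proof.
move=> p2 Hu Hv; have p1 : 1 <= p by lra.
have mE (f : 'rV[R]_n -> R) D : D1p p f D ->
    measurable_fun setT (fun x => (enorm (D x) `^ p)%:E).
  by move=> H; apply/measurable_EFinP; exact: (measurable_energy H).
have mw := mE _ _ (D1p_lin (2^-1) (2^-1) p1 Hu Hv).
have mz := mE _ _ (D1p_lin (2^-1) (- 2^-1) p1 Hu Hv).
have pos (D : 'rV[R]_n -> 'rV[R]_n) x : (0 <= (enorm (D x) `^ p)%:E)%E.
  by rewrite lee_fin powR_ge0.
have half0 : (0 <= (2^-1 : R)%:E)%E by rewrite lee_fin.
have Zl (f : 'rV[R]_n -> R) D : D1p p f D ->
    ((2^-1)%:E * energy p D = \int[mu]_x ((2^-1)%:E * (enorm (D x) `^ p)%:E))%E.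
  by move=> H; rewrite unlock (ge0_integralZl mu measurableT (mE _ _ H) (fun x _ => pos D x) half0).
rewrite (Zl _ _ Hu) (Zl _ _ Hv).
have pos2 D x : (0 <= (2^-1)%:E * (enorm (D x) `^ p)%:E)%E by exact: mule_ge0.
have m2 (f : 'rV[R]_n -> R) D : D1p p f D ->
    measurable_fun setT (fun x => (2^-1)%:E * (enorm (D x) `^ p)%:E)%E.
  by move=> H; apply: measurable_funeM; exact: mE H.
set Dw := (fun x => 2^-1 *: Du x + 2^-1 *: Dv x) in mw *.
set Dz := (fun x => 2^-1 *: Du x + (- 2^-1) *: Dv x) in mz *.
have E1 := ge0_integralD mu measurableT (fun x _ => pos2 Du x) (m2 _ _ Hu)
  (fun x _ => pos2 Dv x) (m2 _ _ Hv).
have E2 : (energy p Dw + energy p Dz =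
    \int[mu]_x ((enorm (Dw x) `^ p)%:E + (enorm (Dz x) `^ p)%:E))%E.
  rewrite energy.unlock; apply/esym.
  exact: (ge0_integralD mu measurableT (fun x _ => pos Dw x) mw (fun x _ => pos Dz x) mz).
rewrite -E1 E2.
apply: ge0_le_integral.
- by [].
- by move=> x _; apply: adde_ge0.
- exact: (emeasurable_funD mw mz).
- exact: (emeasurable_funD (m2 _ _ Hu) (m2 _ _ Hv)).
- move=> x _; rewrite -!EFinM -!EFinD lee_fin.
  exact: enorm_clarkson.
Qed.

(* Both [u] and [v] have least energy among functions with the same gap
   between [a] and [b], so by Clarkson's inequality their gradients agree, and
   Morrey's inequality applied to [u - v] makes it constant. *)
Lemma morrey_extremal_unique p (C : R) u Du v Dv a b : 2 <= p ->
  morrey_inequality (n := n) p C -> D1p p u Du -> D1p p v Dv ->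
  energy p Dv = energy p Du ->
  holder_seminorm p u = (C%:E * gradient_norm p Du)%E ->
  holder_seminorm p u = (holder_quotient p u a b)%:E ->
  a != b -> 0 < u a - u b -> u a - u b <= v a - v b ->
  forall x y, u x - v x = u y - v y.
Proof.
have half (a1 a2 a3 a4 : R) : 2^-1 * a1 + (- 2^-1) * a2 =
    2^-1 * a3 + (- 2^-1) * a4 -> a1 - a2 = a3 - a4 by lra.
move=> p2 morrey Hu Hv Evu supC supq ab uab vab.
have p0 : 0 < p by lra.
have p1 : 1 <= p by lra.
have dab : 0 < enorm (a - b) `^ (1 - n%:R / p).
  by apply/powR_gt0/enorm_gt0; rewrite subr_eq0.
have [q qE] : exists q, q = holder_quotient p u a b by eexists.
have [G GE] : exists G, G = gradient_norm p Du by eexists.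
rewrite -qE in supq; rewrite -GE in supC.
have q0 : 0 < q.
  rewrite qE /holder_quotient; apply: divr_gt0; last exact: dab.
  by rewrite normr_gt0; exact: lt0r_neq0 uab.
have G0 : (0 <= G)%E by rewrite GE; exact: poweR_ge0.
have CG : (C%:E * G = q%:E)%E by rewrite -supC supq.
(* The product of [C] and [G] is the positive real [q]: hence [C > 0] and [G] is finite, which later
   allows dividing by [C] and subtracting the energy. *)
have C0 : 0 < C.
  rewrite ltNge; apply/negP => C0.
  have : (C%:E * G <= 0)%E by apply: mule_le0_ge0.
  by rewrite CG lee_fin leNgt q0.
have Gfin : G \is a fin_num.
  rewrite (ge0_fin_numE G0) ltNge leye_eq; apply/negP => /eqP Ginf.
  by move: CG; rewrite Ginf gt0_muley.
have Efin : energy p Du \is a fin_num.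
  by rewrite (energyE Du (lt0r_neq0 p0)) -GE fin_num_poweR.
have Hw := D1p_lin (2^-1) (2^-1) p1 Hu Hv.
have Hz := D1p_lin (2^-1) (- 2^-1) p1 Hu Hv.
set w := (fun x => 2^-1 * u x + 2^-1 * v x) in Hw.
set Dw := (fun x => 2^-1 *: Du x + 2^-1 *: Dv x) in Hw.
set z := (fun x => 2^-1 * u x + (- 2^-1) * v x) in Hz.
set Dz := (fun x => 2^-1 *: Du x + (- 2^-1) *: Dv x) in Hz.
(* The gap of [w] is the mean of those of [u] and [v], hence at least that of [u]. *)
have qw : q <= holder_quotient p w a b.
  rewrite qE /holder_quotient; apply: ler_wpM2r; first by rewrite invr_ge0 ltW.
  rewrite (gtr0_norm uab); apply: le_trans (ler_norm _).
  by rewrite /w; lra.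
have GGw : (G <= gradient_norm p Dw)%E.
  have : (q%:E <= C%:E * gradient_norm p Dw)%E.
    apply: le_trans (morrey w Dw Hw).
    apply: le_trans (holder_quotient_le_seminorm p w ab).
    by rewrite lee_fin.
  by rewrite -CG lee_pmul2l.
have EEw : (energy p Du <= energy p Dw)%E.
  by apply: (le_gradient_norm p0); rewrite -GE; exact: GGw.
(* The energies of [u] and [v] agree, so the right-hand side of Clarkson's inequality is the energy
   of [u]; minimality then leaves nothing for [Dz]. *)
have clarkson : (energy p Dw + energy p Dz <= energy p Du)%E.
  have := energy_clarkson p2 Hu Hv; rewrite Evu -ge0_muleDl ?lee_fin ?invr_ge0//.
  by rewrite -EFinD (_ : 2^-1 + 2^-1 = 1) ?mul1e//; field.
have Ez0 : energy p Dz = 0%E.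
  apply/eqP; rewrite eq_le energy_ge0 andbT.
  rewrite -(@leeD2lE _ (energy p Du))// adde0.
  by apply: le_trans clarkson; exact: leeD2r.
have Sz : (holder_seminorm p z <= 0)%E.
  have := morrey z Dz Hz.
  by rewrite gradient_normE Ez0 poweR0r ?mule0// invr_eq0 gt_eqF.
move=> x y; have [->//|xy] := eqVneq x y.
have := le_trans (holder_quotient_le_seminorm p z xy) Sz.
have dxy : 0 < enorm (x - y) `^ (1 - n%:R / p).
  by apply/powR_gt0/enorm_gt0; rewrite subr_eq0.
rewrite lee_fin /holder_quotient ler_pdivrMr// mul0r normr_le0 subr_eq0.
by rewrite /z => /eqP; exact: half.
Qed.

Lemma energy_hrefl p nu (c : R) u Du : \sum_i nu ord0 i ^+ 2 = 1 -> D1p p u Du ->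
  energy p (fun x => Du (hrefl nu c x) *m reflmx nu) = energy p Du.
Proof.
move=> nu1 Hu; have pS := measure_preserving_hrefl c nu1.
rewrite energy.unlock; under eq_integral do rewrite enorm_reflmx//.
have := @ge0_integral_preserving R n (hrefl nu c)
  (fun x => (enorm (Du x) `^ p)%:E) setT pS measurableT.
rewrite preimage_setT => -> //.
- by apply/measurable_EFinP; exact: measurable_energy Hu.
- by move=> x _; rewrite lee_fin powR_ge0.
Qed.

End energy.

(** * Polarization *)

Section polarization.
Context {R : realType} {n : nat}.
Implicit Types (x y nu : 'rV[R]_n) (u l : 'rV[R]_n -> R).

Local Notation mu := (lebesgue_rV n : {measure set 'rV[R]_n -> \bar R}).

(** [b] is the indicator of an [S]-invariant set on which gradients are exchanged with their mirror
    images; substituting [S] there leaves the integral unchanged. Only lengths are compared, since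
    an exchanged gradient is also reflected. *)
Lemma energy_swap (p : R) (S : 'rV[R]_n -> 'rV[R]_n) (u b : 'rV[R]_n -> R) Du Dv :
  measure_preserving S -> D1p p u Du -> measurable_fun setT b ->
  (forall x, b x = 0 \/ b x = 1) -> (forall x, b (S x) = b x) ->
  (forall x, enorm (Dv x) = b x * enorm (Du (S x)) + (1 - b x) * enorm (Du x)) ->
  energy p Dv = energy p Du.
Proof.
move=> pS Hu mb b01 bS HDv.
pose F x := enorm (Du x) `^ p.
have mF : measurable_fun setT F := measurable_energy Hu.
have F0 x : 0 <= F x by exact: powR_ge0.
have b0 x : 0 <= b x by have [->|->] := b01 x; rewrite ?ler01.
have b1 x : 0 <= 1 - b x by have [->|->] := b01 x; rewrite ?subr0 ?subrr ?ler01.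
have mbF : measurable_fun setT (fun x => (b x * F x)%:E).
  by apply/measurable_EFinP; exact: measurable_funM.
have m1bF : measurable_fun setT (fun x => ((1 - b x) * F x)%:E).
  apply/measurable_EFinP; apply: measurable_funM mF.
  exact: measurable_funB.
have mbFS : measurable_fun setT (fun x => (b x * F (S x))%:E).
  apply/measurable_EFinP; apply: (measurable_funM mb).
  exact: measurableT_comp mF pS.1.
have pos1 x : setT x -> (0 <= (b x * F x)%:E)%E by rewrite lee_fin mulr_ge0.
have pos2 x : setT x -> (0 <= ((1 - b x) * F x)%:E)%E by rewrite lee_fin mulr_ge0.
have pos3 x : setT x -> (0 <= (b x * F (S x))%:E)%E by rewrite lee_fin mulr_ge0.
have EDu : energy p Du = (\int[mu]_x (b x * F x)%:E + \int[mu]_x ((1 - b x) * F x)%:E)%E.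
  rewrite -(ge0_integralD mu measurableT pos1 mbF pos2 m1bF) unlock.
  apply: eq_integral => x _; rewrite -EFinD; congr (_%:E).
  by rewrite -/(F x); ring.
have EDv : energy p Dv = (\int[mu]_x (b x * F (S x))%:E + \int[mu]_x ((1 - b x) * F x)%:E)%E.
  rewrite -(ge0_integralD mu measurableT pos3 mbFS pos2 m1bF) unlock.
  apply: eq_integral => x _; rewrite -EFinD; congr (_%:E); rewrite HDv /F.
  have [->|->] := b01 x.
    by rewrite !mul0r !add0r subr0 !mul1r.
  by rewrite !mul1r subrr !mul0r !addr0.
have E3 : (\int[mu]_x (b x * F (S x))%:E = \int[mu]_x (b x * F x)%:E)%E.
  have E4 := @ge0_integral_preserving R n S (fun x => (b x * F x)%:E) setT pS measurableT mbF pos1.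
  rewrite preimage_setT in E4; apply: etrans E4.
  by apply: eq_integral => x _; rewrite bS.
exact: (etrans EDv (etrans (f_equal2 adde E3 erefl) (esym EDu))).
Qed.

(* On [{l > 0}] replace [u] by the larger of its values at [x] and at the
   reflected point, on the reflected region by the smaller one: the gradients
   at [x] and its mirror image are either kept or exchanged. *)
Lemma polarization (p : R) nu (c : R) u Du l : 1 <= p ->
  \sum_i nu ord0 i ^+ 2 = 1 -> D1p p u Du -> continuous l ->
  (forall x, l x = 0 -> u (hrefl nu c x) <= u x) ->
  (forall x, 0 < l x -> l (hrefl nu c x) <= 0) ->
  let E x := chi l x * Num.max (u (hrefl nu c x) - u x) 0 in
  exists2 Dv, D1p p (fun x => u x + (E x - E (hrefl nu c x))) Dv &
    energy p Dv = energy p Du.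
Proof.
move=> p1 nu1 Hu cl l0 lS E; set S := hrefl nu c; set A := reflmx nu.
have pS : measure_preserving S := measure_preserving_hrefl c nu1.
have SK : involutive S := hreflK c nu1.
have AA : A *m A = 1%:M := reflmxK nu1.
have HuS := D1p_hrefl c p1 nu1 Hu.
have Hd := D1p_lin 1 (-1) p1 HuS Hu.
pose d x := 1 * (u \o S) x + (-1) * u x.
have dE x : d x = u (S x) - u x by rewrite /d /= mul1r mulN1r.
have ld x : l x = 0 -> d x <= 0.
  by move=> /l0; rewrite dE subr_le0.
have HE := D1p_pos_part p1 cl ld Hd.
have HES := D1p_hrefl c p1 nu1 HE.
have HEE := D1p_lin 1 (-1) p1 HE HES.
have Hv := D1p_lin 1 1 p1 Hu HEE.
have cd : continuous d by have [] := Hd.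
pose B x := chi l x * chi d x.
exists (fun x => 1 *: Du x + 1 *: (1 *: (B x *: (1 *: (Du (S x) *m A) + (-1) *: Du x)) +
   (-1) *: ((B (S x) *: (1 *: (Du (S (S x)) *m A) + (-1) *: Du (S x))) *m A))).
  move: Hv; congr D1p; apply/funext => x.
  by rewrite /= -/S !mul1r !mulN1r /E -/S -dE -/S -(dE (S x)).
have B01 x : B x = 0 \/ B x = 1.
  rewrite /B /chi; case: ifP; case: ifP => _ _; rewrite ?mul1r ?mul0r; by [left|right].
have BS x : B x = 1 -> B (S x) = 0.
  rewrite /B /chi; case: ifP => lx; last by rewrite mul0r => /eqP; rewrite eq_sym oner_eq0.
  have lSx : l (S x) <= 0 := lS x lx.
  by move=> _; rewrite ltNge lSx mul0r.
apply: (energy_swap (S := S) (b := fun x => B x + B (S x)) pS Hu).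
- have mB : measurable_fun setT B.
    by apply: measurable_funM; exact: measurable_chi.
  apply: measurable_funD => //; exact: measurableT_comp mB pS.1.
- move=> x; have [B0|B1] := B01 x; first by rewrite B0 add0r; exact: B01.
  by rewrite B1 (BS _ B1) addr0; right.
- by move=> x; rewrite SK addrC.
(* In both exchanged cases the gradient is [Du (S x) *m A], as long as [Du (S x)]; on the reflected
   region [A *m A = 1] is what cancels [Du x]. *)
- move=> x; rewrite SK; have [B0|B1] := B01 x.
    rewrite B0 add0r; have [B0'|B1'] := B01 (S x).
      by rewrite B0' !scale0r mul0mx !(scaler0, addr0, scale1r) mul0r add0r subr0 mul1r.
    rewrite B1' scale0r scaler0 add0r !scale1r subrr mul0r addr0 mul1r.
    rewrite mulmxDl -mulmxA AA mulmx1 -scalemxAl !scaleN1r opprD opprK addrA subrr add0r.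
    exact: enorm_reflmx.
  rewrite B1 (BS _ B1) !scale0r mul0mx scaler0 !addr0 !scale1r subrr mul0r addr0 mul1r.
  by rewrite scaleN1r addrCA subrr addr0; exact: enorm_reflmx.
Qed.

End polarization.

Section axis.
Context {R : realType} {n : nat} (l : 'I_n).
Implicit Types (x y nu : 'rV[R]_n).

Lemma basis_vecE i j : (basis_vec i : 'rV[R]_n) ord0 j = (i == j)%:R.
Proof. by rewrite /basis_vec mxE eqxx /= eq_sym. Qed.

Lemma basis_vec_dot x : \sum_i (basis_vec l : 'rV[R]_n) ord0 i * x ord0 i = x ord0 l.
Proof.
rewrite (bigD1 l)//= basis_vecE eqxx mul1r big1 ?addr0// => i il.
by rewrite basis_vecE eq_sym (negbTE il) mul0r.
Qed.

Lemma basis_vec_unit : \sum_i (basis_vec l : 'rV[R]_n) ord0 i ^+ 2 = 1.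
Proof.
under eq_bigr do rewrite expr2.
by rewrite basis_vec_dot basis_vecE eqxx.
Qed.

Lemma hrefl_axis x : hrefl (basis_vec l) 0 x = x - (2 * x ord0 l) *: basis_vec l.
Proof. by rewrite /hrefl basis_vec_dot subr0. Qed.

Lemma hrefl_coord nu (c : R) x i : hrefl nu c x ord0 i =
  x ord0 i - 2 * (\sum_j nu ord0 j * x ord0 j - c) * nu ord0 i.
Proof. by rewrite !mxE. Qed.

Lemma enorm_hrefl0 nu x : \sum_i nu ord0 i ^+ 2 = 1 -> enorm (hrefl nu 0 x) = enorm x.
Proof. by move=> nu1; rewrite hreflE mulr0 scale0r addr0 enorm_reflmx. Qed.

End axis.

(** * Oddness and monotonicity of the extremal *)

Section monotonicity.
Context {R : realType} {n : nat} (p : R) (l : 'I_n) (u : 'rV[R]_n -> R).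
Implicit Types (x y nu : 'rV[R]_n).

Local Notation e := (basis_vec l : 'rV[R]_n).

Hypotheses (p2 : 2 <= p) (u_extremal : morrey_extremal p u).
Hypothesis u_sup : holder_seminorm p u = (holder_quotient p u e (- e))%:E.
Hypotheses (u_e : u e = 1) (u_Ne : u (- e) = -1).

Lemma basis_vec_neqN : e != - e.
Proof.
apply/eqP => /rowP/(_ l); rewrite [in RHS]mxE !basis_vecE eqxx /= => h.
have /eqP : (1 : R) = 0 by lra.
by rewrite oner_eq0.
Qed.

Lemma extremal_continuous : continuous u.
Proof. by have [C [Du [_ []]]] := u_extremal. Qed.

(** The additive constant left by [morrey_extremal_unique] is fixed at [- e]. An inequality at [e]
    is asked because polarization might a priori raise that value. The energy condition covers every
    weak gradient of [u], the one in [morrey_extremal] being existentially quantified. *)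
Lemma extremal_unique v (Du0 : forall Du, D1p p u Du -> exists2 Dv, D1p p v Dv &
    energy p Dv = energy p Du) :
  v (- e) = -1 -> 1 <= v e -> v = u.
Proof.
move=> vN v1; have [C [Du [[morrey _] Hu _ supC]]] := u_extremal.
have [Dv Hv Evu] := Du0 _ Hu.
have uab : 0 < u e - u (- e) by rewrite u_e u_Ne; lra.
have vab : u e - u (- e) <= v e - v (- e) by rewrite u_e u_Ne vN; lra.
have K := morrey_extremal_unique p2 morrey Hu Hv Evu supC u_sup basis_vec_neqN uab vab.
by apply/funext => x; have := K x (- e); rewrite u_Ne vN; lra.
Qed.

Lemma extremal_odd x : u (hrefl e 0 x) = - u x.
Proof.
have e1 := @basis_vec_unit R n l.
have refl_e : hrefl e 0 e = - e.
  by rewrite hrefl_axis basis_vecE eqxx mulr1 scaler_nat mulr2n opprD addNKr.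
have refl_Ne : hrefl e 0 (- e) = e by rewrite -refl_e hreflK.
have p1 : 1 <= p by apply: le_trans p2; rewrite ler1n.
(* The summand [0 * u x] gives the competitor the shape of [D1p_lin]. *)
suff V : (fun x => (-1) * (u \o hrefl e 0) x + 0 * u x) = u.
  have := congr1 (fun f => f (hrefl e 0 x)) V.
  by rewrite /= hreflK// mul0r addr0 mulN1r => <-.
apply: extremal_unique.
- move=> Du Hu.
  exists (fun x => (-1) *: (Du (hrefl e 0 x) *m reflmx e) + 0 *: Du x).
    exact: (D1p_lin (-1) 0 p1 (D1p_hrefl 0 p1 e1 Hu) Hu).
  rewrite -(energy_hrefl 0 e1 Hu) energy.unlock; apply: eq_integral => x0 _.
  by rewrite scaleN1r scale0r addr0 enormN.
- by rewrite /= refl_Ne u_e mul0r addr0 mulr1.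
- by rewrite /= refl_e u_Ne mul0r addr0 mulN1r opprK.
Qed.

Lemma extremal_hyperplane x : x ord0 l = 0 -> u x = 0.
Proof.
move=> xl; have := extremal_odd x.
by rewrite hrefl_axis xl mulr0 scale0r subr0; lra.
Qed.

(* Polarize across the hyperplane exchanging [x1] and [x2], on the half-space
   where the coordinate [l] is positive; [u] vanishes on the boundary of the
   latter, so the polarized function is continuous, and by uniqueness it is [u]. *)
Lemma extremal_monotone_strict x1 x2 : x1 ord0 l = x2 ord0 l -> 0 < x2 ord0 l ->
  enorm x2 < enorm x1 -> u x1 <= u x2.
Proof.
move=> x12 x2l x21.
have dn0 : x1 - x2 != 0.
  by rewrite subr_eq0; apply/eqP => xx; move: x21; rewrite xx ltxx.
have d0 := enorm_gt0 dn0; set d := enorm (x1 - x2) in d0.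
have dN0 := lt0r_neq0 d0.
pose nu := d^-1 *: (x1 - x2).
have nuE i : nu ord0 i = (x1 ord0 i - x2 ord0 i) / d.
  by rewrite !mxE mulrC.
(* The normal is orthogonal to [e]: hence [S] preserves the coordinate [l] and maps the half-space
   to itself. *)
have nul : nu ord0 l = 0 by rewrite nuE x12 subrr mul0r.
pose c := \sum_i nu ord0 i * (2^-1 *: (x1 + x2)) ord0 i.
have nu1 : \sum_i nu ord0 i ^+ 2 = 1.
  transitivity (d ^- 2 * \sum_i (x1 - x2) ord0 i ^+ 2).
    by rewrite mulr_sumr; apply: eq_bigr => i _; rewrite nuE !mxE expr_div_n mulrC.
  by rewrite -enorm_sqr mulVf// expf_neq0.
(* The strict inequality of norms enters here: it puts the origin, and with it [e], strictly on the
   side of [x2]. *)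
have c0 : 0 < c.
  have -> : c = (2 * d)^-1 * (enorm x1 ^+ 2 - enorm x2 ^+ 2).
    rewrite !enorm_sqr -sumrB mulr_sumr; apply: eq_bigr => i _.
    by rewrite nuE !mxE; field.
  rewrite mulr_gt0 ?invr_gt0 ?mulr_gt0// subr_gt0.
  by rewrite ltr_pXn2r// nnegrE sqrtr_ge0.
have nux2 : \sum_i nu ord0 i * x2 ord0 i - c = - (d / 2).
  rewrite -sumrB.
  transitivity (\sum_i - (d / 2) * nu ord0 i ^+ 2).
    by apply: eq_bigr => i _; rewrite nuE !mxE; field.
  by rewrite -mulr_sumr nu1 mulr1.
pose S := hrefl nu c.
have Sx2 : S x2 = x1.
  rewrite /S /hrefl nux2 /nu scalerA mulrN mulNr scaleNr opprK.
  have -> : 2 * (d / 2) / d = 1 by field.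
  by rewrite scale1r addrC subrK.
(* Positive exactly on the part of the open half-space that lies on the side of [x2]. *)
pose ell x := Num.min (x ord0 l) (c - \sum_i x ord0 i * nu ord0 i).
have dotC x : \sum_i x ord0 i * nu ord0 i = \sum_i nu ord0 i * x ord0 i.
  by apply: eq_bigr => i _; rewrite mulrC.
have Sl x : S x ord0 l = x ord0 l by rewrite hrefl_coord nul mulr0 subr0.
have cell : continuous ell.
  have c1 : continuous (fun x : 'rV[R]_n => x ord0 l) by move=> x; exact: coord_continuous.
  have c2 : continuous (fun x => \sum_i x ord0 i * nu ord0 i).
    exact: continuous_dot.
  have c3 : continuous (cst c : 'rV[R]_n -> R) by exact: cst_continuous.
  move=> x; exact: (continuous_min (c1 x) (continuousB (c3 x) (c2 x))).
(* The boundary of the cut has two faces: on [x ord0 l = 0] both values vanish by oddness, and on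
   the mirror [S] fixes [x]. *)
have ell0 x : ell x = 0 -> u (S x) <= u x.
  rewrite /ell; case: (leP (x ord0 l)) => _ xl.
    by rewrite !extremal_hyperplane// Sl.
  suff -> : S x = x by [].
  rewrite /S /hrefl; have -> : \sum_i nu ord0 i * x ord0 i - c = 0.
    by rewrite -dotC; lra.
  by rewrite mulr0 scale0r subr0.
have ellS x : 0 < ell x -> ell (S x) <= 0.
  rewrite /ell lt_min => /andP[_ h]; rewrite ge_min; apply/orP; right.
  have := dot_hrefl c x nu1; rewrite -/S -!dotC; lra.
have p1 : 1 <= p by apply: le_trans p2; rewrite ler1n.
pose E x := chi ell x * Num.max (u (S x) - u x) 0.
have E0 x : ell x <= 0 -> E x = 0.
  by move=> h; rewrite /E /chi ltNge h mul0r.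
(* At [- e] and its image the coordinate [l] is negative, so the value is kept; at [e] the cut-off
   is active and the value can only go up. *)
have vu : (fun x => u x + (E x - E (S x))) = u.
  apply: extremal_unique.
  - move=> Du Hu.
    exact: (polarization p1 nu1 Hu cell ell0 ellS).
  - have neg x : x ord0 l = -1 -> E x = 0.
      by move=> h; apply: E0; rewrite ge_min h lerN10.
    have el : (- e) ord0 l = -1 by rewrite mxE basis_vecE eqxx.
    by rewrite !neg ?Sl// subrr addr0.
  - have elle : 0 < ell e.
      rewrite lt_min basis_vecE eqxx ltr01 dotC /=.
      have -> : \sum_i nu ord0 i * e ord0 i = nu ord0 l.
        by rewrite -dotC basis_vec_dot.
      by rewrite nul subr0.
    rewrite (E0 (S e)) ?ellS// subr0 u_e lerDl /E mulr_ge0//.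
      by have /andP[] := chi_itv ell e.
    by rewrite le_max lexx orbT.
have ellx2 : 0 < ell x2.
  by rewrite lt_min x2l dotC /=; move: nux2; lra.
have ellx1 : ell x1 <= 0 by rewrite -Sx2; exact: ellS.
(* At [x2] the identity reads [max (u x1 - u x2) 0 = 0], because [S x2 = x1] lies outside the
   cut. *)
have := congr1 (fun f => f x2) vu.
rewrite /= Sx2 (E0 x1)// subr0 /E /chi ellx2 mul1r Sx2 => /eqP.
rewrite -subr_eq0 addrAC subrr add0r => /eqP h.
by rewrite -subr_le0 -h le_max lexx.
Qed.

(** Perturbation to the strict case: both points are raised by [t] along [e], and the other
    coordinates of [x2] are contracted by [1 - t]. Their common coordinate becomes
    [x2 ord0 l + t > 0], and continuity of [u] allows [t] to tend to [0]. *)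
Lemma extremal_monotone x1 x2 : x1 ord0 l = x2 ord0 l -> 0 <= x2 ord0 l ->
  enorm x2 <= enorm x1 -> u x1 <= u x2.
Proof.
move=> x12 x2l x21; have [->//|xx] := eqVneq x1 x2.
have cu := extremal_continuous.
pose h := x2 ord0 l.
pose y1 (t : R) := x1 + t *: e.
pose y2 (t : R) := x2 + t *: (e - (x2 - h *: e)).
have ei i : e ord0 i = (l == i)%:R by exact: basis_vecE.
have y1E t i : y1 t ord0 i = x1 ord0 i + t * (l == i)%:R.
  by rewrite /y1 -ei !mxE.
have y2E t i : y2 t ord0 i = x2 ord0 i + t * ((l == i)%:R - (x2 ord0 i - h * (l == i)%:R)).
  by rewrite /y2 -ei !mxE.
have mono t : 0 < t -> t < 1 -> u (y1 t) <= u (y2 t).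
  move=> t0 t1; apply: extremal_monotone_strict.
  - by rewrite y1E y2E eqxx /= x12 -/h; ring.
  - rewrite y2E eqxx /= -/h; have : 0 <= h := x2l.
    by rewrite !mulr1 subrr subr0 mulr1; lra.
  have sumE (f : 'I_n -> R) : \sum_i f i = f l + \sum_(i | i != l) f i.
    by rewrite (bigD1 l).
  have enE x x' : enorm x < enorm x' <-> \sum_i x ord0 i ^+ 2 < \sum_i x' ord0 i ^+ 2.
    by rewrite -!enorm_sqr ltr_pXn2r// nnegrE sqrtr_ge0.
  have enE' x x' : enorm x <= enorm x' <-> \sum_i x ord0 i ^+ 2 <= \sum_i x' ord0 i ^+ 2.
    by rewrite -!enorm_sqr ler_pXn2r// nnegrE sqrtr_ge0.
  move/enE' : x21; rewrite [X in X <= _]sumE [X in _ <= X]sumE x12 lerD2l.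
  set Q2 := \sum_(i | i != l) x2 ord0 i ^+ 2.
  set Q1 := \sum_(i | i != l) x1 ord0 i ^+ 2 => Q21.
  apply/enE; rewrite [X in X < _]sumE [X in _ < X]sumE.
  have -> : \sum_(i | i != l) y2 t ord0 i ^+ 2 = (1 - t) ^+ 2 * Q2.
    rewrite mulr_sumr; apply: eq_bigr => i il.
    by rewrite y2E eq_sym (negbTE il) /=; ring.
  have -> : \sum_(i | i != l) y1 t ord0 i ^+ 2 = Q1.
    by apply: eq_bigr => i il; rewrite y1E eq_sym (negbTE il) mulr0 addr0.
  have -> : y2 t ord0 l = y1 t ord0 l.
    by rewrite y1E y2E eqxx /= x12 -/h; ring.
  rewrite ltrD2l.
  have Q20 : 0 <= Q2 by apply: sumr_ge0 => i _; exact: sqr_ge0.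
  (* If [Q1] vanished, so would the smaller [Q2], and the two points would coincide. Positivity
     gives the strict inequality when [Q2 = 0], where contraction has no effect. *)
  have Q10 : 0 < Q1.
    rewrite lt_neqAle (le_trans Q20 Q21) andbT eq_sym.
    apply: contra_neq xx => Q1z.
    have zero (f : 'I_n -> R) : \sum_(i | i != l) f i ^+ 2 = 0 ->
        forall i, i != l -> f i = 0.
      move=> /eqP; rewrite psumr_eq0; last by move=> i _; exact: sqr_ge0.
      move=> /allP H i il; have := H i (mem_index_enum i).
      by rewrite il /= sqrf_eq0 => /eqP.
    have Q2z : Q2 = 0 by apply/le_anti; rewrite Q20 -Q1z Q21.
    apply/rowP => i; have [->//|il] := eqVneq i l.
    by rewrite (zero _ Q1z)// (zero _ Q2z).
  have [->|Q2n] := eqVneq Q2 0; first by rewrite mulr0.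
  have Q2p : 0 < Q2 by rewrite lt_neqAle eq_sym Q2n.
  have tt : (1 - t) ^+ 2 < 1 by rewrite expr_lt1//; lra.
  by apply: lt_le_trans Q21; rewrite gtr_pMl.
have line_cvg (y w : 'rV[R]_n) : u (y + t *: w) @[t --> (0 : R)] --> u y.
  have c1 : {for (0 : R), continuous (fun t : R => t *: w)}.
    by apply: continuousZr_tmp; exact: cvg_id.
  have c2 : {for (0 : R), continuous (fun _ : R => y)} by exact: cst_continuous.
  have cline : {for (0 : R), continuous (fun t : R => y + t *: w)}.
    exact: (continuousD c2 c1).
  have : u (y + t *: w) @[t --> (0 : R)] --> u (y + 0 *: w).
    exact: (continuous_comp cline (cu _)).
  by rewrite scale0r addr0.
have cy1 : u (y1 t) @[t --> (0 : R)^'+] --> u x1.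
  exact: cvg_at_right_filter (line_cvg _ _).
have cy2 : u (y2 t) @[t --> (0 : R)^'+] --> u x2.
  exact: cvg_at_right_filter (line_cvg _ _).
apply: (ler_cvg_to cy1 cy2).
near=> t; apply: mono; first by near: t; exact: nbhs_right_gt.
by near: t; exact: nbhs_right_lt.
Unshelve. all: by end_near. Qed.

End monotonicity.

Theorem theorem1p2 (R : realType) (n : nat) (p : R) (l : 'I_n)
    (u : 'rV[R]_n -> R)
    (n_ge2 : (2 <= n)%N) (p_gt_n : n%:R < p)
    (l_last : l.+1 = n) (* l is the index of the nth coordinate *)
    (u_extremal : morrey_extremal p u)
    (u_sup : holder_seminorm p u =
       (holder_quotient p u (basis_vec l) (- basis_vec l))%:E)
    (u_en : u (basis_vec l) = 1) (u_Nen : u (- basis_vec l) = -1)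
    (x1 x2 : 'rV[R]_n) :
  (x1 ord0 l = x2 ord0 l /\ 0 <= x2 ord0 l /\ enorm x2 <= enorm x1) \/
  (x1 ord0 l = x2 ord0 l /\ x2 ord0 l <= 0 /\ enorm x1 <= enorm x2) ->
  u x1 <= u x2.
Proof.
have p2 : 2 <= p by apply/ltW; apply: le_lt_trans p_gt_n; rewrite ler_nat.
have mono := extremal_monotone p2 u_extremal u_sup u_en u_Nen.
have odd := extremal_odd p2 u_extremal u_sup u_en u_Nen.
case=> [[x12 [x2l x21]]|[x12 [x2l x21]]]; first exact: mono.
have e1 := @basis_vec_unit R n l.
(* Reflection turns the lower half-space into the upper one, and the sign exchanges the roles of the
   two points. *)
rewrite -lerN2 -!odd; apply: mono.
- by rewrite !hrefl_coord !basis_vec_dot x12.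
- by rewrite hrefl_coord basis_vec_dot basis_vecE eqxx /= x12; lra.
- by rewrite !enorm_hrefl0.
Qed.
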